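(* Let $n\geqslant 1$, let $Q=\{x\in\mathbb{R}^{n+1} : x_0\pm x_i\geqslant 0,\ i=1,\dots,n\}$ be the cone over the $n$-cube, and let $C=\{x\in\mathbb{R}^{n+1} : x_0\geqslant |x_1|+\dots+|x_n|\}$ be the cone over the cross-polytope (the dual cone of $Q$). Let $Q^{\max}$ be the maximal operator system over $Q$ and $C^{\min}$ the minimal operator system over $C$. (i) For $n=1$, $Q^{\max}$ is $1$-minimal and $C^{\min}$ is $1$-subhomogeneous. (ii) For $n=2$, $Q^{\max}$ is $2$-minimal and $C^{\min}$ is $2$-subhomogeneous. (iii) For $n\geqslant 3$, $Q^{\max}$ is not $d$-minimal and $C^{\min}$ is not $d$-subhomogeneous for any $d\in\mathbb{N}$.
   Context: ${\rm Her}_s(\mathbb{C})\subseteq{\rm Mat}_s(\mathbb{C})$ is the real space of hermitian $s\times s$ matrices. A convex cone is proper if it is closed, pointed ($C\cap -C=\{0\}$) and has non-empty interior. An operator system $S$ on a finite-dimensional real vector space $V$ is a collection of proper convex cones $S_s\subseteq V\otimes{\rm Her}_s(\mathbb{C})$, $s\in\mathbb{N}=\{1,2,\dots\}$, with a distinguished interior point $u\in S_1$ (order unit), such that $m^*S_sm\subseteq S_t$ for all $s,t$ and $m\in{\rm Mat}_{s,t}(\mathbb{C})$, where $m^*(v\otimes h)m=v\otimes m^*hm$. For $V=\mathbb{R}^{n+1}$ one identifies $V\otimes{\rm Her}_s(\mathbb{C})={\rm Her}_s(\mathbb{C})^{n+1}$. Every unital $C^*$-algebra $A$ is regarded as an operator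 system on $A_{\rm sa}$, with level-$s$ cone the positive elements of ${\rm Mat}_s(A)$ and order unit $1$. For a proper cone $K\subseteq V$, the minimal operator system $K^{\min}$ (respectively maximal operator system $K^{\max}$) is the smallest (respectively largest) operator system on $V$, with respect to level-wise inclusion, whose first level is $K$. For both cones here one may take $(1,0,\dots,0)$ as order unit. $S$ is $d$-minimal if for every $s$ the cone $S_s$ consists exactly of all finite sums $\sum_i v_i^*x_iv_i$ with $x_i\in S_d$ and $v_i\in{\rm Mat}_{d,s}(\mathbb{C})$. $S$ is $d$-subhomogeneous if it has a $d$-commutative realization: a linear map $\psi\colon V\to {\rm Mat}_d(A)_{\rm sa}$, for some commutative unital $C^*$-algebra $A$, sending the order unit of $S$ to $1$ and such that for all $s$ and all $a\in V\otimes{\rm Her}_s(\mathbb{C})$: $a\in S_s$ if and only if $(\psi\otimes{\rm id}_{{\rm Her}_s(\mathbb{C})})(a)$ is positive in ${\rm Mat}_{ds}(A)$. *)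

(* Defs.v *)
From HB Require Import structures.
From mathcomp Require Import all_boot all_order all_algebra.
From mathcomp Require Import complex mxtens.
From mathcomp Require Import all_classical all_reals all_analysis.
Set Implicit Arguments.
Unset Strict Implicit.
Unset Printing Implicit Defensive.
Import Order.TTheory GRing.Theory Num.Theory numFieldNormedType.Exports.
Local Open Scope classical_set_scope.
Local Open Scope complex_scope.
Local Open Scope sesquilinear_scope.
Local Open Scope ring_scope.

(* The topology of numFieldType is not found on the concrete type R[i];
   this transports it there, so that matrices over R[i] get one too. *)
HB.instance Definition _ (R : realType) := NormedModule.copy R[i] R[i]^o.

(* Commutative unital C*-algebras over R[i].  A plain record over comAlgType,
   because MathComp has no join of its ring and normed-module hierarchies. *)
Record comCStar (R : realType) := ComCStar {
  cstar_alg :> comAlgType R[i];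
  star : cstar_alg -> cstar_alg;
  cnorm : cstar_alg -> R;
  starD : forall x y, star (x + y) = star x + star y;
  starZ : forall (k : R[i]) x, star (k *: x) = Num.conj k *: star x;
  starM : forall x y, star (x * y) = star y * star x;
  starK : involutive star;
  cnormD_le : forall x y, cnorm (x + y) <= cnorm x + cnorm y;
  cnormZ : forall (k : R[i]) x, (cnorm (k *: x))%:C = `|k| * (cnorm x)%:C;
  cnorm0_eq0 : forall x, cnorm x = 0 -> x = 0;
  cnormM_le : forall x y, cnorm (x * y) <= cnorm x * cnorm y;
  cnorm_starM : forall x, cnorm (star x * x) = cnorm x ^+ 2;
  cnorm_complete : forall u : nat -> cstar_alg,
    (forall e : R, 0 < e -> exists n0 : nat, forall p q : nat,
       (n0 <= p)%N -> (n0 <= q)%N -> cnorm (u p - u q) < e) ->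
    exists l, (fun p => cnorm (u p - l)) @ \oo --> (0 : R)
}.

Section CStarMatrix.
Variables (R : realType) (A : comCStar R).

Definition selfadjmx m (x : 'M[A]_m) : Prop := x ^t (@star R A) = x.

Definition invertiblemx m (x : 'M[A]_m) : Prop :=
  exists y : 'M[A]_m, x *m y = 1%:M /\ y *m x = 1%:M.

(* Positivity in the C*-algebra Mat_m(A): self-adjoint, and every spectral
   value is real and nonnegative (which is what 0 <= k means in R[i]). *)
Definition posmx m (x : 'M[A]_m) : Prop :=
  selfadjmx x /\
  forall k : R[i], ~ invertiblemx (x - (k%:A : A)%:M) -> 0 <= k.

End CStarMatrix.

(* Her_s(C)^N is the set of hermitian elements of 'rV['M[R[i]]_s]_N, which
   carries the product topology. *)
Definition hermtuple (R : realType) N s : set 'rV['M[R[i]]_s]_N :=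
  [set x | forall j, x 0 j \is hermsymmx].
Arguments hermtuple : clear implicits.

Definition compress (R : realType) N s t (m : 'M[R[i]]_(s, t))
    (x : 'rV['M[R[i]]_s]_N) : 'rV['M[R[i]]_t]_N :=
  map_mx (fun h => m ^t* *m h *m m) x.

(* Interior is taken relative to Her_s(C)^N; that set being closed, closedness
   may be read in the ambient space. *)
Record proper_cone (R : realType) N s (S : set 'rV['M[R[i]]_s]_N) : Prop := {
  cone_herm : S `<=` hermtuple R N s;
  cone0 : S 0;
  coneD : forall x y, S x -> S y -> S (x + y);
  coneZ : forall (r : R) x, 0 <= r -> S x -> S (map_mx ( *:%R r%:C) x);
  cone_closed : closed S;
  cone_pointed : forall x, S x -> S (- x) -> x = 0;
  cone_interior : exists2 x, hermtuple R N s x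
    & \forall y \near x, hermtuple R N s y -> S y
}.

(* R^N identified with Her_1(C)^N. *)
Definition first_level (R : realType) N
    (S : forall s, set 'rV['M[R[i]]_s]_N) : set 'rV[R]_N :=
  [set x | S 1%N (map_mx (fun r => (r%:C)%:M) x)].

(* Operator systems on R^N.  Levels are indexed by s >= 1; the value at s = 0
   is unconstrained and must never be used. *)
Record opsystem (R : realType) N := OpSystem {
  level :> forall s, set 'rV['M[R[i]]_s]_N;
  order_unit : 'rV[R]_N;
  level_proper : forall s, (0 < s)%N -> proper_cone (@level s);
  level_compress : forall s t (m : 'M[R[i]]_(s, t)) x,
    (0 < s)%N -> (0 < t)%N -> @level s x -> @level t (compress m x);
  order_unit_interior : (first_level level)^° order_unit
}.
Arguments level {R N} _ s _.

Definition minimal_over (R : realType) N (K : set 'rV[R]_N)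
    (S : opsystem R N) : Prop :=
  first_level S = K /\
  forall T : opsystem R N, first_level T = K ->
    forall s, (0 < s)%N -> S s `<=` T s.

Definition maximal_over (R : realType) N (K : set 'rV[R]_N)
    (S : opsystem R N) : Prop :=
  first_level S = K /\
  forall T : opsystem R N, first_level T = K ->
    forall s, (0 < s)%N -> T s `<=` S s.

Definition dminimal (R : realType) N (d : nat) (S : opsystem R N) : Prop :=
  forall s, (0 < s)%N ->
    S s = [set a | exists k (x : 'I_k -> 'rV['M[R[i]]_d]_N)
                     (v : 'I_k -> 'M[R[i]]_(d, s)),
             (forall i, S d (x i)) /\ a = \sum_(i < k) compress (v i) (x i)].

(* psi (x) id_{Her_s} on Her_s(C)^N = R^N (x) Her_s(C), with values in
   Mat_d(A) (x) Mat_s(C) = Mat_(d * s)(A) via the Kronecker product. *)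
Definition amplify (R : realType) (A : comCStar R) N d
    (psi : 'rV[R]_N -> 'M[A]_d) s (a : 'rV['M[R[i]]_s]_N) : 'M[A]_(d * s) :=
  \sum_(j < N) tensmx (psi (delta_mx 0 j)) (map_mx (in_alg A) (a 0 j)).

Record dcommutative_realization (R : realType) N (d : nat) (S : opsystem R N)
    (A : comCStar R) (psi : 'rV[R]_N -> 'M[A]_d) : Prop := {
  realization_linear : forall (r : R) x y,
    psi (r *: x + y) = map_mx ( *:%R r%:C) (psi x) + psi y;
  realization_selfadj : forall x, selfadjmx (psi x);
  realization_unit : psi (order_unit S) = 1%:M;
  realization_pos : forall s (a : 'rV['M[R[i]]_s]_N), (0 < s)%N ->
    hermtuple R N s a -> (S s a <-> posmx (amplify psi a))
}.

Definition dsubhomogeneous (R : realType) N (d : nat) (S : opsystem R N) : Prop :=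
  exists (A : comCStar R) (psi : 'rV[R]_N -> 'M[A]_d),
    dcommutative_realization S psi.

Definition cube_cone (R : realType) n : set 'rV[R]_n.+1 :=
  [set x | forall i : 'I_n, 0 <= x 0 ord0 + x 0 (lift ord0 i) /\
                            0 <= x 0 ord0 - x 0 (lift ord0 i)].
Arguments cube_cone : clear implicits.

Definition cross_cone (R : realType) n : set 'rV[R]_n.+1 :=
  [set x | \sum_(i < n) `|x 0 (lift ord0 i)| <= x 0 ord0].
Arguments cross_cone : clear implicits.

(* Main.v *)
(* Write Q_s for the tuples y of hermitian matrices with y_0 + y_i and y_0 - y_i
   positive semidefinite; these are the levels of the maximal system over the
   cube.  Under the pairing sum_j tr (a_j y_j^T), the levels of the minimal system
   over the cross-polytope are the dual cones of the Q_s: the dual cones form an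
   operator system, and conversely a point outside the minimal system is separated
   from it by a functional, which lies in Q_s.  Both halves of each part thus
   concern the elements v^* x v with x in Q_d.

   For n = 2 normalize y_0 to 1.  Hermitian contractions are convex combinations
   of symmetries, and a pair of symmetries decomposes into pairs of size at most 2,
   so Q_s consists of sums of v^* x v with x in Q_2 and x_0 = 1.  Evaluation at all
   such x is a realization over the bounded functions of x.

   For n >= 3 choose symmetries u_i of size d + 1, the first three of which have
   only scalars in their commutant.  If y = v^* x v with x in Q_d and
   sum_i tr (u_i y_i) is close to its upper bound n tr y_0, then y_0 almost commutes
   with the u_i and so is almost scalar, which its rank (at most d) forbids.  Hence
   a = (n - e, - u_1, ..., - u_n) is nonnegative on all these y for some e > 0, but
   it is negative on (1, u_1, ..., u_n).  This refutes d-minimality.  A realization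
   over a commutative C*-algebra becomes, under each character, a tuple x in Q_d
   with x_0 = 1; as non-invertible elements are killed by characters, a would be
   positive in the realization without belonging to the minimal system. *)

(* In the obstruction one [e] has to serve for all [v] and [x] at once, so strictness of each single
   inequality is not enough; hence the explicit estimates, all proportional to [tr y_0]. They
   concern a single [v^* x v], since the conclusion passes to sums. Closeness to the upper bound
   forces almost commutation because, for a symmetry [u] with spectral projections [p] and [q], the
   deficit [tr y_0 - tr (u y_i)] is the trace of [p (y_0 - y_i) p] plus that of [q (y_0 + y_i) q],
   both positive; when both are small, Cauchy-Schwarz puts [y_0] close to [y_i u]. Positivity in
   [Mat_m(A)] is defined by the spectrum, and determinants reduce invertibility of a matrix to
   invertibility of one element of [A]. That is where characters enter; their existence rests on a
   Gelfand-Mazur argument for the quotient seminorm of a maximal ideal. *)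
From HB Require Import structures.
Require Import Defs.
From mathcomp Require Import all_boot all_order all_algebra.
From mathcomp Require Import complex mxtens ring lra.
From mathcomp Require Import all_classical all_reals all_analysis.
Set Implicit Arguments.
Unset Strict Implicit.
Unset Printing Implicit Defensive.
Import Order.TTheory GRing.Theory Num.Theory numFieldNormedType.Exports.
Local Open Scope classical_set_scope.
Local Open Scope complex_scope.
Local Open Scope sesquilinear_scope.
Local Open Scope ring_scope.

(** * Positive semidefinite matrices and dilations *)

Section PositiveSemidefinite.
Variable C : numClosedFieldType.

Lemma hermsymmxP n (M : 'M[C]_n) : reflect (M^t* = M) (M \is hermsymmx).
Proof.
by rewrite qualifE /= expr0 scale1r eq_sym; apply: eqP.
Qed.

Lemma conjtr_mul m n p (M : 'M[C]_(m, n)) (P : 'M[C]_(n, p)) :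
  (M *m P)^t* = P^t* *m M^t*.
Proof. by rewrite trmx_mul map_mxM. Qed.

Lemma conjtrD m n (M P : 'M[C]_(m, n)) : (M + P)^t* = M^t* + P^t*.
Proof. by rewrite linearD /= map_mxD. Qed.

Lemma conjtrN m n (M : 'M[C]_(m, n)) : (- M)^t* = - M^t*.
Proof. by rewrite linearN /= map_mxN. Qed.

Lemma conjtr1 n : (1%:M : 'M[C]_n)^t* = 1%:M.
Proof. by rewrite trmx1 map_mx1. Qed.

Lemma half_double m n (M : 'M[C]_(m, n)) : 2^-1 *: (M + M) = M.
Proof.
by rewrite -[X in X + _]scale1r -[X in _ + X]scale1r -scalerDl scalerA mulVf ?scale1r.
Qed.

Definition sform n (M : 'M[C]_n) (x y : 'cV[C]_n) : C := (x^t* *m M *m y) 0 0.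

Lemma sformE n (M : 'M[C]_n) x y :
  sform M x y = \sum_i \sum_j (x i 0)^* * M i j * y j 0.
Proof.
rewrite /sform !mxE exchange_big /=; apply: eq_bigr => j _.
rewrite !mxE mulr_suml; apply: eq_bigr => i _; by rewrite !mxE.
Qed.

Lemma sform_delta n (M : 'M[C]_n) i j :
  sform M (delta_mx i 0) (delta_mx j 0) = M i j.
Proof.
by rewrite /sform -colE trmx_delta map_delta_mx -rowE !mxE.
Qed.

Lemma sformDl n (M : 'M[C]_n) x x' y : sform M (x + x') y = sform M x y + sform M
  x' y.
Proof. by rewrite /sform conjtrD !mulmxDl mxE. Qed.

Lemma sformDr n (M : 'M[C]_n) x y y' : sform M x (y + y') = sform M x y + sform M
  x y'.
Proof. by rewrite /sform !mulmxDr mxE. Qed.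

Lemma sformZl n (M : 'M[C]_n) a x y : sform M (a *: x) y = a^* * sform M x y.
Proof. by rewrite /sform linearZ /= map_mxZ -!scalemxAl mxE. Qed.

Lemma sformZr n (M : 'M[C]_n) a x y : sform M x (a *: y) = a * sform M x y.
Proof. by rewrite /sform -!scalemxAr mxE. Qed.

Lemma sform_congr m n (P : 'M[C]_(m, n)) (M : 'M[C]_m) x y :
  sform (P^t* *m M *m P) x y = sform M (P *m x) (P *m y).
Proof. by rewrite /sform conjtr_mul !mulmxA. Qed.

Lemma sformD n (M P : 'M[C]_n) x y : sform (M + P) x y = sform M x y + sform P x y.
Proof. by rewrite /sform mulmxDr mulmxDl mxE. Qed.

Lemma sform_conj n (M : 'M[C]_n) x y : (sform M x y)^* = sform (M^t*) y x.
Proof.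
rewrite !sformE rmorph_sum exchange_big /=; apply: eq_bigr => i _.
rewrite rmorph_sum; apply: eq_bigr => j _.
rewrite !mxE !rmorphM /=; by rewrite conjCK; ring.
Qed.

Definition psdmx n (M : 'M[C]_n) : Prop := forall x, 0 <= sform M x x.

Lemma psdmxD n (M P : 'M[C]_n) : psdmx M -> psdmx P -> psdmx (M + P).
Proof. by move=> Mp Pp x; rewrite sformD addr_ge0. Qed.

Lemma psdmx_congr m n (P : 'M[C]_(m, n)) (M : 'M[C]_m) :
  psdmx M -> psdmx (P^t* *m M *m P).
Proof. by move=> Mp x; rewrite sform_congr. Qed.

Lemma psdmxZ n (M : 'M[C]_n) a : 0 <= a -> psdmx M -> psdmx (a *: M).
Proof.
move=> a0 Mp x; rewrite /sform -scalemxAr -scalemxAl mxE mulr_ge0 //; exact: Mp.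
Qed.

Lemma psdmx_diag n (M : 'M[C]_n) i : psdmx M -> 0 <= M i i.
Proof. by move=> Mp; rewrite -(sform_delta M); apply: Mp. Qed.

Lemma psdmx_trace n (M : 'M[C]_n) : psdmx M -> 0 <= \tr M.
Proof. by move=> Mp; apply: sumr_ge0 => i _; apply: psdmx_diag. Qed.

Lemma psdmx_diag_trace n (M : 'M[C]_n) i : psdmx M -> M i i <= \tr M.
Proof.
move=> Mp; rewrite /mxtrace (bigD1 i) //= lerDl.
by apply: sumr_ge0 => j _; apply: psdmx_diag.
Qed.

(** Polarization: the form is real at [e_i + a e_j], and adding the relations for [a = 1] and
    [a = 'i] isolates [M i j]. *)
Lemma psdmx_herm n (M : 'M[C]_n) : psdmx M -> M \is hermsymmx.
Proof.
move=> Mp; apply/hermsymmxP/matrixP => i j; rewrite !mxE.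
have Mr x : (sform M x x)^* = sform M x x by apply: CrealP; apply: ger0_real.
have h a : a^* * (M i j)^* + a * (M j i)^* = a * M i j + a^* * M j i.
  have Hi := Mr (delta_mx i 0); have Hj := Mr (delta_mx j 0).
  rewrite !sform_delta in Hi Hj.
  have := Mr (delta_mx i 0 + a *: delta_mx j 0).
  rewrite !(sformDl, sformDr, sformZl, sformZr, sform_delta).
  rewrite !(rmorphD, rmorphM) /= !conjCK Hi Hj => e.
  by apply/eqP; rewrite -subr_eq0; apply/eqP; move/eqP: e;
    rewrite -subr_eq0 => /eqP <-; ring.
have h1 := h 1; have hi := h 'i.
have {}hi : (M j i)^* - (M i j)^* = M i j - M j i.
  apply: (mulfI (neq0Ci C)); rewrite conjCi in hi.
  by rewrite !mulrBr -[in RHS]mulNr -hi; ring.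
rewrite rmorph1 !mul1r in h1.
have two : (2 : C) != 0 by rewrite pnatr_eq0.
apply: (mulfI two); apply/eqP; rewrite -subr_eq0; apply/eqP.
transitivity (((M i j)^* + (M j i)^* - (M i j + M j i)) +
  ((M j i)^* - (M i j)^* - (M i j - M j i))); first by ring.
by rewrite h1 hi !subrr addr0.
Qed.

(* Nonnegativity of the form at [x + t y] with [t = - (form y x) / form y y];
   when [form y y = 0], at [t = - r (form y x)] with [r] large. *)
Lemma psdmx_cauchy n (M : 'M[C]_n) x y : psdmx M ->
  `|sform M x y| ^+ 2 <= sform M x x * sform M y y.
Proof.
move=> Mp; have /hermsymmxP Mh := psdmx_herm Mp.
set c := sform M x y; set a := sform M x x; set b := sform M y y.
have cE : sform M y x = c^* by rewrite sform_conj Mh.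
have a0 : 0 <= a := Mp x. have b0 : 0 <= b := Mp y.
have key r : r \is Num.real -> 0 <= a - 2 * r * `|c| ^+ 2 + r ^+ 2 * `|c| ^+ 2 * b.
  move=> /CrealP rr; have := Mp (x + (- r * c^*) *: y).
  rewrite !(sformDl, sformDr, sformZl, sformZr) -/a -/b -/c cE.
  rewrite rmorphM rmorphN /= rr conjCK normCK.
  set z := (X in 0 <= X -> _); set w := (X in _ -> 0 <= X).
  by suff -> : z = w by []; rewrite /z /w; ring.
have [b00|b_neq0] := eqVneq b 0; last first.
  have b_gt0 : 0 < b by rewrite lt0r b_neq0.
  have := key b^-1 (ger0_real _); rewrite invr_ge0 => /(_ b0) h.
  rewrite -ler_pdivrMr // -subr_ge0; apply: le_trans h _.
  rewrite le_eqVlt; apply/orP; left; apply/eqP; field; exact: lt0r_neq0.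
rewrite b00 mulr0; have [->|c0] := eqVneq c 0; first by rewrite normr0 expr0n.
have c2 : 0 < `|c| ^+ 2 by rewrite exprn_gt0 // normr_gt0.
have rr : (a + 1) / `|c| ^+ 2 \is Num.real.
  by apply: ger0_real; rewrite divr_ge0 ?addr_ge0 ?(ltW c2).
have := key _ rr; rewrite b00 mulr0 addr0 -mulrA divfK ?gt_eqF // => h.
suff h2 : a + 2 <= 0 by have := lt_le_trans (ltr_wpDl a0 (ltr0n C 2)) h2; rewrite
  ltxx.
by rewrite -oppr_ge0; apply: le_trans h _; rewrite le_eqVlt; apply/orP; left;
  apply/eqP; ring.
Qed.

(* Typing [diag_mx] over the semiring of [C] makes the [mulmx] lemmas apply. *)
Local Notation diagmx := (@diag_mx (C : pzSemiRingType) _).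

Lemma mulmxdE m n (M : 'M[C]_(m, n)) (d : 'rV[C]_n) i j :
  (M *m diagmx d) i j = M i j * d 0 j.
Proof. by rewrite mul_mx_diag mxE. Qed.

Lemma muldmxE m n (M : 'M[C]_(m, n)) (d : 'rV[C]_m) i j :
  (diagmx d *m M) i j = d 0 i * M i j.
Proof. by rewrite mul_diag_mx mxE. Qed.

Lemma psdmx_eq0 n (M : 'M[C]_n) k l : psdmx M -> M k k = 0 -> M k l = 0.
Proof.
move=> Mp Mkk; have := psdmx_cauchy (delta_mx k 0) (delta_mx l 0) Mp.
rewrite !sform_delta Mkk mul0r => h; apply/eqP; rewrite -normr_eq0 -sqrf_eq0.
by rewrite eq_le h exprn_ge0.
Qed.

Lemma psdmx_gram m n (P : 'M[C]_(m, n)) : psdmx (P^t* *m P).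
Proof.
move=> x; rewrite /sform mulmxA -mulmxA -conjtr_mul mxE.
by apply: sumr_ge0 => i _; rewrite !mxE mulrC mul_conjC_ge0.
Qed.

Lemma psdmx1 n : psdmx (1%:M : 'M[C]_n).
Proof. by rewrite -[1%:M]mulmx1 -{1}conjtr1; apply: psdmx_gram. Qed.

Lemma conjtr_diag n (d : 'rV[C]_n) :
  (forall i, d 0 i \is Num.real) -> (diagmx d)^t* = diagmx d.
Proof.
move=> dr; rewrite tr_diag_mx map_diag_mx; congr diag_mx; apply/rowP => i.
by rewrite mxE; apply: CrealP.
Qed.

Lemma psdmx_diag_mx n (d : 'rV[C]_n) : (forall i, 0 <= d 0 i) -> psdmx (diagmx d).
Proof.
move=> d0 x; rewrite sformE; apply: sumr_ge0 => i _.
rewrite (bigD1 i) //= big1 => [|j ji]; last first.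
  by rewrite mxE eq_sym (negbTE ji) mulr0n mulr0 mul0r.
by rewrite addr0 mxE eqxx mulr1n mulrAC mulr_ge0 // mulrC mul_conjC_ge0.
Qed.

Lemma herm_diag n (M : 'M[C]_n) : M \is hermsymmx ->
  exists (U : 'M[C]_n) (d : 'rV[C]_n), [/\ U *m U^t* = 1%:M, U^t* *m U = 1%:M,
    forall i, d 0 i \is Num.real & M = U^t* *m diagmx d *m U].
Proof.
move=> Mh; have Un := spectral_unitarymx M; have /unitarymxP UU := Un.
exists (spectralmx M), (spectral_diag M); split => //.
- exact: mulmx1C.
- by move=> i; have /mxOverP := hermitian_spectral_diag_real Mh; apply.
by rewrite -(invmx_unitary Un); apply/orthomx_spectralP/hermitian_normalmx.
Qed.

Lemma psdmx_diagP n (M : 'M[C]_n) : psdmx M ->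
  exists (U : 'M[C]_n) (d : 'rV[C]_n), [/\ U *m U^t* = 1%:M, U^t* *m U = 1%:M,
    forall i, 0 <= d 0 i & M = U^t* *m diagmx d *m U].
Proof.
move=> Mp; have [U [d [U1 U2 _ E]]] := herm_diag (psdmx_herm Mp).
exists U, d; split => // i.
suff dE : diagmx d = U^t*^t* *m M *m U^t*.
  have := psdmx_diag i (psdmx_congr (U^t*) Mp).
  by rewrite -dE mxE eqxx mulr1n.
by rewrite trmxCK E !mulmxA U1 mul1mx -mulmxA U1 mulmx1.
Qed.

Lemma psdmx_sum_rank1 n (M : 'M[C]_n) : psdmx M ->
  exists w : 'I_n -> 'rV[C]_n, M = \sum_i (w i)^t* *m w i.
Proof.
move=> /psdmx_diagP[U [d [_ _ d0 ->]]]; exists (fun i => sqrtC (d 0 i) *: row i U).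
apply/matrixP => p q; rewrite summxE !mxE; apply: eq_bigr => i _.
rewrite mulmxdE !mxE big_ord1 !mxE rmorphM /=.
rewrite (CrealP (ger0_real (_ : 0 <= sqrtC (d 0 i)))) ?sqrtC_ge0 //.
rewrite -{1}[d 0 i]sqrtCK; ring.
Qed.

(** Eigenvalues enter through determinants because ring morphisms transport the spectrum of a matrix
    over a C*-algebra in that form. *)
Lemma psdmx_eigenvalue n (M : 'M[C]_n) : M \is hermsymmx ->
  (forall k, \det (M - k%:M) = 0 -> 0 <= k) -> psdmx M.
Proof.
move=> /herm_diag[U [d [U1 U2 _ ->]]] h; apply/psdmx_congr/psdmx_diag_mx => i.
apply: h; have -> : U^t* *m diagmx d *m U - (d 0 i)%:M =
    U^t* *m (diagmx d - (d 0 i)%:M) *m U.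
  by rewrite mulmxBr mulmxBl mul_mx_scalar -scalemxAl U2 scalemx1.
rewrite -diag_const_mx -linearB /= !det_mulmx det_diag (bigD1 i) //= !mxE subrr.
by rewrite mul0r mulr0 mul0r.
Qed.

(* [b] and [b i] are compressed by [b^(-1/2)]; the kernel of [b] lies in that
   of [b i], so the convention [0^-1 = 0] does no harm. *)
Lemma psdmx_normalize (I : Type) n (b : 'M[C]_n) (y : I -> 'M[C]_n) :
  psdmx b -> (forall i, psdmx (b + y i)) -> (forall i, psdmx (b - y i)) ->
  exists (w : 'M[C]_n) (c : I -> 'M[C]_n),
    [/\ b = w^t* *m w, forall i, y i = w^t* *m c i *m w,
        forall i, psdmx (1%:M + c i) & forall i, psdmx (1%:M - c i)].
Proof.
move=> /psdmx_diagP[U [d [U1 U2 d0 bE]]] yp ym.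
pose z i := U *m y i *m U^t*.
pose g : 'M[C]_n := diagmx (\row_k sqrtC (d 0 k)).
pose gi : 'M[C]_n := diagmx (\row_k (sqrtC (d 0 k))^-1).
have s0 k : 0 <= sqrtC (d 0 k) by rewrite sqrtC_ge0.
have gh : g^t* = g by apply: conjtr_diag => k; rewrite mxE ger0_real.
have gih : gi^t* = gi by apply: conjtr_diag => k; rewrite mxE ger0_real ?invr_ge0.
have psdc (e : 'M[C]_n) : psdmx (b + U^t* *m e *m U) -> psdmx (diagmx d + e).
  move=> /(psdmx_congr (U^t*)); rewrite trmxCK bE mulmxDr mulmxDl.
  by rewrite !mulmxA !U1 !mul1mx -!mulmxA !U1 !mulmx1.
have zE i : y i = U^t* *m z i *m U.
  by rewrite /z !mulmxA U2 mul1mx -mulmxA U2 mulmx1.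
clearbody z.
have zp i : psdmx (diagmx d + z i) by apply: psdc; rewrite -zE.
have zm i : psdmx (diagmx d - z i).
  by apply: psdc; rewrite mulmxN mulNmx -zE.
(* Where [d] vanishes, the diagonal entry of [z i] and its opposite are both nonnegative, so it is
   zero, and by Cauchy-Schwarz so is the row. *)
have z0 i k l : d 0 k = 0 -> z i k l = 0.
  move=> dk; have zkk : z i k k = 0.
    have := psdmx_diag k (zp i); have := psdmx_diag k (zm i).
    rewrite !mxE eqxx dk mulr1n !add0r oppr_ge0 => h1 h2.
    by apply/eqP; rewrite eq_le h1 h2.
  have := psdmx_eq0 l (zp i) (k := k); rewrite !mxE eqxx dk zkk mulr1n addr0.
  by move=> /(_ erefl); rewrite mul0rn add0r.
have zh i : (z i)^t* = z i.
  have /hermsymmxP := psdmx_herm (zp i).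
  by rewrite conjtrD conjtr_diag => [/addrI //|k]; rewrite ger0_real.
have z0' i k l : d 0 l = 0 -> z i k l = 0.
  by move=> dl; rewrite -zh !mxE z0 // rmorph0.
have normp (e : 'M[C]_n) : psdmx (diagmx d + e) -> psdmx (1%:M + gi *m e *m gi).
  move=> /(psdmx_congr gi); rewrite gih mulmxDr mulmxDl => h.
  (* [gi] turns [diag d] into the projection onto its range; [q] is the projection onto the kernel,
     which restores the identity. *)
  pose q := diagmx (\row_k (d 0 k == 0)%:R) : 'M[C]_n.
  have -> : 1%:M = q + gi *m diagmx d *m gi.
    apply/matrixP => k l; rewrite 2!mxE mulmxdE mulmxdE !mxE.
    have [<-|kl] := eqVneq k l; last by rewrite !mulr0n !mul0r addr0.
    rewrite !mulr1n; have [->|dk] := eqVneq (d 0 k) 0; first by rewrite mulr0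
      mul0r addr0.
    rewrite add0r -{2}[d 0 k]sqrtCK expr2 mulrA mulVf ?mul1r ?divff //.
      by rewrite sqrtC_eq0.
    by rewrite sqrtC_eq0.
  by rewrite -addrA; apply: psdmxD h; apply: psdmx_diag_mx => k; rewrite mxE ler0n.
exists (g *m U), (fun i => gi *m z i *m gi); split => [|i|i|i].
- rewrite conjtr_mul gh bE !mulmxA -(mulmxA (U^t*) g); congr (_ *m _ *m _).
  apply/matrixP => k l; rewrite /g mulmxdE !mxE; have [<-|kl] := eqVneq k l.
    by rewrite !mulr1n -expr2 sqrtCK.
  by rewrite !mulr0n mul0r.
- rewrite {1}zE conjtr_mul gh !mulmxA; congr (_ *m _).
  rewrite -!mulmxA; congr (_ *m _); rewrite !mulmxA.
  apply/matrixP => k l; rewrite /g /gi !mulmxdE -!mulmxA !muldmxE !mxE.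
  have [dk|dk] := eqVneq (d 0 k) 0; first by rewrite !z0 // !(mul0r, mulr0).
  have [dl|dl] := eqVneq (d 0 l) 0; first by rewrite !z0' // !(mul0r, mulr0).
  by field; apply/andP; split; rewrite sqrtC_eq0.
- exact: normp (zp i).
by have := normp _ (zm i); rewrite mulmxN mulNmx.
Qed.

(** * Sums of compressions of tuples of a fixed size *)

Definition dilation (I : Type) d (P : (I -> 'M[C]_d) -> Prop) n
    (y : I -> 'M[C]_n) : Prop :=
  exists k (x : 'I_k -> I -> 'M[C]_d) (v : 'I_k -> 'M[C]_(d, n)),
    (forall i, P (x i)) /\ forall j, y j = \sum_i (v i)^t* *m x i j *m v i.

Section Dilation.
Variables (I : Type) (d : nat) (P : (I -> 'M[C]_d) -> Prop).

Lemma dilation_ext n (y z : I -> 'M[C]_n) :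
  (forall j, y j = z j) -> dilation P y -> dilation P z.
Proof. by move=> yz [k [x [v [Px E]]]]; exists k, x, v; split => // j; rewrite
  -yz. Qed.

Lemma dilationD n (y z : I -> 'M[C]_n) :
  dilation P y -> dilation P z -> dilation P (fun j => y j + z j).
Proof.
move=> [k [x [v [Px yE]]]] [l [x' [v' [Px' zE]]]].
exists (k + l)%N, (fun i : 'I_(k + l) => match fintype.split i with inl a => x a
  | inr b => x' b end),
  (fun i : 'I_(k + l) => match fintype.split i with inl a => v a | inr b => v' b end).
split=> [i|j]; first by case: fintype.split.
rewrite big_split_ord /= yE zE; congr (_ + _); apply: eq_bigr => i _.
  by rewrite (unsplitK (inl i)).
by rewrite (unsplitK (inr i)).
Qed.

Lemma dilation_congr m n (w : 'M[C]_(m, n)) (y : I -> 'M[C]_m) :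
  dilation P y -> dilation P (fun j => w^t* *m y j *m w).
Proof.
move=> [k [x [v [Px yE]]]]; exists k, x, (fun i => v i *m w); split => // j.
rewrite yE mulmx_sumr mulmx_suml; apply: eq_bigr => i _.
by rewrite conjtr_mul !mulmxA.
Qed.

Lemma dilationZ n (a : C) (y : I -> 'M[C]_n) :
  0 <= a -> dilation P y -> dilation P (fun j => a *: y j).
Proof.
move=> a0 /(dilation_congr (sqrtC a)%:M); apply: dilation_ext => j.
rewrite tr_scalar_mx map_scalar_mx /= (CrealP (ger0_real _)) ?sqrtC_ge0 //.
by rewrite mul_scalar_mx mul_mx_scalar scalerA -expr2 sqrtCK.
Qed.

End Dilation.

Definition ncube n d (x : 'I_n.+1 -> 'M[C]_d) : Prop :=
  x ord0 = 1%:M /\ forall i : 'I_n,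
    psdmx (1%:M + x (lift ord0 i)) /\ psdmx (1%:M - x (lift ord0 i)).

(** [1 + s] is twice a projection, hence half its own square. *)
Lemma involution_psdmx n (s : 'M[C]_n) : s^t* = s -> s *m s = 1%:M -> psdmx (1%:M
  + s).
Proof.
move=> sh ss; have -> : 1%:M + s = 2^-1 *: ((1%:M + s)^t* *m (1%:M + s)).
  rewrite conjtrD conjtr1 sh mulmxDl !mulmxDr ss !mul1mx mulmx1 (addrC s).
  by rewrite half_double.
by apply: psdmxZ; [rewrite invr_ge0 ler0n | apply: psdmx_gram].
Qed.

Lemma involutionN_psdmx n (s : 'M[C]_n) : s^t* = s -> s *m s = 1%:M -> psdmx
  (1%:M - s).
Proof.
by move=> sh ss; apply: involution_psdmx; rewrite ?conjtrN ?sh // mulmxN mulNmx opprK.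
Qed.

(* Hermitian contractions are convex combinations of symmetries: split the
   eigenvalues that are not [1] or [-1] one at a time. *)
Lemma contraction_ind n (F : 'M[C]_n -> Prop) :
  (forall t a b, 0 <= t -> t <= 1 -> F a -> F b -> F (t *: a + (1 - t) *: b)) ->
  (forall s, s^t* = s -> s *m s = 1%:M -> F s) ->
  forall c, psdmx (1%:M + c) -> psdmx (1%:M - c) -> F c.
Proof.
move=> Fconv Fsym c cp cm.
have : c \is hermsymmx.
  apply/hermsymmxP; have /hermsymmxP := psdmx_herm cp.
  by rewrite conjtrD conjtr1 => /addrI.
move=> /herm_diag[U [d [U1 U2 dr cE]]].
have d1 i : `|d 0 i| <= 1.
  have h (e : 'rV[C]_n) : psdmx (1%:M + U^t* *m diagmx e *m U) -> 0 <= 1 + e 0 i.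
    move=> /(psdmx_congr (U^t*)) /(psdmx_diag i); rewrite trmxCK mulmxDr mulmxDl
      mulmx1 U1.
    by rewrite !mulmxA U1 mul1mx -mulmxA U1 mulmx1 !mxE eqxx mulr1n.
  rewrite real_ler_norml //; apply/andP; split; rewrite -subr_ge0.
    by rewrite opprK addrC h // -cE.
  have := h (- d); rewrite mxE; apply.
  by rewrite linearN /= mulmxN mulNmx -cE.
(* Induction on the number [k] of eigenvalues that may still lie strictly between [-1] and [1]; from
   index [k] on they have modulus one. *)
have {cp cm} : forall k (d : 'rV[C]_n), (forall i, d 0 i \is Num.real) ->
    (forall i, `|d 0 i| <= 1) -> (forall i : 'I_n, (k <= i)%N -> `|d 0 i| = 1) ->
  F (U^t* *m diagmx d *m U).
  elim=> [|k IH] {d dr cE d1}d dr d1 dk.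
    have dd i : d 0 i * d 0 i = 1.
      by rewrite -expr2 -real_normK // dk // expr1n.
    apply: Fsym.
      by rewrite !conjtr_mul trmxCK conjtr_diag // mulmxA.
    rewrite !mulmxA -(mulmxA _ U) U1 mulmx1 -[RHS]U2; congr (_ *m _).
    rewrite -[RHS]mulmx1 -mulmxA; congr (_ *m _); apply/matrixP => p q.
    by rewrite mulmxdE !mxE; case: eqVneq => [<-|]; rewrite ?mulr1n ?dd // mulr0n
      mul0r.
  have [kn|kn] := ltnP k n; last first.
    by apply: IH => // i ki; have := leq_trans kn ki; rewrite leqNgt ltn_ord.
  (* [t] is the weight that makes [d 0 k0] the convex combination of [1] and [-1]. *)
  pose k0 := Ordinal kn; pose t := (1 + d 0 k0) / 2.
  pose e (a : C) : 'rV[C]_n := \row_j (if j == k0 then a else d 0 j).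
  have eF (a : C) : a \is Num.real -> `|a| = 1 -> F (U^t* *m diagmx (e a) *m U).
    move=> ar a1; apply: IH => i.
    - by rewrite mxE; case: ifP.
    - by rewrite mxE; case: ifP => // _; rewrite a1.
    rewrite mxE => ki; case: eqVneq => [//|ik]; apply: dk.
    by rewrite ltn_neqAle ki andbT; apply: contraNneq ik => E; apply/eqP/val_inj.
  have := d1 k0; rewrite real_ler_norml // => /andP[dk1 dk2].
  have := Fconv t _ _ _ _ (eF 1 (rpred1 _) (normr1 _)) (eF (-1) _ _).
  have -> : t *: (U^t* *m diagmx (e 1) *m U) + (1 - t) *: (U^t* *m diagmx (e (-
    1)) *m U)
      = U^t* *m diagmx d *m U.
    have -> : diagmx d = t *: diagmx (e 1) + (1 - t) *: diagmx (e (-1)).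
      apply/matrixP => i j; rewrite !mxE; case: (i == j); last by rewrite !mulr0n
        !mulr0 addr0.
      rewrite !mulr1n; case: eqVneq => [->|_]; last by ring.
      by rewrite /t; field.
    by rewrite mulmxDr mulmxDl -!scalemxAr -!scalemxAl.
  apply.
  - by rewrite /t divr_ge0 ?ler0n // -(opprK 1) addrC subr_ge0.
  - by rewrite /t ler_pdivrMr ?ltr0n // mul1r -[2]/(1 + 1) lerD2l.
  - by rewrite rpredN rpred1.
  - by rewrite normrN1.
move=> /(_ n d dr d1); rewrite -cE; apply => i; by rewrite leqNgt ltn_ord.
Qed.

Definition triple n (a b c : 'M[C]_n) (i : 'I_3) : 'M[C]_n :=
  match val i with 0 => a | 1 => b | _ => c end.

Lemma ncube_triple d (s t : 'M[C]_d) :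
  psdmx (1%:M + s) -> psdmx (1%:M - s) -> psdmx (1%:M + t) -> psdmx (1%:M - t) ->
  ncube (n := 2) (triple 1%:M s t).
Proof. by move=> sp sm tp tm; split => //; case=> [[|[|//]] i2]; split. Qed.

Definition mx2 (a b c : C) : 'M[C]_2 :=
  \matrix_(i, j) if i != j then b else if i == 0 then a else c.

Lemma mx2_mul n (a b c : C) (v : 'M[C]_(2, n)) :
  mx2 a b c *m v =
  \matrix_(i, j) if i == 0 then a * v 0 j + b * v 1 j else b * v 0 j + c * v 1 j.
Proof.
apply/matrixP => i j; rewrite !mxE !big_ord_recl big_ord0 addr0 !mxE.
by case: i => [[|[|//]] i2] /=; congr (_ * v _ j + _ * v _ j); apply: val_inj.
Qed.

(* Let [h = s + t], diagonal, and [k = s - t], so that [h k = - k h] and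
   [k k = 4 - h h].  For the eigenvector [e i] of [h] the span of [e i] and
   [k (e i)] is invariant under [s] and [t]; [v i] is its (normalized)
   coordinate map, and the projections [v i^* v i] add up to twice the identity. *)
Lemma dilation_diag_symmetries n (s t : 'M[C]_n) (mu : 'rV[C]_n) :
  s^t* = s -> t^t* = t -> s *m s = 1%:M -> t *m t = 1%:M ->
  (forall i, mu 0 i \is Num.real) -> s + t = diagmx mu ->
  dilation (ncube (n := 2) (d := 2)) (triple 1%:M s t).
Proof.
move=> sh th ss tt mur stE.
pose k := s - t.
have sE i j : 2 * s i j = mu 0 i *+ (i == j) + k i j.
  have /matrixP/(_ i j) := stE; rewrite !mxE => <-; ring.
have tE i j : 2 * t i j = mu 0 i *+ (i == j) - k i j.
  have /matrixP/(_ i j) := stE; rewrite !mxE => <-; ring.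
have kh : k^t* = k by rewrite conjtrD conjtrN sh th.
have hk : diagmx mu *m k = - (k *m diagmx mu).
  by rewrite -stE !(mulmxDl, mulmxDr, mulNmx, mulmxN) ss tt; 
     apply/matrixP => i j; rewrite !mxE; ring.
have kk : k *m k = 4%:M - diagmx mu *m diagmx mu.
  by rewrite -stE !(mulmxDl, mulmxDr, mulNmx, mulmxN) ss tt; 
     apply/matrixP => i j; rewrite !mxE; case: (i == j); rewrite ?mulr1n ?mulr0n;
       ring.
clearbody k.
pose r i := sqrtC (4 - mu 0 i ^+ 2).
have kkE i j : \sum_l k i l * k l j = (4 - mu 0 i ^+ 2) *+ (i == j).
  transitivity ((k *m k) i j); first by rewrite mxE.
  by rewrite kk mxE [fun_of_matrix (- _) i j]mxE muldmxE !mxE; case: eqVneq =>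
    [->|]; rewrite ?mulr1n ?mulr0n ?expr2 ?mulr0 ?subr0.
have kc i j : (k i j)^* = k j i.
  by have /matrixP/(_ j i) := kh; rewrite !mxE.
have r0 i : 0 <= 4 - mu 0 i ^+ 2.
  have := kkE i i; rewrite eqxx mulr1n => <-; apply: sumr_ge0 => l _.
  by rewrite -[k l i]kc mul_conjC_ge0.
have rr i : 0 <= r i by rewrite sqrtC_ge0.
have r2 i : r i ^+ 2 = 4 - mu 0 i ^+ 2 by rewrite sqrtCK.
have k0 i j : r i = 0 -> k i j = 0.
  move=> ri; have := kkE i i; rewrite -r2 ri expr0n eqxx mulr1n /=.
  under eq_bigr => l _ do rewrite -[k l i]kc -normCK.
  move=> /eqP; rewrite psumr_eq0 => [/allP/(_ j)|l _]; last exact: exprn_ge0.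
  by rewrite mem_index_enum sqrf_eq0 normr_eq0 => /(_ isT)/eqP.
(* [k] anticommutes with [h], so it links only eigenvectors with opposite eigenvalues, and [r]
   depends on the square of the eigenvalue. *)
have kr i j : k i j != 0 -> r i = r j.
  move=> kij; have /matrixP/(_ i j) := hk.
  rewrite muldmxE [fun_of_matrix (- _) i j]mxE mulmxdE => /eqP; rewrite -subr_eq0
    opprK mulrC -mulrDr.
  by rewrite mulf_eq0 (negbTE kij) addr_eq0 /r => /eqP ->; rewrite sqrrN.
(* When [r i = 0] the row of [k] vanishes and the span degenerates to [e i], which must then carry
   the whole weight 2 in the sum of the [v i^* v i]; otherwise the two rows contribute 1 each. *)
pose a i : C := if r i == 0 then sqrtC 2 else 1.
pose v i : 'M[C]_(2, n) :=
  \matrix_(p, j) if p == 0 then a i *+ (i == j) else (r i)^-1 * k i j.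
pose S i := mx2 (mu 0 i / 2) (r i / 2) (- (mu 0 i / 2)).
pose T i := mx2 (mu 0 i / 2) (- (r i / 2)) (- (mu 0 i / 2)).
have two0 : (2 : C) != 0 by rewrite pnatr_eq0.
have ra i : r i != 0 -> a i = 1 by rewrite /a => /negbTE ->.
have kmu i j : k i j * mu 0 j = - (mu 0 i * k i j).
  have /matrixP/(_ i j) := hk.
  by rewrite muldmxE [fun_of_matrix (- _) i j]mxE mulmxdE => ->; rewrite opprK.
(* [s] and [t] are [(h + e k) / 2] with [e = 1] and [e = -1], so one computation covers both. *)
have ks (e : C) (x : 'M[C]_n) i j :
    (forall i j, 2 * x i j = mu 0 i *+ (i == j) + e * k i j) ->
  2 * \sum_l k i l * x l j = - (mu 0 i * k i j) + e * (r i ^+ 2 *+ (i == j)).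
  move=> xE; rewrite r2 -kkE -kmu.
  have -> : k i j * mu 0 j = \sum_l (if l == j then k i l * mu 0 l else 0).
    by rewrite -big_mkcond big_pred1_eq.
  rewrite !mulr_sumr -big_split; apply: eq_bigr => l _ /=.
  rewrite mulrCA xE mulrDr mulrCA; congr (_ + _).
  by case: eqVneq => _; rewrite ?mulr1n ?mulr0n ?mulr0.
have ev (e : C) (x : 'M[C]_n) i :
    (forall i j, 2 * x i j = mu 0 i *+ (i == j) + e * k i j) -> e ^+ 2 = 1 ->
    mx2 (mu 0 i / 2) (e * (r i / 2)) (- (mu 0 i / 2)) *m v i = v i *m x.
  move=> xE e2; apply/matrixP => p j; rewrite mx2_mul !mxE; apply: (mulfI two0).
  rewrite /=; case: ifP => p0.
    under eq_bigr => l _ do rewrite !mxE p0.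
    rewrite (bigD1 i) //= big1 => [|l li]; last by rewrite eq_sym (negbTE li)
      mulr0n mul0r.
    rewrite eqxx mulr1n addr0 [RHS]mulrCA xE.
    have [ri|ri] := eqVneq (r i) 0; first by rewrite k0 // !mulr0 !addr0 ; case:
      (i == j); rewrite ?mulr1n ?mulr0n; field.
    by rewrite ra // ; case: (i == j); rewrite ?mulr1n ?mulr0n; field; rewrite ri.
  under eq_bigr => l _ do rewrite !mxE p0 -mulrA.
  rewrite -mulr_sumr [RHS]mulrCA (ks e) //.
  have [ri|ri] := eqVneq (r i) 0; first by rewrite ri invr0 !(mul0r, mulr0, addr0).
  by rewrite ra // ; case: (i == j); rewrite ?mulr1n ?mulr0n; field; rewrite ri.
have Sv i : S i *m v i = v i *m s.
  rewrite -(ev 1) ?expr1n ?mul1r // => p j; by rewrite mul1r.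
have Tv i : T i *m v i = v i *m t.
  rewrite -(ev (- 1)) ?sqrrN ?expr1n ?mulN1r // => p j; by rewrite mulN1r.
have vv : \sum_i (v i)^t* *m v i = 2%:M.
  apply/matrixP => p q; rewrite summxE.
  have vvE i : ((v i)^t* *m v i) p q = a i ^+ 2 *+ ((i == p) && (i == q)) + (r
    p)^-1 ^+ 2 * (k p i * k i q).
    rewrite !mxE !big_ord_recl big_ord0 addr0 !mxE /= rmorphMn rmorphM /=.
    have ar : (a i)^* = a i.
      by rewrite /a; case: ifP; rewrite ?rmorph1 // => _; rewrite (CrealP
        (ger0_real _)) // sqrtC_ge0 ler0n.
    have ir : ((r i)^-1)^* = (r i)^-1 by apply: CrealP; apply: ger0_real; rewrite
      invr_ge0.
    rewrite ar ir kc; congr (_ + _).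
      by case: (i == p); case: (i == q); rewrite ?mulr1n ?mulr0n ?mul0r ?mulr0 ?expr2.
    have [->|/kr ->] := eqVneq (k p i) 0; first by rewrite !(mulr0, mul0r).
    by rewrite expr2; ring.
  under eq_bigr => i _ do rewrite vvE.
  rewrite big_split /= -mulr_sumr kkE -r2 (bigD1 p) //= big1 => [|i ip]; last first.
    by rewrite (negbTE ip).
  rewrite eqxx addr0 !mxE; case: eqVneq => _; last by rewrite !mulr0n mulr0 addr0.
  rewrite !mulr1n /a; have [->|ri] := eqVneq (r p) 0.
    by rewrite sqrtCK expr0n mulr0 addr0.
  by rewrite expr1n -exprMn mulVf // expr1n.
have mx2P b c : b \is Num.real -> c \is Num.real -> b ^+ 2 + c ^+ 2 = 1 ->
    (mx2 b c (- b))^t* = mx2 b c (- b) /\ mx2 b c (- b) *m mx2 b c (- b) = 1%:M.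
  move=> /CrealP br /CrealP cr bc; split.
    apply/matrixP => i j; rewrite !mxE eq_sym; case: eqVneq => [->|_] //=.
    by case: ifP; rewrite ?rmorphN /= br.
  rewrite mx2_mul; apply/matrixP => i j; rewrite !mxE.
  by case: i => [[|[|//]] i2]; case: j => [[|[|//]] j2] /=; rewrite ?mulr1n
    ?mulr0n -?bc; ring.
apply: dilation_ext (dilationZ (a := 2^-1) _ _) => [j||]; last first.
- exists n, (fun i => triple 1%:M (S i) (T i)), v; split; last by move=> j;
  reflexivity.
  move=> i.
  have mur2 : mu 0 i / 2 \is Num.real by rewrite rpred_div ?realn.
  have rr2 : r i / 2 \is Num.real by rewrite rpred_div ?realn // ger0_real.
  have mr : (mu 0 i / 2) ^+ 2 + (r i / 2) ^+ 2 = 1.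
    by rewrite !expr_div_n r2; field.
  have [Sh SS] := mx2P _ _ mur2 rr2 mr.
  have nr2 : - (r i / 2) \is Num.real by rewrite rpredN.
  have [|Th TT] := mx2P _ _ mur2 nr2; first by rewrite sqrrN.
  apply: ncube_triple; by [apply: involution_psdmx | apply: involutionN_psdmx].
- by rewrite invr_ge0 ler0n.
case: j => [[|[|[|//]]] j3] /=; rewrite /triple /=.
- under eq_bigr => i _ do rewrite mulmx1.
  by rewrite vv scale_scalar_mx mulVf.
- under eq_bigr => i _ do rewrite -mulmxA Sv mulmxA.
  by rewrite -mulmx_suml vv mul_scalar_mx scalerA mulVf ?scale1r.
under eq_bigr => i _ do rewrite -mulmxA Tv mulmxA.
by rewrite -mulmx_suml vv mul_scalar_mx scalerA mulVf ?scale1r.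
Qed.

Lemma dilation_symmetries n (s t : 'M[C]_n) :
  s^t* = s -> t^t* = t -> s *m s = 1%:M -> t *m t = 1%:M ->
  dilation (ncube (n := 2) (d := 2)) (triple 1%:M s t).
Proof.
move=> sh th ss tt.
have /herm_diag[U [mu [U1 U2 mur stE]]] : s + t \is hermsymmx.
  by apply/hermsymmxP; rewrite conjtrD sh th.
pose s' := U *m s *m U^t*; pose t' := U *m t *m U^t*.
have conjU (x : 'M[C]_n) : U^t* *m (U *m x *m U^t*) *m U = x.
  by rewrite !mulmxA U2 mul1mx -mulmxA U2 mulmx1.
have hU (x : 'M[C]_n) : x^t* = x -> (U *m x *m U^t*)^t* = U *m x *m U^t*.
  by move=> xh; rewrite !conjtr_mul trmxCK xh mulmxA.
have sqU (x : 'M[C]_n) : x *m x = 1%:M -> (U *m x *m U^t*) *m (U *m x *m U^t*) = 1%:M.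
  by move=> xx; rewrite !mulmxA -(mulmxA _ (U^t*) U) U2 mulmx1 -(mulmxA U) xx mulmx1.
have stE' : U *m s *m U^t* + U *m t *m U^t* = diagmx mu.
  rewrite -mulmxDl -mulmxDr stE !mulmxA U1 mul1mx -mulmxA U1 mulmx1 //.
have := dilation_diag_symmetries (hU _ sh) (hU _ th) (sqU _ ss) (sqU _ tt) mur stE'.
move=> /(dilation_congr U); apply: dilation_ext => -[[|[|j]] j3]; rewrite /triple //=.
by rewrite mulmx1.
Qed.

(** Contractions are replaced by symmetries one coordinate at a time; the coordinate held fixed is
    written as [a x + (1 - a) x], so that the pairs form a convex combination. *)
Lemma dilation_contractions n (s t : 'M[C]_n) :
  psdmx (1%:M + s) -> psdmx (1%:M - s) -> psdmx (1%:M + t) -> psdmx (1%:M - t) ->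
  dilation (ncube (n := 2) (d := 2)) (triple 1%:M s t).
Proof.
move=> sp sm tp tm.
have conv (a : C) (x y x' y' : 'M[C]_n) : 0 <= a -> a <= 1 ->
    dilation (ncube (n := 2) (d := 2)) (triple 1%:M x y) ->
    dilation (ncube (n := 2) (d := 2)) (triple 1%:M x' y') ->
  dilation (ncube (n := 2) (d := 2))
    (triple 1%:M (a *: x + (1 - a) *: x') (a *: y + (1 - a) *: y')).
  move=> a0 a1 /(dilationZ a0) xy /(dilationZ (_ : 0 <= 1 - a)) xy'.
  have {}xy' := xy' (ltac:(by rewrite subr_ge0)).
  apply: dilation_ext (dilationD xy xy') => -[[|[|j]] j3]; rewrite /triple //=.
  by rewrite -scalerDl addrC subrK scale1r.
have scal (a : C) (x : 'M[C]_n) : a *: x + (1 - a) *: x = x.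
  by rewrite -scalerDl addrC subrK scale1r.
apply: (contraction_ind (F := fun s => dilation _ (triple 1%:M s t))) sp sm.
  by move=> a x y a0 a1 xP yP; rewrite -[t](scal a); apply: conv.
move=> {}s sh ss.
apply: (contraction_ind (F := fun t => dilation _ (triple 1%:M s t))) tp tm.
  by move=> a x y a0 a1 xP yP; rewrite -[s](scal a); apply: conv.
by move=> {}t th tt; apply: dilation_symmetries.
Qed.

Theorem dilation_square n (y : 'I_3 -> 'M[C]_n) : psdmx (y ord0) ->
  (forall i : 'I_2, psdmx (y ord0 + y (lift ord0 i)) /\ psdmx (y ord0 - y (lift
    ord0 i))) ->
  dilation (ncube (n := 2) (d := 2)) y.
Proof.
move=> y0 yi; have [w [c [E0 Ei cp cm]]] :=
  psdmx_normalize y0 (fun i => proj1 (yi i)) (fun i => proj2 (yi i)).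
have := dilation_contractions (cp ord0) (cm ord0) (cp (lift ord0 ord0)) (cm (lift
  ord0 ord0)).
move=> /(dilation_congr w); apply: dilation_ext => -[[|[|[|//]]] j3]; rewrite
  /triple /=.
- by rewrite mulmx1 -E0; congr y; apply: val_inj.
- by rewrite -Ei; congr y; apply: val_inj.
by rewrite -Ei; congr y; apply: val_inj.
Qed.

(** A segment has two vertices: the pair is half of [(1, 1)] weighted by [y_0 + y_1] plus [(1, -1)]
    weighted by [y_0 - y_1], and each weight splits into rank one terms. *)
Theorem dilation_segment n (y : 'I_2 -> 'M[C]_n) : 
  (forall i : 'I_1, psdmx (y ord0 + y (lift ord0 i)) /\ psdmx (y ord0 - y (lift
    ord0 i))) ->
  dilation (ncube (n := 1) (d := 1)) y.
Proof.
move=> /(_ ord0)[]; set y1 := y (lift ord0 ord0) => yp ym.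
pose x (e : C) (i : 'I_2) : 'M[C]_1 := if i == ord0 then 1%:M else e%:M.
have xP e : e ^+ 2 = 1 -> `|e| = 1 -> e \is Num.real -> ncube (n := 1) (x e).
  move=> e2 e1 er; split; first by rewrite /x eqxx.
  have eh : (e%:M : 'M[C]_1)^t* = e%:M by rewrite tr_scalar_mx map_scalar_mx /=
    (CrealP er).
  have ee : e%:M *m e%:M = 1%:M :> 'M[C]_1 by rewrite -scalar_mxM -expr2 e2.
  by move=> i; rewrite /x /=; split; [apply: involution_psdmx | apply:
    involutionN_psdmx].
have dil e (M : 'M[C]_n) : e ^+ 2 = 1 -> `|e| = 1 -> e \is Num.real -> psdmx M ->
    dilation (ncube (n := 1) (d := 1)) (fun i => (if i == ord0 then 1 else e) *: M).
  move=> e2 e1 er /psdmx_sum_rank1[w ->]; exists n, (fun=> x e), w; split => [_|j].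
    exact: xP.
  rewrite scaler_sumr; apply: eq_bigr => i _; rewrite /x; case: ifP => _.
    by rewrite mulmx1 scale1r.
  by rewrite mul_mx_scalar scalemxAl.
have half : 0 <= 2^-1 :> C by rewrite invr_ge0 ler0n.
have := dilationD (dil 1 _ (expr1n _ _) (normr1 _) (rpred1 _) (psdmxZ half yp))
  (dil (- 1) _ _ (normrN1 _) _ (psdmxZ half ym)).
rewrite sqrrN expr1n rpredN rpred1 => /(_ erefl isT).
apply: dilation_ext => -[[|[|//]] j2] /=.
  rewrite !scale1r -scalerDr addrACA subrr addr0 half_double; congr y; exact: val_inj.
rewrite scale1r scaleN1r -scalerN -scalerDr opprB [y1 - _]addrC addrACA subrr
  add0r half_double.
by congr y; apply: val_inj.
Qed.

Lemma psdmx_entry n (M : 'M[C]_n) k l : psdmx M -> `|M k l| <= \tr M.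
Proof.
move=> Mp; have T0 := psdmx_trace Mp.
rewrite -(@ler_pXn2r _ 2) ?nnegrE //.
have := psdmx_cauchy (delta_mx k 0) (delta_mx l 0) Mp; rewrite !sform_delta =>
  /le_trans; apply.
by rewrite expr2 ler_pM ?psdmx_diag ?psdmx_diag_trace.
Qed.

(** * Almost commuting with symmetries *)

Section Deficit.
Variables (n : nat) (y0 y1 u : 'M[C]_n).
Hypotheses (yp : psdmx (y0 + y1)) (ym : psdmx (y0 - y1)).

Lemma deficit_trace1 : \tr y1 <= \tr y0.
Proof. by have := psdmx_trace ym; rewrite linearB /= subr_ge0. Qed.

Hypotheses (uh : u^t* = u) (uu : u *m u = 1%:M).

(** Projections onto the eigenspaces of [u] for [1] and [-1]. *)
Let pp := 2^-1 *: (1%:M + u).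
Let pm := 2^-1 *: (1%:M - u).

Let halfC : (2^-1 : C)^* = 2^-1.
Proof. by apply: CrealP; rewrite rpredV realn. Qed.

Let pph : pp^t* = pp.
Proof. by rewrite linearZ /= map_mxZ /= halfC conjtrD conjtr1 uh. Qed.

Let pmh : pm^t* = pm.
Proof. by rewrite linearZ /= map_mxZ /= halfC conjtrD conjtrN conjtr1 uh. Qed.

Let decE : (y0 - y1) *m pp + (y0 + y1) *m pm = y0 - y1 *m u.
Proof.
rewrite -!scalemxAr -scalerDr !mulmxDr !mulmxN !mulmx1 !mulmxDl mulNmx.
by apply/matrixP => i j; rewrite !mxE; field.
Qed.

Let ppp : pp *m pp = pp.
Proof.
rewrite -scalemxAl -scalemxAr mulmxDl !mulmxDr uu !mul1mx mulmx1 (addrC u).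
by rewrite half_double.
Qed.

Let pmm : pm *m pm = pm.
Proof.
rewrite -scalemxAl -scalemxAr mulmxDl !mulmxDr !mulmxN !mulNmx opprK uu !mul1mx
  mulmx1 (addrC (- u)).
by rewrite half_double.
Qed.

Let trE : \tr (pp^t* *m (y0 - y1) *m pp) + \tr (pm^t* *m (y0 + y1) *m pm) =
  \tr y0 - \tr (u *m y1).
Proof.
rewrite pph pmh -!mulmxA mxtrace_mulC -mulmxA ppp.
by rewrite [in X in _ + X]mxtrace_mulC -mulmxA pmm -linearD decE linearB /=
  (mxtrace_mulC u).
Qed.

Lemma deficit_ge0 : 0 <= \tr y0 - \tr (u *m y1).
Proof. by rewrite -trE addr_ge0 // psdmx_trace //; apply: psdmx_congr. Qed.

(** By Cauchy-Schwarz an entry of [m p] is at most the geometric mean of a diagonal entry of [m],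
    bounded by [2 tr y0], and one of [p^* m p], bounded by the deficit; [decE] writes [y0 - y1 u] as
    a sum of two such products. *)
Lemma deficit_entry (e d : C) k l : 0 <= d -> \tr y0 - \tr (u *m y1) <= e ->
  2 * \tr y0 * e <= d ^+ 2 -> `|(y0 - y1 *m u) k l| <= 2 * d.
Proof.
move=> d0 dle ed; rewrite -decE mxE mulr_natl mulr2n.
have entry (m p : 'M[C]_n) : psdmx m -> \tr m <= 2 * \tr y0 ->
    \tr (p^t* *m m *m p) <= e -> `|(m *m p) k l| <= d.
  move=> mp mT pe; rewrite -(@ler_pXn2r _ 2) ?nnegrE //; apply: le_trans ed.
  have -> : (m *m p) k l = sform m (delta_mx k 0) (p *m delta_mx l 0).
    by rewrite -sform_delta /sform !mulmxA.
  apply: le_trans (psdmx_cauchy _ _ mp) _; rewrite sform_delta -sform_congr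
    sform_delta.
  apply: ler_pM; rewrite ?psdmx_diag //; first exact: psdmx_congr.
    exact: le_trans (psdmx_diag_trace _ mp) mT.
  by apply: le_trans pe; apply/psdmx_diag_trace/psdmx_congr.
have tD : \tr (y0 + y1) + \tr (y0 - y1) = 2 * \tr y0.
  by rewrite -linearD addrACA subrr addr0 linearD /= mulr_natl mulr2n.
have := trE => tE; have pp0 := psdmx_trace (psdmx_congr pp ym).
have pm0 := psdmx_trace (psdmx_congr pm yp).
apply: le_trans (ler_normD _ _) _; apply: lerD; apply: entry => //.
- by rewrite -tD lerDr psdmx_trace.
- by apply: le_trans dle; rewrite -tE lerDl.
- by rewrite -tD lerDl psdmx_trace.
by apply: le_trans dle; rewrite -tE lerDr.
Qed.

(** With [E = y0 - y1 u] one has [E u = y0 u - y1]. As [y1] is hermitian, it cancels in [E u] minus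
    its adjoint, which leaves the commutator. The bound on the column sums keeps multiplication by
    [u] from enlarging entry bounds. *)
Lemma deficit_commute (e d : C) k l : (forall j, \sum_i `|u i j| <= 1) ->
  0 <= d -> \tr y0 - \tr (u *m y1) <= e ->
  2 * \tr y0 * e <= d ^+ 2 -> `|(y0 *m u - u *m y0) k l| <= 4 * d.
Proof.
move=> u1 d0 dle ed; set E := y0 - y1 *m u.
have Eu k' l' : `|(E *m u) k' l'| <= 2 * d.
  rewrite mxE; apply: le_trans (ler_norm_sum _ _ _) _.
  apply: le_trans (_ : \sum_i 2 * d * `|u i l'| <= _); last first.
    by rewrite -mulr_sumr -[leRHS]mulr1 ler_wpM2l // mulr_ge0.
  by apply: ler_sum => i _; rewrite normrM ler_wpM2r // (deficit_entry _ _ d0 dle).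
have y0h : y0^t* = y0.
  have /hermsymmxP := psdmx_herm (psdmxD yp ym).
  rewrite addrACA subrr addr0 conjtrD => /matrixP h; apply/matrixP => i j.
  have two : (2 : C) != 0 by rewrite pnatr_eq0.
  by apply: (mulfI two); have := h i j; rewrite !mulr_natl !mulr2n
    ![fun_of_matrix (_ + _) _ _]mxE.
have y1h : y1^t* = y1.
  by have /hermsymmxP := psdmx_herm yp; rewrite conjtrD y0h => /addrI.
have -> : y0 *m u - u *m y0 = E *m u - (E *m u)^t*.
  by rewrite /E mulmxBl -mulmxA uu mulmx1 conjtrD conjtrN conjtr_mul y0h y1h uh
    opprB addrA subrK.
rewrite mxE [fun_of_matrix (- _) k l]mxE [fun_of_matrix (_^t*) k l]mxE
  [fun_of_matrix (_^T) k l]mxE.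
apply: le_trans (ler_normB _ _) _; rewrite norm_conjC.
by rewrite (_ : 4 * d = 2 * d + 2 * d) ?lerD // -mulrDl -natrD.
Qed.

End Deficit.

(** * Three symmetries with trivial commutant *)

Section Swap.
Variable d : nat.
Let n := d.+1.

(** The involution pairs each [k] of parity [b] with [k + 1]. An end of the path without a partner
    is fixed: the last index by the bound test, and [0] for [b = true] by the convention
    [0.-1 = 0]. *)
Definition swap_nat (b : bool) (k : nat) : nat :=
  if odd k == b then (if (k.+1 < n)%N then k.+1 else k) else k.-1.

Lemma swap_nat_lt b k : (k < n -> swap_nat b k < n)%N.
Proof.
rewrite /swap_nat; case: ifP => _; first by case: ifP.
by case: k => //= k /ltnW.
Qed.

Definition swap_ord b (k : 'I_n) : 'I_n := Ordinal (swap_nat_lt b (ltn_ord k)).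

Lemma swap_ordK b : involutive (swap_ord b).
Proof.
move=> [k kn]; apply: val_inj; rewrite /= {2}/swap_nat.
case: ifP => kb; first case: ifP => kn'.
- by rewrite /swap_nat /= -(eqP kb); case: (odd k).
- by rewrite /swap_nat kb kn'.
rewrite /swap_nat; case: k kn kb => [|k] kn kb; first by rewrite /= kb.
by move: kb => /=; rewrite kn; case: (odd k); case: b.
Qed.

Definition swap_mx b : 'M[C]_n := \matrix_(i, j) (j == swap_ord b i)%:R.

Definition refl_mx : 'M[C]_n := \matrix_(i, j) ((if i == ord0 then -1 else 1) *+
  (i == j)).

Lemma mul_swap_mx b (M : 'M[C]_n) i j : (swap_mx b *m M) i j = M (swap_ord b i) j.
Proof.
rewrite mxE (bigD1 (swap_ord b i)) //= big1 => [|k ki].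
  by rewrite mxE eqxx mul1r addr0.
by rewrite mxE (negbTE ki) mul0r.
Qed.

Lemma mulmx_swap b (M : 'M[C]_n) i j : (M *m swap_mx b) i j = M i (swap_ord b j).
Proof.
rewrite mxE (bigD1 (swap_ord b j)) //= big1 => [|k ki].
  by rewrite mxE swap_ordK eqxx mulr1 addr0.
rewrite mxE; case: eqVneq => [jk|]; last by rewrite mulr0.
by rewrite jk swap_ordK eqxx in ki.
Qed.

Lemma swap_mx_herm b : (swap_mx b)^t* = swap_mx b.
Proof.
apply/matrixP => i j; rewrite !mxE conjC_nat; congr (_%:R).
by congr nat_of_bool; apply/eqP/eqP => ->; rewrite swap_ordK.
Qed.

Lemma swap_mx_sq b : swap_mx b *m swap_mx b = 1%:M.
Proof. by apply/matrixP => i j; rewrite mul_swap_mx !mxE swap_ordK eq_sym. Qed.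

Lemma mul_refl_mx (M : 'M[C]_n) i j :
  (refl_mx *m M) i j = (if i == ord0 then -1 else 1) * M i j.
Proof.
rewrite mxE (bigD1 i) //= big1 => [|k ki]; first by rewrite mxE eqxx addr0.
by rewrite mxE [i == k]eq_sym (negbTE ki) mul0r.
Qed.

Lemma mulmx_refl (M : 'M[C]_n) i j :
  (M *m refl_mx) i j = M i j * (if j == ord0 then -1 else 1).
Proof.
rewrite mxE (bigD1 j) //= big1 => [|k ki]; first by rewrite mxE eqxx addr0.
by rewrite mxE (negbTE ki) mulr0.
Qed.

Lemma refl_mx_herm : refl_mx^t* = refl_mx.
Proof.
apply/matrixP => i j; rewrite !mxE [j == i]eq_sym; case: (eqVneq i j) => [->|_].
  by apply: CrealP; rewrite rpredMn //; case: ifP => _; rewrite ?rpredN rpred1.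
exact: rmorph0.
Qed.

Lemma refl_mx_sq : refl_mx *m refl_mx = 1%:M.
Proof.
apply/matrixP => i j; rewrite mul_refl_mx !mxE; case: (eqVneq i j) => [->|]; last
  by rewrite mulr0.
by case: ifP; rewrite ?mulrNN mulr1.
Qed.

Lemma swap_mx_colsum b j : \sum_i `|swap_mx b i j| <= 1.
Proof.
rewrite (bigD1 (swap_ord b j)) //= big1 => [|k ki].
  by rewrite mxE swap_ordK eqxx normr1 addr0.
rewrite mxE; case: eqVneq => [jk|]; last by rewrite normr0.
by rewrite jk swap_ordK eqxx in ki.
Qed.

Lemma refl_mx_colsum j : \sum_i `|refl_mx i j| <= 1.
Proof.
rewrite (bigD1 j) //= big1 => [|k ki]; last by rewrite mxE (negbTE ki) normr0.
by rewrite mxE eqxx addr0 mulr1n; case: ifP => _; rewrite ?normrN normr1.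
Qed.

(* The swaps generate all permutations of the path 0, ..., d and the reflection
   kills the off-diagonal entries in row 0, so that a matrix commuting with all
   three is scalar. *)
Lemma almost_scalar (y : 'M[C]_n) (e : C) : 0 <= e ->
  (forall b k l, `|(y *m swap_mx b - swap_mx b *m y) k l| <= e) ->
  (forall k l, `|(y *m refl_mx - refl_mx *m y) k l| <= e) ->
  (forall k l, k != l -> `|y k l| <= n%:R * e) /\
  (forall k, `|y k k - y ord0 ord0| <= n%:R * e).
Proof.
move=> e0 ysw yre.
have step b k l : `|y k l - y (swap_ord b k) (swap_ord b l)| <= e.
  have := ysw b k (swap_ord b l).
  by rewrite mxE [fun_of_matrix (- _) _ _]mxE mulmx_swap mul_swap_mx swap_ordK.
(* The swap of parity opposite to [k] lowers a positive [k] by one; iterating it moves every entry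
   to row [0]. *)
have walk (k : 'I_n) : (0 < k)%N -> (swap_ord (~~ odd k) k).+1 = k :> nat.
  by move=> k0; rewrite /= /swap_nat; case: (odd k) => /=; rewrite prednK.
suff h m (k : 'I_n) : (val k = m) ->
    (forall l, k != l -> `|y k l| <= m.+1%:R * e) /\ `|y k k - y ord0 ord0| <=
      m.+1%:R * e.
  have le_n (k : 'I_n) : k.+1%:R * e <= n%:R * e by rewrite ler_wpM2r // ler_nat.
  split=> [k l kl|k]; have [h1 h2] := h _ k erefl.
    exact: le_trans (h1 _ kl) (le_n k).
  exact: le_trans h2 (le_n k).
elim: m k => [|m IH] k km.
  have -> : k = ord0 by apply: val_inj.
  split=> [l l0|]; last by rewrite subrr normr0 mul1r.
  (* Off the diagonal in row [0], the commutator with the reflection has entry [2 y 0 l]. *)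
  have := yre ord0 l; rewrite mxE [fun_of_matrix (- _) _ _]mxE mulmx_refl mul_refl_mx.
  rewrite eqxx eq_sym (negbTE l0) mulr1 mulN1r opprK => h.
  rewrite mul1r; apply: le_trans h; rewrite -mulr2n normrMn mulr2n lerDl //.
have k0 : (0 < k)%N by rewrite km.
pose b := ~~ odd k; have bk : val (swap_ord b k) = m.
  by apply: succn_inj; rewrite -[in RHS]km; apply: walk.
have [h1 h2] := IH _ bk.
have tri (p q r : C) : `|p - q| <= e -> `|q - r| <= m.+1%:R * e -> `|p - r| <=
  m.+2%:R * e.
  move=> pq qr; rewrite -[p](subrK q) -addrA; apply: le_trans (ler_normD _ _) _.
  by rewrite -[m.+2]add1n natrD mulrDl mul1r lerD.
split=> [l kl|]; last exact: tri (step b _ _) h2.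
rewrite -[y k l]subr0; apply: tri (step b _ _) _; rewrite subr0; apply: h1.
by rewrite (inj_eq (can_inj (swap_ordK b))).
Qed.

End Swap.

(* If all three deficits are small then [y0] almost commutes with the three
   symmetries, hence is almost scalar, which a singular matrix cannot be. *)
Theorem deficit_lower_bound d : exists2 e : C, 0 < e &
  forall y0 y1 y2 y3 : 'M[C]_d.+1,
    (exists2 z : 'cV[C]_d.+1, z != 0 & y0 *m z = 0) ->
    psdmx (y0 + y1) -> psdmx (y0 - y1) -> psdmx (y0 + y2) -> psdmx (y0 - y2) ->
    psdmx (y0 + y3) -> psdmx (y0 - y3) ->
    \tr (swap_mx d false *m y1) + \tr (swap_mx d true *m y2) + \tr (refl_mx d *m y3)
      <= (3 - e) * \tr y0.
Proof.
(* [K] is chosen so that the final estimate reads [T <= T - T / K]: with off-diagonal bound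
   [q = 4 n T / K] one gets [T <= n (2 q + n q)]. The value of [e] is the largest for which
   [deficit_commute] applies with [dl = T / K]. *)
pose n := d.+1; pose K : C := (n * (n + n + n * n) * 4).+1%:R.
have K0 : 0 < K by rewrite ltr0n.
pose e : C := K^-1 ^+ 2 / 2.
have e0 : 0 < e by rewrite divr_gt0 ?exprn_gt0 ?invr_gt0 ?ltr0n.
exists e => // y0 y1 y2 y3 [z z0 yz] p1 m1 p2 m2 p3 m3.
have half : 0 <= 2^-1 :> C by rewrite invr_ge0 ler0n.
have y0p : psdmx y0.
  by have := psdmxZ half (psdmxD p1 m1); rewrite addrACA subrr addr0 half_double.
set T := \tr y0; have T0 : 0 <= T := psdmx_trace y0p.
have D1 := deficit_ge0 p1 m1 (swap_mx_herm d false) (swap_mx_sq d false).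
have D2 := deficit_ge0 p2 m2 (swap_mx_herm d true) (swap_mx_sq d true).
have D3 := deficit_ge0 p3 m3 (refl_mx_herm d) (refl_mx_sq d).
rewrite -/T in D1 D2 D3.
set t1 := \tr (_ *m y1) in D1 *; set t2 := \tr (_ *m y2) in D2 *.
set t3 := \tr (_ *m y3) in D3 *.
suff h : e * T <= (T - t1) + (T - t2) + (T - t3).
  rewrite -subr_ge0 in h; rewrite -subr_ge0; apply: le_trans h _.
  by rewrite le_eqVlt; apply/orP; left; apply/eqP; ring.
have eTr : e * T \is Num.real by rewrite rpredM ?ger0_real ?(ltW e0).
(* One large deficit already suffices, the others being nonnegative. *)
have big (x : C) (r : C) : 0 <= x -> 0 <= r -> ~ (x <= e * T) -> e * T <= x + r.
  move=> x0 r0 h; have [//|/ltW h'] := real_leP (ger0_real x0) eTr.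
  by apply: le_trans h' _; rewrite lerDl.
have [h1|/negP h1] := boolP (T - t1 <= e * T); last first.
  by rewrite -addrA; apply: big h1; rewrite // addr_ge0.
have [h2|/negP h2] := boolP (T - t2 <= e * T); last first.
  by rewrite [T - t1 + _]addrC -addrA; apply: big h2; rewrite // addr_ge0.
have [h3|/negP h3] := boolP (T - t3 <= e * T); last first.
  by rewrite addrC; apply: big h3; rewrite // addr_ge0.
suff T00 : T = 0 by rewrite [in leLHS]T00 mulr0 addr_ge0 // addr_ge0.
pose dl := K^-1 * T; have dl0 : 0 <= dl by rewrite mulr_ge0 // invr_ge0 ltW.
have edl : 2 * T * (e * T) <= dl ^+ 2.
  by rewrite le_eqVlt; apply/orP; left; apply/eqP; rewrite /e /dl; move: (K^-1)
    => c; field.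
have [|||offd ond] := @almost_scalar d y0 (4 * dl).
- by rewrite mulr_ge0 ?ler0n.
- move=> [] k l.
    by apply: (deficit_commute p2 m2 _ _ _ _ _ dl0 h2 edl); [exact: swap_mx_herm
      | exact: swap_mx_sq | exact: swap_mx_colsum].
  by apply: (deficit_commute p1 m1 _ _ _ _ _ dl0 h1 edl); [exact: swap_mx_herm |
    exact: swap_mx_sq | exact: swap_mx_colsum].
- by move=> k l; apply: (deficit_commute p3 m3 _ _ _ _ _ dl0 h3 edl); [exact:
  refl_mx_herm | exact: refl_mx_sq | exact: refl_mx_colsum].
pose q : C := n%:R * (4 * dl).
have q0 : 0 <= q by rewrite mulr_ge0 ?ler0n // mulr_ge0 ?ler0n.
(* The kernel vector is measured in the sum norm: row [k] of [y0 z = 0] bounds the diagonal entry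
   times [|z k|] by [q Z], and summing over [k] bounds [y0 0 0], since all diagonal entries are
   within [q] of it. *)
pose Z : C := \sum_k `|z k 0|.
have Zk k : `|z k 0| <= Z.
  by rewrite /Z (bigD1 k) //= lerDl sumr_ge0.
have Z_gt0 : 0 < Z.
  rewrite lt0r sumr_ge0 // andbT; apply: contraNneq z0 => Z0.
  apply/eqP/colP => k; rewrite mxE; apply/eqP; rewrite -normr_le0.
  by rewrite -Z0.
have row k : `|y0 k k| * `|z k 0| <= q * Z.
  have /colP/(_ k) := yz; rewrite !mxE (bigD1 k) //= => /eqP.
  rewrite addr_eq0 -normrM => /eqP ->; rewrite normrN.
  apply: le_trans (ler_norm_sum _ _ _) _.
  apply: le_trans (_ : \sum_(i | i != k) q * `|z i 0| <= _).
    by apply: ler_sum => i ik; rewrite normrM ler_wpM2r // offd // eq_sym.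
  rewrite -mulr_sumr ler_wpM2l // /Z [leRHS](bigD1 k) //= lerDr //.
have y00 : y0 ord0 ord0 <= q + n%:R * q.
  rewrite -(ler_pM2r Z_gt0).
  apply: le_trans (_ : \sum_k (`|y0 k k| + q) * `|z k 0| <= _).
    rewrite /Z mulr_sumr; apply: ler_sum => k _; rewrite ler_wpM2r //.
    rewrite -[y0 ord0 ord0]ger0_norm ?psdmx_diag //.
    rewrite -[y0 ord0 ord0](subKr (y0 k k)); apply: le_trans (ler_normB _ _) _.
    by rewrite lerD2l.
  under eq_bigr => k _ do rewrite mulrDl.
  rewrite big_split /= -mulr_sumr mulrDl addrC lerD2l -mulrA mulr_natl -[n in _
    *+ n](card_ord n) -sumr_const.
  by apply: ler_sum => k _; apply: row.
have Tq : T <= n%:R * (2 * q + n%:R * q).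
  rewrite mulr_natl -[n in _ *+ n](card_ord n) -sumr_const; apply: ler_sum => k _.
  rewrite -[y0 k k]ger0_norm ?psdmx_diag // -[y0 k k](subrK (y0 ord0 ord0)).
  apply: le_trans (ler_normD _ _) _; rewrite mulr_natl mulr2n -addrA lerD //.
  by rewrite ger0_norm ?psdmx_diag.
have TK : T <= T - K^-1 * T.
  apply: le_trans Tq _; rewrite le_eqVlt; apply/orP; left; apply/eqP.
  rewrite /q /dl (_ : K = n%:R * (n%:R + n%:R + n%:R * n%:R) * 4 + 1); last first.
    by rewrite /K -natr1 !natrM !natrD natrM.
  field; rewrite -!natrM -!natrD -!natrM natr1 pnatr_eq0 //.
apply/eqP; rewrite eq_le T0 andbT.
by move: TK; rewrite -subr_ge0 addrC addKr oppr_ge0 pmulr_rle0 // invr_gt0.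
Qed.
End PositiveSemidefinite.

(** * Characters of commutative C*-algebras *)

Section Modulus.
Variable R : realType.
Implicit Types k l : R[i].

(** The norm of [R[i]] takes its values in [R[i]]; seminorms and suprema call for this real-valued
    modulus. *)
Definition modc k : R := complex.Re `|k|.

Lemma modcE k : (modc k)%:C = `|k|.
Proof. by rewrite /modc RRe_real // ger0_real. Qed.

Lemma modc_ge0 k : 0 <= modc k.
Proof. by rewrite -lecR modcE normr_ge0. Qed.

Lemma modcM k l : modc (k * l) = modc k * modc l.
Proof. by apply: (@complexI R); rewrite rmorphM /= !modcE normrM. Qed.

Lemma modcD k l : modc (k + l) <= modc k + modc l.
Proof. by rewrite -lecR rmorphD /= !modcE ler_normD. Qed.

Lemma modcN k : modc (- k) = modc k.
Proof. by rewrite /modc normrN. Qed.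

Lemma modcX k n : modc (k ^+ n) = modc k ^+ n.
Proof. by apply: (@complexI R); rewrite rmorphXn /= !modcE normrX. Qed.

Lemma modcR (x : R) : modc x%:C = `|x|.
Proof. by apply: (@complexI R); rewrite modcE normc_def /= expr0n addr0
  sqrtr_sqr. Qed.

Lemma modc1 : modc 1 = 1.
Proof. by rewrite /modc normr1. Qed.

Lemma modc_gt0 k : (0 < modc k) = (k != 0).
Proof. by rewrite -ltcR modcE normr_gt0. Qed.

Lemma modc_rect (x y : R) : modc (x +i* y) <= `|x| + `|y|.
Proof.
rewrite [x +i* y]complexE; apply: le_trans (modcD _ _) _; rewrite modcM !modcR /=.
by rewrite (_ : modc 'i = 1) ?mul1r // /modc normCi.
Qed.

Lemma modc_Re k : `|complex.Re k| <= modc k.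
Proof. by rewrite -lecR modcE normc_ge_Re. Qed.

Lemma modc_Im k : `|complex.Im k| <= modc k.
Proof.
rewrite -[complex.Im k]opprK -ReiNIm normrN; apply: le_trans (modc_Re _) _.
by rewrite modcM (_ : modc 'i = 1) ?mulr1 // /modc normCi.
Qed.

End Modulus.

Lemma expr_small (R : realType) (t e : R) : 0 <= t < 1 -> 0 < e ->
  exists n, forall m, (n <= m)%N -> t ^+ m < e.
Proof.
move=> /andP[t0 t1] e0.
have : `|t| < 1 by rewrite ger0_norm.
move=> /cvg_expr /cvgr0Pnorm_lt /(_ e e0)[n _ h]; exists n => m nm.
by have := h m nm; rewrite /= ger0_norm // exprn_ge0.
Qed.

(* Rickart's elementary proof of Gelfand-Mazur: averaging the resolvents
   [l (l - a)^-1] over the [2^k]-th roots of unity gives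
   [(1 - (a / l)^(2^k))^-1].  Resolvents being uniformly continuous on discs,
   smallness of [(a / r)^(2^k)] for some [k] propagates from large to small [r],
   which is impossible for an invertible [a]. *)
Section GelfandMazur.
Variables (R : realType) (A : comAlgType R[i]) (q : A -> R).
Hypotheses (qD : forall x y, q (x + y) <= q x + q y)
  (qM : forall x y, q (x * y) <= q x * q y)
  (qZ : forall k x, q (k *: x) = modc k * q x) (q1 : q 1 = 1).
Variable a : A.
Variable c : R[i] -> A.
Hypothesis cE : forall l, q ((l%:A - a) * c l - 1) = 0.

Let q0 : q 0 = 0.
Proof. by rewrite -(scale0r 0) qZ /modc normr0 mul0r. Qed.

Let qN x : q (- x) = q x.
Proof. by rewrite -scaleN1r qZ modcN modc1 mul1r. Qed.

Let q_ge0 x : 0 <= q x.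
Proof. by have := qD x (- x); rewrite subrr q0 qN -mulr2n pmulrn_lge0. Qed.

Let qX x n : q (x ^+ n) <= q x ^+ n.
Proof.
elim: n => [|n IH]; first by rewrite !expr0 q1.
by rewrite !exprS; apply: le_trans (qM _ _) _; rewrite ler_wpM2l.
Qed.

(** Identities are proved modulo elements of seminorm zero, which stands in for computing in a
    quotient algebra. *)
Let null x := q x = 0.

Let nullD x y : null x -> null y -> null (x + y).
Proof.
move=> x0 y0; apply/eqP; rewrite eq_le q_ge0 andbT.
by apply: le_trans (qD _ _) _; rewrite x0 y0 addr0.
Qed.

Let nullM x y : null y -> null (x * y).
Proof.
move=> y0; apply/eqP; rewrite eq_le q_ge0 andbT.
by apply: le_trans (qM _ _) _; rewrite y0 mulr0.
Qed.

Let qle x y : null (x - y) -> q x <= q y.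
Proof. by move=> xy; rewrite -[x](subrK y); apply: le_trans (qD _ _) _; rewrite
  xy add0r. Qed.

Let resolvent l m : null (c l - c m - (m - l)%:A * (c l * c m)).
Proof.
have -> : c l - c m - (m - l)%:A * (c l * c m) =
    (- c l) * ((m%:A - a) * c m - 1) + c m * ((l%:A - a) * c l - 1).
  by rewrite scalerBl; ring.
by apply: nullD; apply: nullM; apply: cE.
Qed.

Let qA k : q k%:A = modc k.
Proof. by rewrite qZ q1 mulr1. Qed.

Let c_lip l m : q (c l - c m) <= modc (m - l) * (q (c l) * q (c m)).
Proof.
apply: le_trans (qle (resolvent l m)) _; apply: le_trans (qM _ _) _.
by rewrite qA ler_wpM2l ?modc_ge0.
Qed.

(** By compactness of a square it suffices to bound [q (c l)] near each [m]: with [b = q (c m)] and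
    [|m - l| b <= 1/2], the resolvent identity gives [q (c l) <= 2 b]. *)
Let c_bounded (M : R) : exists B, forall l, modc l <= M -> q (c l) <= B.
Proof.
have K : compact ([set x | x \in `[-M, M]] `*` [set x | x \in `[-M, M]] : set (R
  * R)).
  by apply: compact_setX; apply: segment_compact.
move/compact_near_coveringP: K => /(_ _ \oo (fun i p => q (c (p.1 +i* p.2)) <=
  i%:R) _).
move=> [[x y] /= _|n _ h].
  set m := x +i* y; set b := q (c m).
  have e0 : 0 < (4 * b + 4)^-1 by rewrite invr_gt0 ltr_wpDl ?mulr_ge0 ?q_ge0.
  exists (ball (x, y) (4 * b + 4)^-1, [set i : nat | 2 * b <= i%:R]).
    split => /=; first exact: nbhsx_ballx.
    exists (Num.bound (2 * b)) => // i /= hi.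
    apply: le_trans (ltW (archi_boundP _)) _; first by rewrite mulr_ge0 ?q_ge0.
    by rewrite ler_nat.
  move=> [[x' y'] i] /= [[/= bx By] hi].
  rewrite /ball /= in bx By; set l := x' +i* y'.
  apply: le_trans hi; set b' := q (c l).
  have ml : modc (m - l) <= 2 * (4 * b + 4)^-1.
    have -> : m - l = (x - x') +i* (y - y') by [].
    by apply: le_trans (modc_rect _ _) _; rewrite mulr_natl mulr2n lerD // ltW.
  have b0 : 0 <= b := q_ge0 _. have b'0 : 0 <= b' := q_ge0 _.
  have h1 : b' <= b + b' / 2.
    rewrite -[X in _ <= X]addrC -lerBlDr; apply: le_trans (_ : q (c l - c m) <= _).
      by rewrite lerBlDr /b' /b -[in leLHS](subrK (c m) (c l)); apply: qD.
    apply: le_trans (c_lip _ _) _; rewrite -/b -/b' mulrCA ler_wpM2l //.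
    apply: le_trans (ler_wpM2r b0 ml) _.
    by rewrite mulrAC ler_pdivrMr ?ltr_wpDl ?mulr_ge0 //; lra.
  lra.
exists n%:R => l lM.
have lE : l = complex.Re l +i* complex.Im l by case: l {lM}.
have := h n (leqnn n) (complex.Re l, complex.Im l); rewrite /= -lE; apply.
have := le_trans (modc_Re l) lM; have := le_trans (modc_Im l) lM.
by rewrite !in_itv /= !ler_norml.
Qed.

Let G l := l *: c l.

(** A [2^k]-th root of [-1]. The [2^(k+1)]-th roots of unity are the [2^k]-th ones and their
    multiples by it, which drives the recursion of [avg_resolvent]. *)
Fixpoint root_m1 k : R[i] := if k is k'.+1 then sqrtC (root_m1 k') else -1.

Let root_m1X k : root_m1 k ^+ (2 ^ k) = -1.
Proof. by elim: k => [|k IH] //=; rewrite expnS exprM sqrtCK. Qed.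

Let modc_root_m1 k : modc (root_m1 k) = 1.
Proof.
have: modc (root_m1 k) ^+ (2 ^ k) = 1 ^+ (2 ^ k).
  by rewrite expr1n -modcX root_m1X modcN modc1.
by move=> /eqP; rewrite eqrXn2 ?expn_gt0 ?modc_ge0 // => /eqP.
Qed.

Fixpoint avg_resolvent k l : A :=
  if k is k'.+1 then 2^-1 *: (avg_resolvent k' l + avg_resolvent k' (root_m1 k' *
    l)) else G l.

Let avg_resolventE k l : l != 0 -> null (avg_resolvent k l * (1 - l^-1 ^+ (2 ^ k)
  *: a ^+ (2 ^ k)) - 1).
Proof.
elim: k l => [|k IH] l l0 /=.
  rewrite expn0 !expr1 /G; have := cE l; rewrite /null.
  rewrite mulrBr mulr1 -scalerAl -scalerAr scalerA mulfV // scale1r.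
  by rewrite mulrBl -scalerAl mul1r (mulrC a).
set u := avg_resolvent k l; set v := avg_resolvent k _; set x := l^-1 ^+ (2 ^ k)
  *: a ^+ (2 ^ k).
have ux := IH l l0; have z0 : root_m1 k * l != 0.
  by rewrite mulf_neq0 // -modc_gt0 modc_root_m1.
have vx := IH _ z0; rewrite -/u -/v -/x in ux vx.
have zx : (root_m1 k * l)^-1 ^+ (2 ^ k) *: a ^+ (2 ^ k) = - x.
  by rewrite invfM exprMn exprVn root_m1X invrN1 mulN1r scaleNr.
rewrite zx opprK in vx.
have -> : l^-1 ^+ (2 ^ k.+1) *: a ^+ (2 ^ k.+1) = x ^+ 2.
  by rewrite exprZn -!exprM -expnSr.
(* The identity [1/(1 - x) + 1/(1 + x) = 2/(1 - x^2)], cleared of denominators. *)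
have -> : 2^-1 *: (u + v) * (1 - x ^+ 2) - 1 = (2^-1)%:A *
   ((1 + x) * (u * (1 - x) - 1) + (1 - x) * (v * (1 + x) - 1)).
  set t := (2^-1)%:A; have -> : 2^-1 *: (u + v) = t * (u + v) by rewrite
    -scalerAl mul1r.
  have tt : t + t = 1.
    by rewrite -scalerDl; have := splitr (1 : R[i]); rewrite mul1r => <-; rewrite
      scale1r.
  rewrite -{2}tt; ring.
by apply: nullM; apply: nullD; apply: nullM.
Qed.

(** The points averaged over all have the modulus of [l], so an oscillation bound valid on the whole
    disc survives averaging. *)
Let avg_resolvent_osc (M e : R) t k : 
  (forall l, modc l <= M -> q (G l - G (t * l)) <= e) ->
  forall l, modc l <= M -> q (avg_resolvent k l - avg_resolvent k (t * l)) <= e.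
Proof.
move=> Ge; elim: k => [|k IH] l lM /=; first exact: Ge.
rewrite -scalerBr qZ; have -> : modc (2^-1) = (2^-1 : R).
  by rewrite (_ : 2^-1 = (2^-1)%:C) ?modcR ?ger0_norm ?invr_ge0 // rmorphV
    ?unitfE ?pnatr_eq0 // rmorph_nat.
rewrite mulrC ler_pdivrMr // opprD addrACA; apply: le_trans (qD _ _) _.
rewrite mulr_natr mulr2n lerD ?IH // (mulrCA (root_m1 k)) IH //.
by rewrite modcM modc_root_m1 mul1r.
Qed.

Let good (r : R) := exists k, q (a ^+ (2 ^ k)) <= r ^+ (2 ^ k) / 3.

(** The constants close up: [1/3] squared is [1/9], which puts the average at [r] within [1/8] of
    [1]; the oscillation leaves the average at [t r] within [1/4] of [1], and this gives back
    [1/3]. *)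
Let good_step (M : R) (t : R) : 0 < t -> 
  (forall l, modc l <= M -> q (G l - G (t%:C * l)) <= 1 / 8) ->
  forall r, 0 < r -> r <= M -> good r -> good (t * r).
Proof.
move=> t0 GM r r0 rM [k ak].
have rX n : 0 < r ^+ n by rewrite exprn_gt0.
pose n := (2 ^ k.+1)%N.
have an : q (a ^+ n) <= r ^+ n / 9.
  rewrite /n expnSr !exprM; apply: le_trans (qX _ _) _.
  apply: le_trans (_ : (r ^+ (2 ^ k) / 3) ^+ 2 <= _).
    by rewrite ler_pXn2r // nnegrE ?q_ge0 // divr_ge0 // ltW.
  by rewrite expr_div_n le_eqVlt; apply/orP; left; apply/eqP; congr (_ / _); ring.
have rC0 : r%:C != 0 by rewrite -modc_gt0 modcR normr_gt0 gt_eqF.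
have modr : modc r%:C = r by rewrite modcR gtr0_norm.
have trC0 : t%:C * r%:C != 0.
  by rewrite -rmorphM -modc_gt0 modcR normr_gt0 gt_eqF // mulr_gt0.
have modtr : modc (t%:C * r%:C) = t * r by rewrite modcM !modcR !gtr0_norm.
have small l : modc l = r -> q (l^-1 ^+ n *: a ^+ n) <= 1 / 9.
  move=> lr; rewrite qZ modcX.
  have -> : modc l^-1 = r^-1.
    have l0 : l != 0 by rewrite -modc_gt0 lr.
    apply: (mulfI (lt0r_neq0 r0)); rewrite -{1}lr -modcM !divff ?modc1 //.
    by rewrite lt0r_neq0.
  by rewrite exprVn mulrC ler_pdivrMr ?rX // mulrC mul1r.
have h1 := avg_resolventE k.+1 rC0; set x := (X in 1 - X) in h1; set h :=
  avg_resolvent k.+1 _ in h1.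
have x9 : q x <= 1 / 9 by apply: small.
have h8 : q (h - 1) <= 1 / 8.
  have : q (h - 1) <= q x * (q (h - 1) + 1).
    have hx : q (h - 1) <= q (x * h).
      by apply: qle; rewrite (_ : h - 1 - x * h = h * (1 - x) - 1) //; ring.
    apply: le_trans hx _; apply: le_trans (qM _ _) _; rewrite ler_wpM2l //.
    by rewrite -{1}[h](subrK 1) -[in leRHS]q1; apply: qD.
  have := q_ge0 (h - 1); have := q_ge0 x; nra.
have h2 := avg_resolventE k.+1 trC0; set x' := (X in 1 - X) in h2; set h' :=
  avg_resolvent k.+1 _ in h2.
have hh' : q (h - h') <= 1 / 8 by apply: (avg_resolvent_osc k.+1 GM); rewrite modr.
have h'4 : q (h' - 1) <= 1 / 4.
  have : q (h' - 1) <= q (h - h') + q (h - 1).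
    rewrite (_ : h' - 1 = - (h - h') + (h - 1)); last by ring.
    by rewrite -[q (h - h')]qN; apply: qD.
  lra.
have x'3 : q x' <= 1 / 3.
  have : q x' <= q (h' - 1) + q x' * q (h' - 1).
    apply: le_trans (_ : q ((h' - 1) - x' * (h' - 1)) <= _).
      by apply: qle; rewrite (_ : x' - _ = - (h' * (1 - x') - 1)) ?/null ?qN //; ring.
    apply: le_trans (qD _ _) _; rewrite qN lerD2l; exact: qM.
  move: h'4 (ler_wpM2l (q_ge0 x') h'4).
  by move: (q (h' - 1)) (q x') => u v; lra.
exists k.+1; rewrite -/n.
move: x'3; rewrite /x' qZ modcX -/n.
have -> : modc (t%:C * r%:C)^-1 = (t * r)^-1.
  have tr0 : t * r != 0 by rewrite gt_eqF // mulr_gt0.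
  by apply: (mulfI tr0); rewrite -{1}modtr -modcM !divff ?modc1.
rewrite exprVn mulrC ler_pdivrMr ?exprn_gt0 ?mulr_gt0 //.
by rewrite mul1r mulrC.
Qed.

Lemma gelfand_mazur : False.
Proof.
(* With this [M], [good M] holds at [k = 0]. *)
pose M := 3 * q a + 1.
have M0 : 0 < M by rewrite ltr_wpDl // mulr_ge0.
have [B cB] := c_bounded M.
have B0 : 0 <= B.
  by apply: le_trans (q_ge0 _) (cB 0 _); rewrite /modc normr0 ltW.
pose L := M * B ^+ 2 + B.
have L0 : 0 <= L by rewrite addr_ge0 // mulr_ge0 ?exprn_ge0 // ltW.
have K0 : 0 <= 8 * M * L by rewrite mulr_ge0 // mulr_ge0 // ltW.
(* On the disc of radius [M], replacing [l] by [(1 - s) l] moves [G] by at most [s M L], which this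
   [s] keeps below [1/8]. *)
pose s := (8 * M * L + 2)^-1.
have s0 : 0 < s by rewrite invr_gt0; lra.
have s1 : s < 1 by rewrite invf_lt1; lra.
have GM l : modc l <= M -> q (G l - G ((1 - s)%:C * l)) <= 1 / 8.
  move=> lM; set m := _ * l.
  have mM : modc m <= M.
    apply: le_trans lM; rewrite modcM modcR ger0_norm ?subr_ge0 ?(ltW s1) //.
    by rewrite ler_piMl ?modc_ge0 // lerBlDr lerDl ltW.
  have lm : modc (l - m) <= s * M.
    rewrite (_ : l - m = s%:C * l); last by rewrite /m rmorphB rmorph1 /=; ring.
    by rewrite modcM modcR ger0_norm ?(ltW s0) // ler_wpM2l // ltW.
  have -> : G l - G m = l *: (c l - c m) + (l - m) *: c m.
    by rewrite /G scalerBr scalerBl addrA subrK.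
  apply: le_trans (qD _ _) _; rewrite !qZ.
  have h1 : modc l * q (c l - c m) <= M * (s * M * (B * B)).
    apply: ler_pM; rewrite ?modc_ge0 //; apply: le_trans (c_lip _ _) _.
    apply: ler_pM; rewrite ?modc_ge0 ?mulr_ge0 //; first by rewrite -modcN opprB.
    by apply: ler_pM; rewrite ?cB.
  have h2 : modc (l - m) * q (c m) <= s * M * B.
    by apply: ler_pM; rewrite ?modc_ge0 ?cB.
  apply: le_trans (lerD h1 h2) _.
  rewrite (_ : _ + _ = s * (M * L)); last by rewrite /L; ring.
  by rewrite /s mulrC ler_pdivrMr; lra.
have t01 : 0 <= 1 - s < 1 by rewrite subr_ge0 ltW //= ltrBlDr ltrDl.
have t0 : 0 < 1 - s by rewrite subr_gt0.
have goodM n : good ((1 - s) ^+ n * M).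
  elim: n => [|n IH].
    exists 0%N; rewrite expn0 !expr1 expr0 mul1r /M; lra.
  rewrite exprS -mulrA; apply: good_step GM _ _ _ IH => //.
    by rewrite mulr_gt0 // exprn_gt0.
  rewrite ler_piMl ?(ltW M0) // exprn_ile1 ?(ltW t0) //.
  by rewrite lerBlDr lerDl ltW.
pose b := q (c 0).
(* For the [n] obtained from this, the radius [r] satisfies [r q (c 0) <= 1]. Since [- c 0] inverts
   [a] modulo null elements, goodness of [r] brings the seminorm of some [a^m (- c 0)^m], which is
   at least [1], down to at most [1/3]. *)
have e0 : 0 < (b + 1)^-1 / M by rewrite divr_gt0 // invr_gt0 ltr_wpDl ?q_ge0.
have [n /(_ n (leqnn n)) hn] := expr_small t01 e0.
have [k hk] := goodM n; set r := _ * M in hk.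
have r0 : 0 < r by rewrite mulr_gt0 // exprn_gt0.
have rb : r * b <= 1.
  have b0 : 0 <= b := q_ge0 _.
  have : r <= (b + 1)^-1 by rewrite -ler_pdivlMr // ltW.
  move=> /(ler_wpM2r b0) /le_trans; apply.
  by rewrite mulrC ler_pdivrMr ?ltr_wpDl // mul1r lerDl.
have ab : null (a * - c 0 - 1).
  by have := cE 0; rewrite scale0r sub0r mulNr mulrN.
have abn m : null (a ^+ m * (- c 0) ^+ m - 1).
  elim: m => [|m IH]; first by rewrite !expr0 mul1r subrr.
  rewrite (_ : _ - 1 = a * - c 0 * (a ^+ m * (- c 0) ^+ m - 1) + (a * - c 0 -
    1)); last first.
    by rewrite !exprS; ring.
  by apply: nullD => //; apply: nullM.
have : 1 <= q (a ^+ (2 ^ k) * (- c 0) ^+ (2 ^ k)).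
  rewrite -[leLHS]q1; apply: qle; have := abn (2 ^ k)%N.
  by rewrite /null -qN opprB.
rewrite leNgt => /negP; apply; apply: le_lt_trans (qM _ _) _.
apply: le_lt_trans (_ : r ^+ (2 ^ k) / 3 * b ^+ (2 ^ k) < 1).
  apply: ler_pM => //; apply: le_trans (qX _ _) _; by rewrite qN.
rewrite mulrAC -exprMn ltr_pdivrMr // mul1r.
have rb0 : 0 <= r * b by rewrite mulr_ge0 ?q_ge0 // ltW.
by have := exprn_ile1 (2 ^ k) rb0 rb; lra.
Qed.

End GelfandMazur.

(** * Norm estimates and the Neumann series *)

Section Norm.
Variables (R : realType) (A : comCStar R).
Implicit Types x y : A.
Local Notation nrm := (@cnorm R A).

Lemma cnormZE (k : R[i]) x : nrm (k *: x) = modc k * nrm x.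
Proof. by apply: (@complexI R); rewrite cnormZ rmorphM /= modcE. Qed.

Lemma cnorm0 : nrm 0 = 0.
Proof. by rewrite -(scale0r 0) cnormZE /modc normr0 mul0r. Qed.

Lemma cnormN x : nrm (- x) = nrm x.
Proof. by rewrite -scaleN1r cnormZE modcN modc1 mul1r. Qed.

Lemma cnorm_ge0 x : 0 <= nrm x.
Proof. by have := cnormD_le x (- x); rewrite subrr cnorm0 cnormN -mulr2n
  pmulrn_lge0. Qed.

Lemma star1 : star 1 = 1 :> A.
Proof. by have := starM (star 1) (1 : A); rewrite mulr1 !starK mulr1 => <-. Qed.

Lemma cnorm1 : nrm 1 = 1.
Proof.
have /eqP := cnorm_starM (1 : A); rewrite star1 mulr1 expr2 -subr_eq0 -{1}[nrm
  1]mulr1 -mulrBr.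
rewrite mulf_eq0 subr_eq0 => /orP[/eqP/cnorm0_eq0/eqP|/eqP //].
by rewrite oner_eq0.
Qed.

Lemma cnormX x n : nrm (x ^+ n) <= nrm x ^+ n.
Proof.
elim: n => [|n IH]; first by rewrite !expr0 cnorm1.
by rewrite !exprS; apply: le_trans (cnormM_le _ _) _; rewrite ler_wpM2l ?cnorm_ge0.
Qed.

Lemma neumann x : nrm (1 - x) < 1 -> exists y, x * y = 1.
Proof.
set z := 1 - x; set r := nrm z => r1; have r0 : 0 <= r := cnorm_ge0 z.
pose u n := \sum_(k < n) z ^+ k.
have uE n : x * u n = 1 - z ^+ n.
  by rewrite -[x](subKr 1) -/z -opprB mulNr -subrX1 opprB.
have ule n : nrm (u n) <= (1 - r)^-1.
  apply: le_trans (_ : \sum_(k < n) r ^+ k <= _).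
    rewrite /u; elim: n => [|n IH]; first by rewrite !big_ord0 cnorm0.
    rewrite !big_ord_recr /=; apply: le_trans (cnormD_le _ _) _.
    by rewrite lerD // cnormX.
  rewrite -[leRHS]mul1r ler_pdivlMr ?subr_gt0 //.
  rewrite mulrC -opprB mulNr -subrX1 opprB lerBlDr lerDl exprn_ge0 //.
have uD p m : u (p + m)%N - u p = z ^+ p * u m.
  rewrite /u big_split_ord /= addrAC subrr add0r mulr_sumr.
  by apply: eq_bigr => i _; rewrite exprD.
have [e e0|l /cvgr0Pnorm_lt ul] := @cnorm_complete R A u.
  have e0' : 0 < e * (1 - r) by rewrite mulr_gt0 // subr_gt0.
  have [|n hn] := expr_small (_ : 0 <= r < 1) e0'; first by rewrite r0.
  exists n.
  have main p m : (n <= p)%N -> nrm (u (p + m)%N - u p) < e.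
    move=> np; rewrite uD; apply: le_lt_trans (cnormM_le _ _) _.
    apply: le_lt_trans (_ : r ^+ p * (1 - r)^-1 < e).
      by apply: ler_pM; rewrite ?cnorm_ge0 ?cnormX.
    by rewrite ltr_pdivrMr ?subr_gt0 // hn.
  move=> p m np nm; have [pm|/ltnW mp] := leqP p m.
    by rewrite -cnormN opprB -(subnKC pm) main.
  by rewrite -(subnKC mp) main.
exists l; apply/eqP; rewrite -subr_eq0; apply/eqP/cnorm0_eq0.
apply/eqP; rewrite eq_le cnorm_ge0 andbT; apply/ler_addgt0Pl => e e0; rewrite addr0.
have e1 : 0 < e / (nrm x + 1) / 2.
  by rewrite !divr_gt0 // ltr_wpDl // cnorm_ge0.
have [|n hn] := expr_small (_ : 0 <= r < 1) (divr_gt0 e0 (ltr0n _ 2)); first by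
  rewrite r0.
have [m _ hm] := ul _ e1; pose k := maxn n m.
rewrite -(subrK (x * u k) (x * l)) -addrA -mulrBr uE addrAC subrr sub0r.
apply: le_trans (cnormD_le _ _) _; rewrite cnormN (splitr e) lerD //.
  apply: le_trans (cnormM_le _ _) _; rewrite -[nrm (l - u k)]cnormN opprB.
  have := hm k (leq_maxr _ _); rewrite /= ger0_norm ?cnorm_ge0 // => /ltW h.
  apply: le_trans (ler_wpM2l (cnorm_ge0 x) h) _.
  rewrite mulrA ler_wpM2r // mulrA ler_pdivrMr ?ltr_wpDl ?cnorm_ge0 //.
  by rewrite mulrC ler_wpM2l ?(ltW e0) // lerDl.
exact: le_trans (cnormX _ _) (ltW (hn _ (leq_maxl _ _))).
Qed.

End Norm.

(** * Maximal ideals and characters *)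

Section Character.
Variables (R : realType) (A : comCStar R).
Local Notation nrm := (@cnorm R A).

(** The empty set qualifies; it is the union of the empty chain in Zorn's lemma. *)
Record ideal (I : set A) : Prop := Ideal {
  idealD : forall x y, I x -> I y -> I (x + y);
  idealM : forall a x, I x -> I (a * x);
  ideal_proper : ~ I 1 }.

Lemma maximal_ideal (f : A) : (forall y, f * y <> 1) ->
  exists I, [/\ ideal I, I f & forall a, ~ I a -> exists b m, I m /\ a * b + m = 1].
Proof.
move=> fN; pose P (I : set A) := ideal I /\ (I !=set0 -> I f).
have [F FP Ftot|I [[Iid If] Imax]] := @Zorn_bigcup A P.
  split; last first.
    by move=> [x [X FX Xx]]; exists X => //; apply: (FP X FX).2; exists x.
  split.
  - move=> x y [X FX Xx] [Y FY Yy]; have [XY|YX] := Ftot X Y FX FY.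
      by exists Y => //; apply: idealD (FP Y FY).1 _ _ (XY _ Xx) Yy.
    by exists X => //; apply: idealD (FP X FX).1 _ _ Xx (YX _ Yy).
  - by move=> a x [X FX Xx]; exists X => //; apply: idealM (FP X FX).1 _ _ Xx.
  - by move=> [X FX X1]; exact: (ideal_proper (FP X FX).1) X1.
(* Were the maximal element empty, the principal ideal of [f], proper since [f] has no inverse,
   would be larger. *)
have {}If : I f.
  apply: contrapT => I0.
  have Iemp x : ~ I x by move=> Ix; apply/I0/If; exists x.
  apply: (Imax [set x | exists y, x = f * y]).
    split; first by move=> x /Iemp.
    by move=> h; apply: I0; apply: h; exists 1; rewrite mulr1.
  split; last by move=> _; exists 1; rewrite mulr1.
  split.
  - by move=> _ _ [x ->] [y ->]; exists (x + y); rewrite mulrDr.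
  - by move=> a _ [x ->]; exists (a * x); rewrite mulrCA.
  - by move=> [y /esym]; apply: fN.
exists I; split => // a Ia; apply: contrapT => h.
pose J := [set x | exists b m, I m /\ x = a * b + m].
have IJ : I `<=` J by move=> x Ix; exists 0, x; rewrite mulr0 add0r.
have I0 : I 0 by rewrite -(mul0r f); apply: idealM Iid _ _ If.
apply: (Imax J).
  split=> // JI; apply: Ia; apply: JI; exists 1, 0; by rewrite mulr1 addr0.
split; last by move=> _; apply: IJ.
split.
- move=> _ _ [b [m [Im ->]]] [b' [m' [Im' ->]]]; exists (b + b'), (m + m').
  by split; [apply: idealD | rewrite mulrDr addrACA].
- move=> x _ [b [m [Im ->]]]; exists (x * b), (x * m).
  by split; [apply: idealM | rewrite mulrDr mulrCA].
- by move=> [b [m [Im E]]]; apply: h; exists b, m.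
Qed.

Section Quotient.
Variable I : set A.
Hypotheses (Iid : ideal I) (I0 : I 0).
Hypothesis Imax : forall a, ~ I a -> exists b m, I m /\ a * b + m = 1.

Let dists x := [set nrm (x - m) | m in I].
(** The norm of the quotient by [I], as a seminorm on [A]. *)
Let q x := inf (dists x).

Let dist_nonempty x : dists x !=set0.
Proof. by exists (nrm (x - 0)), 0. Qed.

Let dist_lb x : has_inf (dists x).
Proof. by split=> //; exists 0 => _ [m _ <-]; apply: cnorm_ge0. Qed.

Let q_le x m : I m -> q x <= nrm (x - m).
Proof. by move=> Im; apply: ge_inf; [apply: (dist_lb x).2 | exists m]. Qed.

Let q_ge x e : (forall m, I m -> e <= nrm (x - m)) -> e <= q x.
Proof. by move=> h; apply: lb_le_inf => // _ [m Im <-]; apply: h. Qed.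

Let q_lt x e : q x < e -> exists2 m, I m & nrm (x - m) < e.
Proof. by move=> /inf_lt -/(_ (dist_nonempty x)) [_ [m Im <-] h]; exists m. Qed.

Let qx x : q x <= nrm x.
Proof. by have := q_le x I0; rewrite subr0. Qed.

Let q_ge0 x : 0 <= q x.
Proof. by apply: q_ge => m _; apply: cnorm_ge0. Qed.

Let IN x : I x -> I (- x).
Proof. by rewrite -mulN1r; apply: idealM. Qed.

(** An element of [I] at distance less than one from [1] would be invertible by the Neumann
    series. *)
Let q1 : q 1 = 1.
Proof.
apply/eqP; rewrite eq_le; apply/andP; split; first by rewrite -[leRHS](cnorm1 A) qx.
apply: q_ge => m Im; rewrite leNgt; apply/negP => h.
have [y my] : exists y, m * y = 1 by apply: neumann.
by apply: (ideal_proper Iid); rewrite -my mulrC; apply: idealM.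
Qed.

Let qD x y : q (x + y) <= q x + q y.
Proof.
apply/ler_addgt0Pr => e e0.
have e2 : 0 < e / 2 by rewrite divr_gt0.
have [|m Im hm] := @q_lt x (q x + e / 2); first by rewrite ltrDl.
have [|m' Im' hm'] := @q_lt y (q y + e / 2); first by rewrite ltrDl.
apply: le_trans (q_le _ (idealD Iid Im Im')) _.
rewrite opprD addrACA; apply: le_trans (cnormD_le _ _) _.
apply: le_trans (lerD (ltW hm) (ltW hm')) _; lra.
Qed.

Let qM x y : q (x * y) <= q x * q y.
Proof.
have main e : 0 < e -> q (x * y) <= (q x + e) * (q y + e).
  move=> e0; have [|m Im hm] := @q_lt x (q x + e); first by rewrite ltrDl.
  have [|m' Im' hm'] := @q_lt y (q y + e); first by rewrite ltrDl.
  apply: le_trans (_ : nrm ((x - m) * (y - m')) <= _).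
    have -> : (x - m) * (y - m') = x * y - (y * m + (x - m) * m') by ring.
    by apply: q_le; apply: idealD => //; apply: idealM.
  by apply: le_trans (cnormM_le _ _) _; apply: ler_pM; rewrite ?cnorm_ge0 // ltW.
apply/ler_addgt0Pr => e e0.
(* [d] is chosen so that [d (q x + q y + d) <= e]. *)
pose d := Num.min 1 (e / (q x + q y + 1)).
have K0 : 0 < q x + q y + 1 by have := q_ge0 x; have := q_ge0 y; lra.
have d0 : 0 < d by rewrite lt_min ltr01 divr_gt0.
have d1 : d <= 1 by rewrite ge_min lexx.
have de : d * (q x + q y + 1) <= e by rewrite -ler_pdivlMr // ge_min lexx orbT.
apply: le_trans (main d d0) _; have := q_ge0 x; have := q_ge0 y; nra.
Qed.

Let qZ k x : q (k *: x) = modc k * q x.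
Proof.
have le k' x' : k' != 0 -> q (k' *: x') <= modc k' * q x'.
  move=> k0; have mk : 0 < modc k' by rewrite modc_gt0.
  rewrite mulrC -ler_pdivrMr //; apply: q_ge => m Im.
  rewrite ler_pdivrMr // mulrC -cnormZE scalerBr; apply: q_le.
  by rewrite -mulr_algl; apply: idealM.
have [->|k0] := eqVneq k 0.
  apply/eqP; rewrite scale0r /modc normr0 mul0r eq_le q_ge0 andbT.
  by rewrite -(cnorm0 A) qx.
apply/eqP; rewrite eq_le le //= mulrC -ler_pdivlMr ?modc_gt0 //.
rewrite mulrC -{1}[x]scale1r -(mulVf k0) -scalerA; apply: le_trans (le _ _ _) _.
  by rewrite invr_eq0.
rewrite ler_wpM2r // le_eqVlt; apply/orP; left; apply/eqP.
have mk : modc k != 0 by rewrite gt_eqF // modc_gt0.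
by apply: (mulfI mk); rewrite -modcM !divff ?modc1.
Qed.

(** Otherwise every [l - a] lies outside [I], so maximality makes it invertible modulo [I], against
    Gelfand-Mazur for the quotient seminorm. *)
Lemma maximal_scalar a : exists l : R[i], I (a - l%:A).
Proof.
apply: contrapT => h.
have /choice[c cE] : forall l : R[i], exists c, q ((l%:A - a) * c - 1) = 0.
  move=> l; have [|b [m [Im E]]] := Imax (a := l%:A - a).
    by move=> Il; apply: h; exists l; rewrite -opprB; apply: IN.
  exists b; apply/eqP; rewrite eq_le q_ge0 andbT.
  have Im' : I ((l%:A - a) * b - 1).
    have -> : (l%:A - a) * b = 1 - m by apply/eqP; rewrite eq_sym subr_eq E.
    by rewrite addrAC subrr sub0r; apply: IN.
  by apply: le_trans (q_le _ Im') _; rewrite subrr cnorm0.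
exact: (gelfand_mazur qD qM qZ q1 cE).
Qed.

End Quotient.

(** The character reads off the scalar to which an element is congruent modulo a maximal ideal
    containing [f]; properness makes this scalar unique, and uniqueness yields the algebraic
    laws. *)
Lemma char_exists (f : A) : (forall y, f * y <> 1) ->
  exists chi : {rmorphism A -> R[i]}, [/\ chi f = 0, forall k : R[i], chi k%:A = k &
    forall x, chi (star x) = (chi x)^*].
Proof.
move=> fN; have [I [Iid If Imax]] := maximal_ideal fN.
have I0 : I 0 by rewrite -(mul0r f); apply: idealM Iid _ _ If.
have IB x y : I x -> I y -> I (x - y).
  by move=> Ix Iy; rewrite -mulN1r; apply: (idealD Iid) => //; apply: idealM.
have /choice[chi chiE] := maximal_scalar Iid I0 Imax.
have chi_uniq x k : I (x - k%:A) -> chi x = k.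
  move=> xk; apply/eqP; rewrite -subr_eq0; apply: contrapT => /negP k0.
  apply: (ideal_proper Iid).
  have -> : 1 = (chi x - k)^-1%:A * ((x - k%:A) - (x - (chi x)%:A)).
    rewrite mulr_algl (_ : x - k%:A - (x - (chi x)%:A) = (chi x - k)%:A); last by
      rewrite scalerBl opprB addrC addrA subrK.
    by rewrite scalerA mulVf // scale1r.
  by apply: idealM => //; apply: IB.
have chiD x y : chi (x + y) = chi x + chi y.
  by apply: chi_uniq; rewrite scalerDl opprD addrACA; apply: idealD.
have chiZ k : chi k%:A = k by apply: chi_uniq; rewrite subrr.
have chiM x y : chi (x * y) = chi x * chi y.
  apply: chi_uniq.
  rewrite (_ : _ - _ = y * (x - (chi x)%:A) + (chi x)%:A * (y - (chi y)%:A)).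
    by apply: idealD => //; apply: idealM.
  by rewrite -scalerA -[in LHS]mulr_algl; ring.
have chiN x : chi (- x) = - chi x.
  have chi0 : chi 0 = 0 by rewrite -{1}(scale0r 1) chiZ.
  by apply/eqP; rewrite -addr_eq0 -chiD addNr chi0.
(* If [|chi x|] exceeded the norm, [1 - x / chi x] would be invertible by the Neumann series
   although [chi] kills it. *)
have chi_le x : modc (chi x) <= nrm x.
  rewrite leNgt; apply/negP => h.
  have x0 : chi x != 0 by rewrite -modc_gt0 (le_lt_trans _ h) // cnorm_ge0.
  have mx0 : 0 < modc (chi x) by rewrite modc_gt0.
  have [|y xy] := @neumann R A (1 - (chi x)^-1 *: x).
    rewrite subKr cnormZE -ltr_pdivlMl ?modc_gt0 ?invr_eq0 //.
    rewrite mulr1 (_ : (modc (chi x)^-1)^-1 = modc (chi x)) //.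
    have mx1 := lt0r_neq0 mx0; apply: (mulfI (lt0r_neq0 (_ : 0 < modc (chi x)^-1))).
      by rewrite modc_gt0 invr_eq0.
    rewrite divff ?gt_eqF ?modc_gt0 ?invr_eq0 //.
    by rewrite -modcM mulVf // modc1.
  have := chiM (1 - (chi x)^-1 *: x) y.
  rewrite xy chiD chiN -mulr_algl chiM chiZ mulVf // -[1](scale1r 1) chiZ subrr mul0r.
  by move/eqP; rewrite oner_eq0.
have Re_real (z : R[i]) : complex.Im z = 0 -> z^* = z.
  by case: z => u v /= ->; apply/eqP; rewrite eq_complex /= oppr0 !eqxx.
(* Arens's trick: compare [|chi (x + i t)|^2] with the norm of [x^2 + t^2]. The terms in [t^2]
   cancel, which leaves an upper bound on a linear function of [t], so its slope is zero. *)
have chi_real x : star x = x -> complex.Im (chi x) = 0.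
  move=> xs; set al := complex.Re (chi x); set be := complex.Im (chi x).
  have key (t : R) : al ^+ 2 + (be + t) ^+ 2 <= nrm (x * x) + t ^+ 2.
    pose y := x + ('i * t%:C)%:A.
    have -> : al ^+ 2 + (be + t) ^+ 2 = modc (chi y) ^+ 2.
      rewrite /y chiD chiZ; apply: (@complexI R); rewrite rmorphXn /= modcE
        -add_Re2_Im2.
      congr (_%:C); rewrite /al /be; case: (chi x) => u v /=.
      by rewrite !(mul0r, mulr0, mul1r, subr0, addr0, add0r).
    apply: le_trans (_ : nrm y ^+ 2 <= _); first by rewrite ler_pXn2r ?nnegrE
      ?modc_ge0 ?cnorm_ge0.
    rewrite -cnorm_starM.
    have -> : star y * y = x * x + (t%:C ^+ 2)%:A.
      rewrite /y starD xs starZ star1.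
      have -> : Num.conj ('i * t%:C) = - ('i * t%:C).
        apply/eqP; rewrite eq_complex /=; apply/andP; split; apply/eqP; ring.
      rewrite scaleNr (_ : (t%:C ^+ 2)%:A = - (('i * t%:C)%:A * ('i * t%:C)%:A));
        first by ring.
      by rewrite mulr_algl scalerA -scaleNr; congr (_ *: _); rewrite mulrACA
        -expr2 sqr_i mulN1r opprK expr2.
    apply: le_trans (cnormD_le _ _) _; rewrite lerD2l cnormZE cnorm1 mulr1.
    by rewrite modcX modcR real_normK ?num_real.
  have h (t : R) : 2 * be * t <= nrm (x * x).
    by have := key t; have := sqr_ge0 al; have := sqr_ge0 be; rewrite !expr2; nra.
  apply/eqP; apply: contrapT => /negP be0.
  have := h ((nrm (x * x) + 1) / (2 * be)).
  rewrite mulrC divfK ?mulf_neq0 ?pnatr_eq0 // => {}h.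
  by have : nrm (x * x) < nrm (x * x) + 1 by [rewrite ltrDl]; lra.
have chiB : zmod_morphism chi by move=> x y; rewrite chiD chiN.
have chiM1 : monoid_morphism chi.
  by split=> // ; rewrite -[1](scale1r 1) chiZ.
pose chi' : {rmorphism A -> R[i]} := HB.pack chi (GRing.isZmodMorphism.Build _ _
  chi chiB)
  (GRing.isMonoidMorphism.Build _ _ chi chiM1).
exists chi'; split => //=.
  by apply: chi_uniq; rewrite scale0r subr0.
move=> x; have chiZx k y : chi (k *: y) = k * chi y by rewrite -mulr_algl chiM chiZ.
(* General [x] reduces to the self-adjoint elements [x + star x] and [i (x - star x)]. *)
pose h := x + star x; pose k := 'i *: (x - star x).
have hs : star h = h by rewrite /h starD starK addrC.
have starN y : star (- y) = - star y :> A.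
  by rewrite -scaleN1r starZ rmorphN rmorph1 scaleN1r.
have ks : star k = k.
  by rewrite /k starZ starD starN starK conjCi scaleNr -scalerN opprB.
have hr := Re_real _ (chi_real _ hs); have kr := Re_real _ (chi_real _ ks).
rewrite /h chiD in hr; rewrite /k chiZx chiB in kr.
have two : (2 : R[i]) != 0 by rewrite pnatr_eq0.
have ii : 'i * 'i = -1 :> R[i] by rewrite -expr2 sqrCi.
have {}kr : (chi x - chi (star x))^* = - (chi x - chi (star x)).
  apply: (mulfI (neq0Ci _)); rewrite mulrN -[in RHS]kr rmorphM /= conjCi; ring.
rewrite rmorphD /= in hr; rewrite rmorphB /= in kr.
apply: (mulfI two); apply/eqP; rewrite -subr_eq0; apply/eqP.
set u := chi x in hr kr *; set v := chi (star x) in hr kr *.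
transitivity ((u + v - (u^* + v^*)) - (u^* - v^* - - (u - v))); first by ring.
by rewrite hr kr !subrr.
Qed.

End Character.

(** * Positive matrices over a commutative C*-algebra *)

Section MatrixPositivity.
Variables (R : realType) (A : comCStar R).

Definition star_character (chi : {rmorphism A -> R[i]}) : Prop :=
  (forall k : R[i], chi k%:A = k) /\ forall x, chi (star x) = (chi x)^*.

Lemma invertiblemx_det m (x : 'M[A]_m) : (exists y, \det x * y = 1) -> invertiblemx x.
Proof.
move=> [y xy]; exists (y *: \adj x).
by rewrite -scalemxAr -scalemxAl mul_mx_adj mul_adj_mx scale_scalar_mx mulrC xy.
Qed.

Lemma map_spectrum (chi : {rmorphism A -> R[i]}) m (x : 'M[A]_m) k :
  star_character chi ->
  map_mx chi (x - (k%:A : A)%:M) = map_mx chi x - k%:M.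
Proof. by move=> [chiA _]; rewrite map_mxB map_scalar_mx /= chiA. Qed.

Lemma posmx_psdmx (chi : {rmorphism A -> R[i]}) m (x : 'M[A]_m) :
  star_character chi -> posmx x -> psdmx (map_mx chi x).
Proof.
move=> chiP [xs xpos]; apply: psdmx_eigenvalue.
  apply/hermsymmxP; rewrite -[in RHS]xs; apply/matrixP => i j.
  by rewrite !mxE chiP.2.
move=> k dk; apply: xpos => -[y [xy _]].
have := congr1 (fun M => \det (map_mx chi M)) xy.
rewrite map_mxM map_spectrum // det_mulmx dk mul0r map_mx1 det1 => /esym/eqP.
by rewrite oner_eq0.
Qed.

(** A spectral value [k] makes [det (x - k)] non-invertible, by the adjugate formula; a character
    killing it turns [k] into an eigenvalue of the complex matrix [chi x], hence nonnegative. *)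
Lemma psdmx_posmx m (x : 'M[A]_m) : selfadjmx x ->
  (forall chi : {rmorphism A -> R[i]}, star_character chi -> psdmx (map_mx chi x)) ->
  posmx x.
Proof.
move=> xs xpos; split=> // k kN.
have [chi [chi0 chiA chis]] : exists chi : {rmorphism A -> R[i]},
    [/\ chi (\det (x - (k%:A : A)%:M)) = 0, forall k : R[i], chi k%:A = k &
    forall x, chi (star x) = (chi x)^*].
  by apply: char_exists => y xy; apply: kN; apply: invertiblemx_det; exists y.
have chiP : star_character chi by [].
rewrite -det_map_mx map_spectrum // in chi0.
have /eqP/det0P[v v0 vE] := chi0.
have := xpos chi chiP (v^t*); rewrite /sform trmxCK.
have -> : v *m map_mx chi x = k *: v.
  by apply/eqP; rewrite -subr_eq0 -mul_mx_scalar -mulmxBr vE.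
rewrite -scalemxAl mxE; have : 0 < (v *m v^t*) 0 0.
  rewrite mxE lt0r; apply/andP; split; last first.
    by apply: sumr_ge0 => i _; rewrite !mxE mul_conjC_ge0.
  apply: contraNneq v0 => /eqP; rewrite psumr_eq0 => [/allP v0|i _].
    apply/eqP/rowP => i; have := v0 i; rewrite mem_index_enum !mxE => /(_ isT).
    by rewrite mul_conjC_eq0 => /eqP.
  by rewrite !mxE mul_conjC_ge0.
by move=> v_gt0; rewrite pmulr_lge0.
Qed.

(** The form computed inside [A], so that over bounded functions a square root can be taken before
    an arbitrary character is applied. *)
Definition cstar_sform m (x : 'M[A]_m) (v : 'cV[R[i]]_m) : A :=
  \sum_i \sum_j ((v i 0)^*)%:A * x i j * (v j 0)%:A.

Lemma sform_map (chi : {rmorphism A -> R[i]}) m (x : 'M[A]_m) v :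
  star_character chi -> sform (map_mx chi x) v v = chi (cstar_sform x v).
Proof.
move=> [chiA _]; rewrite sformE rmorph_sum; apply: eq_bigr => i _.
rewrite rmorph_sum; apply: eq_bigr => j _.
by rewrite !rmorphM !chiA mxE.
Qed.

End MatrixPositivity.

(** * The C*-algebra of bounded functions *)

Section BoundedFunctions.
Variables (R : realType) (X : pointedType).

(** All bounded functions instead of continuous ones, so that [X] carries no topology; the base
    point gives [1 != 0] and nonempty suprema. *)
Record linf := Linf {
  linf_fun :> X -> R[i];
  linf_bounded : exists M : R, forall x, modc (linf_fun x) <= M }.

HB.instance Definition _ := gen_eqMixin linf.
HB.instance Definition _ := gen_choiceMixin linf.

Lemma linfP (f g : linf) : (forall x, f x = g x) -> f = g.
Proof.
case: f g => [f fb] [g gb] /= fg; have E : f = g by apply/funext.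
by rewrite -E in gb *; congr Linf; apply: Prop_irrelevance.
Qed.

Lemma linf_cst_subproof (k : R[i]) : exists M : R, forall x : X, modc ((fun=> k)
  x) <= M.
Proof. by exists (modc k). Qed.

Lemma linf_add_subproof (f g : linf) : exists M : R, forall x, modc (f x + g x) <= M.
Proof.
have [[M fM] [N gN]] := (linf_bounded f, linf_bounded g).
by exists (M + N) => x; apply: le_trans (modcD _ _) _; rewrite lerD.
Qed.

Lemma linf_mul_subproof (f g : linf) : exists M : R, forall x, modc (f x * g x) <= M.
Proof.
have [[M fM] [N gN]] := (linf_bounded f, linf_bounded g).
by exists (M * N) => x; rewrite modcM ler_pM ?modc_ge0.
Qed.

Lemma linf_opp_subproof (f : linf) : exists M : R, forall x, modc (- f x) <= M.
Proof. by have [M fM] := linf_bounded f; exists M => x; rewrite modcN. Qed.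

Lemma linf_conj_subproof (f : linf) : exists M : R, forall x, modc ((f x)^*) <= M.
Proof. by have [M fM] := linf_bounded f; exists M => x; rewrite /modc norm_conjC
  fM. Qed.

Definition linf_cst k := Linf (linf_cst_subproof k).
Definition linf_add f g := Linf (linf_add_subproof f g).
Definition linf_mul f g := Linf (linf_mul_subproof f g).
Definition linf_opp f := Linf (linf_opp_subproof f).
Definition linf_conj f := Linf (linf_conj_subproof f).

Fact linf_addA : associative linf_add.
Proof. by move=> f g h; apply: linfP => x; apply: addrA. Qed.
Fact linf_addC : commutative linf_add.
Proof. by move=> f g; apply: linfP => x; apply: addrC. Qed.
Fact linf_add0 : left_id (linf_cst 0) linf_add.
Proof. by move=> f; apply: linfP => x; apply: add0r. Qed.
Fact linf_addN : left_inverse (linf_cst 0) linf_opp linf_add.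
Proof. by move=> f; apply: linfP => x; apply: addNr. Qed.
HB.instance Definition _ :=
  GRing.isZmodule.Build linf linf_addA linf_addC linf_add0 linf_addN.

Fact linf_mulA : associative linf_mul.
Proof. by move=> f g h; apply: linfP => x; apply: mulrA. Qed.
Fact linf_mulC : commutative linf_mul.
Proof. by move=> f g; apply: linfP => x; apply: mulrC. Qed.
Fact linf_mul1 : left_id (linf_cst 1) linf_mul.
Proof. by move=> f; apply: linfP => x; apply: mul1r. Qed.
Fact linf_mulDl : left_distributive linf_mul linf_add.
Proof. by move=> f g h; apply: linfP => x; apply: mulrDl. Qed.
Fact linf_1_neq0 : linf_cst 1 != linf_cst 0.
Proof. by apply/eqP => /(congr1 (fun f : linf => f point))/eqP; rewrite oner_eq0. Qed.
HB.instance Definition _ := GRing.Zmodule_isComNzRing.Build linf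
  linf_mulA linf_mulC linf_mul1 linf_mulDl linf_1_neq0.

Definition linf_scale k f := linf_mul (linf_cst k) f.
Fact linf_scaleA k l f : linf_scale k (linf_scale l f) = linf_scale (k * l) f.
Proof. by apply: linfP => x; apply: mulrA. Qed.
Fact linf_scale1 : left_id 1 linf_scale.
Proof. by move=> f; apply: linfP => x; apply: mul1r. Qed.
Fact linf_scaleDr : right_distributive linf_scale +%R.
Proof. by move=> k f g; apply: linfP => x; apply: mulrDr. Qed.
Fact linf_scaleDl f : {morph linf_scale^~ f : k l / k + l}.
Proof. by move=> k l; apply: linfP => x; apply: mulrDl. Qed.
HB.instance Definition _ := GRing.Zmodule_isLmodule.Build R[i] linf
  linf_scaleA linf_scale1 linf_scaleDr linf_scaleDl.

Fact linf_scaleAl (k : R[i]) (f g : linf) : k *: (f * g) = (k *: f) * g.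
Proof. by apply: linfP => x; apply: mulrA. Qed.
HB.instance Definition _ := GRing.Lmodule_isLalgebra.Build R[i] linf linf_scaleAl.
HB.instance Definition _ := GRing.Lalgebra_isComAlgebra.Build R[i] linf.

Definition linf_norm (f : linf) : R := sup (range (fun x => modc (f x))).

Lemma linf_has_sup (f : linf) : has_sup (range (fun x => modc (f x))).
Proof.
split; first by exists (modc (f point)), point.
by have [M fM] := linf_bounded f; exists M => _ [x _ <-].
Qed.

Lemma linf_norm_ge (f : linf) x : modc (f x) <= linf_norm f.
Proof. by apply: ub_le_sup; [apply: (linf_has_sup f).2 | exists x]. Qed.

Lemma linf_norm_le (f : linf) M : (forall x, modc (f x) <= M) -> linf_norm f <= M.
Proof. by move=> h; apply: ge_sup; [apply: (linf_has_sup f).1 | move=> _ [x _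
  <-]]. Qed.

Fact linf_normD f g : linf_norm (f + g) <= linf_norm f + linf_norm g.
Proof.
by apply: linf_norm_le => x; apply: le_trans (modcD _ _) _; rewrite lerD
  ?linf_norm_ge.
Qed.

Fact linf_normZ (k : R[i]) f : (linf_norm (k *: f))%:C = `|k| * (linf_norm f)%:C.
Proof.
rewrite -modcE -rmorphM; congr (_%:C); apply/eqP; rewrite eq_le; apply/andP; split.
  by apply: linf_norm_le => x; rewrite modcM ler_wpM2l ?modc_ge0 ?linf_norm_ge.
have [->|k0] := eqVneq k 0.
  rewrite {1}/modc normr0 mul0r; apply: le_trans (linf_norm_ge _ point); exact:
    modc_ge0.
rewrite mulrC -ler_pdivlMr ?modc_gt0 //; apply: linf_norm_le => x.
rewrite ler_pdivlMr ?modc_gt0 // mulrC -modcM; exact: (linf_norm_ge (k *: f) x).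
Qed.

Fact linf_norm_eq0 f : linf_norm f = 0 -> f = 0.
Proof.
move=> f0; apply: linfP => x; have := linf_norm_ge f x; rewrite f0.
by move=> h; apply/eqP; rewrite -[_ == _]negbK -modc_gt0 -leNgt.
Qed.

Fact linf_normM f g : linf_norm (f * g) <= linf_norm f * linf_norm g.
Proof. by apply: linf_norm_le => x; rewrite modcM ler_pM ?modc_ge0 ?linf_norm_ge. Qed.

Fact linf_norm_conj f : linf_norm (linf_conj f * f) = linf_norm f ^+ 2.
Proof.
have mE x : modc ((linf_conj f * f) x) = modc (f x) ^+ 2.
  transitivity (modc ((f x)^* * f x)); first by [].
  by rewrite modcM expr2 {1}/modc norm_conjC.
have n0 : 0 <= linf_norm f by apply: le_trans (linf_norm_ge f point); apply: modc_ge0.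
apply/eqP; rewrite eq_le; apply/andP; split.
  by apply: linf_norm_le => x; rewrite mE ler_pXn2r ?nnegrE ?modc_ge0 ?linf_norm_ge.
have s0 : 0 <= linf_norm (linf_conj f * f).
  by apply: le_trans (linf_norm_ge _ point); apply: modc_ge0.
rewrite -[leRHS]sqr_sqrtr // ler_pXn2r ?nnegrE ?sqrtr_ge0 //.
apply: linf_norm_le => x; rewrite -[leLHS]ger0_norm ?modc_ge0 // -sqrtr_sqr.
by rewrite ler_wsqrtr // -mE linf_norm_ge.
Qed.

(** The index [n] that works for [e] along the sequence also works for its limit; this keeps
    pointwise limits of bounded functions uniform in the point. *)
Lemma cauchy_limit (v : nat -> R) :
    (forall e, 0 < e -> exists n, forall p r, (n <= p)%N -> (n <= r)%N -> `|v p -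
      v r| < e) ->
  exists l, forall e n, (forall p r, (n <= p)%N -> (n <= r)%N -> `|v p - v r| < e) ->
    forall p, (n <= p)%N -> `|v p - l| <= e.
Proof.
move=> cv; have : cvg (v @ \oo).
  apply: cauchy_cvg; apply: cauchy_exP => e e0; have [n hn] := cv e e0.
  by exists (v n), n => // p np; rewrite /ball /=; apply: hn.
move=> /cvg_ex[/= l vl]; exists l => e n hn p np; apply/ler_addgt0Pr => d d0.
have /cvgrPdist_lt /(_ d d0) [m _ hm] := vl.
have := hm (maxn n m) (leq_maxr _ _); rewrite /= distrC => /ltW h1.
have h2 := ltW (hn p _ np (leq_maxl n m)).
by rewrite -[v p](subrK (v (maxn n m))) -addrA; apply: le_trans (ler_normD _ _)
  _; rewrite lerD.
Qed.

Fact linf_complete (u : nat -> linf) :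
    (forall e : R, 0 < e -> exists n0 : nat, forall p q : nat,
       (n0 <= p)%N -> (n0 <= q)%N -> linf_norm (u p - u q) < e) ->
    exists l, (fun p => linf_norm (u p - l)) @ \oo --> (0 : R).
Proof.
move=> cu.
(* Real and imaginary parts are treated alike, through an additive real-valued [g] dominated by the
   modulus. *)
have lim (g : R[i] -> R) : (forall k, `|g k| <= modc k) -> (forall k l, g (k - l)
  = g k - g l) ->
    exists l : X -> R, forall x e n,
      (forall p r, (n <= p)%N -> (n <= r)%N -> linf_norm (u p - u r) < e) ->
      forall p, (n <= p)%N -> `|g (u p x) - l x| <= e.
  move=> gle gB.
  have le p r x : `|g (u p x) - g (u r x)| <= linf_norm (u p - u r).
    by rewrite -gB; apply: le_trans (gle _) _; apply: (linf_norm_ge (u p - u r)).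
  have /choice[l lP] : forall x, exists l : R, forall e n,
      (forall p r, (n <= p)%N -> (n <= r)%N -> `|g (u p x) - g (u r x)| < e) ->
      forall p, (n <= p)%N -> `|g (u p x) - l| <= e.
    move=> x; apply: cauchy_limit => e e0; have [n hn] := cu e e0; exists n => p
      r np nr.
    exact: le_lt_trans (le _ _ _) (hn _ _ np nr).
  exists l => x e n hn; apply: lP => p r np nr.
  exact: le_lt_trans (le _ _ _) (hn _ _ np nr).
have [re reP] := lim (@complex.Re R) (@modc_Re R) (fun k l => raddfB _ k l).
have [im imP] := lim (@complex.Im R) (@modc_Im R) (fun k l => raddfB _ k l).
have lP e n : (forall p r, (n <= p)%N -> (n <= r)%N -> linf_norm (u p - u r) < e) ->
    forall p x, (n <= p)%N -> modc (u p x - (re x +i* im x)) <= e + e.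
  move=> hn p x np.
  have -> : u p x - (re x +i* im x) =
      (complex.Re (u p x) - re x) +i* (complex.Im (u p x) - im x) by case: (u p x).
  by apply: le_trans (modc_rect _ _) _; rewrite lerD ?(reP _ _ _ hn) ?(imP _ _ _ hn).
have lb : exists M : R, forall x, modc (re x +i* im x) <= M.
  have [n hn] := cu 1 ltr01; exists (1 + 1 + linf_norm (u n)) => x.
  rewrite -[re x +i* im x](subKr (u n x)) addrC; apply: le_trans (modcD _ _) _.
  by rewrite modcN lerD ?linf_norm_ge ?(lP _ _ hn).
exists (Linf lb); apply/cvgr0Pnorm_le => e e0.
have e2 : 0 < e / 2 by rewrite divr_gt0.
have [n hn] := cu _ e2; exists n => // p np /=.
have n0 : 0 <= linf_norm (u p - Linf lb).
  by apply: le_trans (linf_norm_ge _ point); apply: modc_ge0.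
rewrite ger0_norm //; apply: linf_norm_le => x.
by rewrite (splitr e); apply: (lP _ _ hn).
Qed.

Fact linf_conjD f g : linf_conj (f + g) = linf_conj f + linf_conj g.
Proof. by apply: linfP => x; apply: rmorphD. Qed.
Fact linf_conjZ (k : R[i]) f : linf_conj (k *: f) = Num.conj k *: linf_conj f.
Proof. by apply: linfP => x; apply: rmorphM. Qed.
Fact linf_conjM f g : linf_conj (f * g) = linf_conj g * linf_conj f.
Proof. by apply: linfP => x; rewrite mulrC; apply: rmorphM. Qed.
Fact linf_conjK : involutive linf_conj.
Proof. by move=> f; apply: linfP => x; apply: conjCK. Qed.

Definition linf_cstar : comCStar R := @ComCStar R linf linf_conj linf_norm
  linf_conjD linf_conjZ linf_conjM linf_conjK linf_normD linf_normZ linf_norm_eq0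
  linf_normM linf_norm_conj linf_complete.

Definition linf_eval (x : X) (f : linf_cstar) : R[i] := linf_fun f x.

Fact linf_eval_zmod x : zmod_morphism (linf_eval x). Proof. by []. Qed.
Fact linf_eval_monoid x : monoid_morphism (linf_eval x). Proof. by []. Qed.
HB.instance Definition _ x := GRing.isZmodMorphism.Build linf_cstar R[i] (linf_eval x)
  (linf_eval_zmod x).
HB.instance Definition _ x := GRing.isMonoidMorphism.Build linf_cstar R[i]
  (linf_eval x)
  (linf_eval_monoid x).

Lemma linf_eval_char x : star_character (linf_eval x).
Proof. by split=> // k; apply: mulr1. Qed.

(* A pointwise nonnegative function is [star g * g] with [g] its pointwise square
   root, hence nonnegative under every character. *)
Lemma linf_posmx m (M : 'M[linf_cstar]_m) : selfadjmx M ->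
  (forall x, psdmx (map_mx (linf_eval x) M)) -> posmx M.
Proof.
move=> Ms Mp; apply: psdmx_posmx => // chi chiP v.
rewrite sform_map //; set f := cstar_sform M v.
have f0 x : 0 <= linf_eval x f.
  by have := Mp x v; rewrite sform_map //; apply: linf_eval_char.
have [K fK] := linf_bounded f.
have gb : exists K : R, forall x, modc (sqrtC (linf_eval x f)) <= K.
  exists (Num.sqrt K) => x; rewrite -[leLHS]ger0_norm ?modc_ge0 // -sqrtr_sqr.
  by rewrite ler_wsqrtr // -modcX sqrtCK; apply: fK.
pose g : linf_cstar := Linf gb.
have -> : f = star g * g.
  apply: linfP => x; rewrite -[RHS]/((sqrtC (linf_eval x f))^* * sqrtC (linf_eval
    x f)).
  by rewrite (CrealP (ger0_real _)) ?sqrtC_ge0 // -expr2 sqrtCK.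
by rewrite rmorphM chiP.2 mulrC mul_conjC_ge0.
Qed.

End BoundedFunctions.

(** * Dual operator systems *)

Section Pairing.
Variable R : realType.
Local Notation tup N s := 'rV['M[R[i]]_s]_N.

(** Bilinear, with no conjugation, so the adjoint of compression by [m] is compression by [m^T]. *)
Definition pairing N s (a y : tup N s) : R[i] :=
  \sum_j \sum_k \sum_l a 0 j k l * y 0 j k l.

Lemma pairingC N s (a y : tup N s) : pairing a y = pairing y a.
Proof.
by apply: eq_bigr => j _; apply: eq_bigr => k _; apply: eq_bigr => l _; apply: mulrC.
Qed.

Lemma pairing_raddf N s (a : tup N s) : zmod_morphism (pairing a).
Proof.
move=> x y; rewrite /pairing -sumrB; apply: eq_bigr => j _; rewrite -sumrB.
by apply: eq_bigr => k _; rewrite -sumrB; apply: eq_bigr => l _; rewrite !mxE mulrBr.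
Qed.

HB.instance Definition _ N s (a : tup N s) :=
  GRing.isZmodMorphism.Build (tup N s) R[i] (pairing a) (pairing_raddf a).

Lemma pairingZ N s (r : R) (a y : tup N s) :
  pairing a (map_mx ( *:%R r%:C) y) = r%:C * pairing a y.
Proof.
rewrite /pairing mulr_sumr; apply: eq_bigr => j _; rewrite mulr_sumr.
by apply: eq_bigr => k _; rewrite mulr_sumr; apply: eq_bigr => l _; rewrite !mxE
  mulrCA.
Qed.

Lemma pairing_compress N s t (m : 'M[R[i]]_(s, t)) (a : tup N s) (y : tup N t) :
  pairing (compress m a) y = pairing a (compress m^T y).
Proof.
apply: eq_bigr => j _.
transitivity (\sum_k \sum_l \sum_p \sum_q (m p k)^* * a 0 j p q * m q l * y 0 j k l).
  apply: eq_bigr => k _; apply: eq_bigr => l _; rewrite !mxE mulr_suml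
    exchange_big /=.
  apply: eq_bigr => q _; rewrite !mxE mulr_suml mulr_suml.
  by apply: eq_bigr => p _; rewrite !mxE.
under eq_bigr => k _ do rewrite exchange_big.
rewrite exchange_big; apply: eq_bigr => p _ /=.
under eq_bigr => k _ do rewrite exchange_big.
rewrite exchange_big; apply: eq_bigr => q _ /=.
rewrite !mxE mulr_sumr exchange_big; apply: eq_bigr => l _ /=.
rewrite !mxE mulr_suml mulr_sumr; apply: eq_bigr => k _.
by rewrite !mxE; ring.
Qed.

Lemma hermsymmx_conj n (M : 'M[R[i]]_n) k l : M \is hermsymmx -> (M k l)^* = M l k.
Proof. by move=> /hermsymmxP/matrixP/(_ l k); rewrite !mxE. Qed.

Lemma pairing_real N s (a y : tup N s) : hermtuple R N s a -> hermtuple R N s y ->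
  pairing a y \is Num.real.
Proof.
move=> ah yh; apply/CrealP; rewrite rmorph_sum; apply: eq_bigr => j _.
rewrite rmorph_sum.
under eq_bigr => k _ do rewrite rmorph_sum.
rewrite exchange_big; apply: eq_bigr => k _; apply: eq_bigr => l _.
by rewrite rmorphM /= !hermsymmx_conj.
Qed.

Lemma hermtuple0 N s : hermtuple R N s 0.
Proof. by move=> j; rewrite mxE; apply/hermsymmxP; rewrite trmx0 map_mx0. Qed.

Lemma hermtupleD N s (x y : tup N s) :
  hermtuple R N s x -> hermtuple R N s y -> hermtuple R N s (x + y).
Proof.
move=> xh yh j; rewrite mxE; apply/hermsymmxP; rewrite conjtrD.
by have /hermsymmxP -> := xh j; have /hermsymmxP -> := yh j.
Qed.

Lemma hermtupleZ N s (r : R) (x : tup N s) :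
  hermtuple R N s x -> hermtuple R N s (map_mx ( *:%R r%:C) x).
Proof.
move=> xh j; rewrite mxE; apply/hermsymmxP; rewrite linearZ /= map_mxZ /=.
have /hermsymmxP -> := xh j; congr (_ *: _).
by apply/CrealP; rewrite complex_real.
Qed.

Lemma hermtuple_compress N s t (m : 'M[R[i]]_(s, t)) (x : tup N s) :
  hermtuple R N s x -> hermtuple R N t (compress m x).
Proof.
move=> xh j; rewrite mxE; apply/hermsymmxP; rewrite !conjtr_mul trmxCK.
by have /hermsymmxP -> := xh j; rewrite mulmxA.
Qed.

Lemma compressM N s t r (m : 'M[R[i]]_(s, t)) (p : 'M[R[i]]_(t, r)) (x : tup N s) :
  compress p (compress m x) = compress (m *m p) x.
Proof. by apply/rowP => j; rewrite !mxE conjtr_mul !mulmxA. Qed.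

(** A vector of the tensor product is a [d] by [s] matrix [X], and the form of a sum of Kronecker
    products at it becomes a pairing with a compression. This links positivity in a realization to
    duality. *)
Lemma tensmx_form d s N (U : tup N d) (a : tup N s) (X : 'M[R[i]]_(d, s)) :
  let v : 'cV[R[i]]_(d * s) := \col_p X (mxtens_unindex p).1 (mxtens_unindex p).2 in
  sform (\sum_j tensmx (U 0 j) (a 0 j)) v v = pairing a (compress X U).
Proof.
move=> v; rewrite sformE.
have reix (F : 'I_(d * s) -> R[i]) :
    \sum_p F p = \sum_(i < d) \sum_(k < s) F (mxtens_index (i, k)).
  rewrite pair_bigA (reindex (@mxtens_index d s)) /=; last first.
    by exists (@mxtens_unindex d s) => p _; rewrite (mxtens_indexK, mxtens_unindexK).
  by apply: eq_bigr => -[].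
rewrite reix.
under eq_bigr => p _ do under eq_bigr => k _ do rewrite reix.
transitivity (\sum_j \sum_p \sum_k \sum_q \sum_l
    (X p k)^* * (U 0 j p q * a 0 j k l) * X q l).
  rewrite [RHS]exchange_big; apply: eq_bigr => p _ /=.
  rewrite [RHS]exchange_big; apply: eq_bigr => k _ /=.
  rewrite [RHS]exchange_big; apply: eq_bigr => q _ /=.
  rewrite [RHS]exchange_big; apply: eq_bigr => l _ /=.
  rewrite !mxE summxE !mxtens_indexK /= mulr_sumr mulr_suml; apply: eq_bigr => j _.
  by rewrite tensmxE.
apply: eq_bigr => j _; rewrite exchange_big; apply: eq_bigr => k _ /=.
under eq_bigr => p _ do rewrite exchange_big.
rewrite exchange_big; apply: eq_bigr => l _ /=.
rewrite !mxE mulr_sumr exchange_big; apply: eq_bigr => q _ /=.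
by rewrite !mxE mulr_suml mulr_sumr; apply: eq_bigr => p _; rewrite !mxE; ring.
Qed.

Lemma psdmx_tensP d s N (U : tup N d) (a : tup N s) :
  psdmx (\sum_j tensmx (U 0 j) (a 0 j)) <->
  forall X : 'M[R[i]]_(d, s), 0 <= pairing a (compress X U).
Proof.
split=> [h X|h v]; first by rewrite -tensmx_form; apply: h.
have := h (\matrix_(p, k) v (mxtens_index (p, k)) 0); rewrite -tensmx_form.
set w := \col_p _; suff -> : w = v by [].
apply/colP => p; rewrite !mxE -surjective_pairing mxtens_unindexK.
by [].
Qed.

Section Systems.
Variable n : nat.
Local Notation N := n.+1.

Definition cubesys s : set (tup N s) :=
  [set x | hermtuple R N s x /\ forall i : 'I_n,
    psdmx (x 0 ord0 + x 0 (lift ord0 i)) /\ psdmx (x 0 ord0 - x 0 (lift ord0 i))].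

(** Spans an extreme ray of the cross-polytope cone and, as a functional, defines a facet of the
    cube cone; both roles are used. *)
Definition vertex (b : bool) (i : 'I_n) : 'rV[R]_N :=
  delta_mx 0 ord0 + (-1) ^+ b *: delta_mx 0 (lift ord0 i).

Definition scalar_tup (x : 'rV[R]_N) : tup N 1 := map_mx (fun r => (r%:C)%:M) x.

Lemma pairing_vertex s (a : tup N s) b i (w : 'M[R[i]]_(1, s)) :
  pairing a (compress w (scalar_tup (vertex b i))) =
  sform (a 0 ord0 + (-1) ^+ b *: a 0 (lift ord0 i)) w^T w^T.
Proof.
have vE j : scalar_tup (vertex b i) 0 j = ((j == ord0)%:R + (-1) ^+ b * (j ==
  lift ord0 i)%:R)%:M.
  by rewrite !mxE rmorphD rmorphM /= rmorphXn rmorphN rmorph1 !rmorph_nat.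
rewrite /pairing.
have cE j k l : compress w (scalar_tup (vertex b i)) 0 j k l =
    ((j == ord0)%:R + (-1) ^+ b * (j == lift ord0 i)%:R) * ((w 0 k)^* * w 0 l).
  rewrite mxE vE mul_mx_scalar -scalemxAl mxE; congr (_ * _).
  by rewrite mxE big_ord1 !mxE.
under eq_bigr => j _ do under eq_bigr => k _ do under eq_bigr => l _ do rewrite cE.
rewrite sformE (bigD1 ord0) //= (bigD1 (lift ord0 i)) //=.
rewrite [X in _ + (_ + X)]big1 ?addr0; last first.
  move=> j /andP[j0 ji]; rewrite big1 // => k _; rewrite big1 // => l _.
  by rewrite (negbTE j0) (negbTE ji) mulr0 add0r mul0r mulr0.
rewrite -big_split; apply: eq_bigr => k _ /=; rewrite -big_split; apply: eq_bigr
  => l _ /=.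
by rewrite !mxE !eqxx (mulr1n 1); move: (_ ^+ b) => c; ring.
Qed.

End Systems.

End Pairing.

(** * The topology of tuples, and dual cones as operator systems *)

Section Topology.
Variable R : realType.
Local Notation tup N s := 'rV['M[R[i]]_s]_N.

Lemma nbhs_tupP N s (x : tup N s) (U : set (tup N s)) :
  nbhs x U <-> exists2 e : R, 0 < e & forall y : tup N s,
    (forall j k l, modc (x 0 j k l - y 0 j k l) < e) -> U y.
Proof.
have ballE (e : R[i]) (y : tup N s) : 0 < e ->
    ball x e y <-> forall j k l, modc (x 0 j k l - y 0 j k l) < complex.Re e.
  move=> e0; have eE : (complex.Re e)%:C = e by rewrite RRe_real // gtr0_real.
  split=> [[_ h] j k l|h].
    have [_ /(_ k l)] := h 0 j; rewrite -ball_normE /= => hkl.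
    by rewrite -ltcR modcE eE.
  split=> // i j; split=> // k l; rewrite -ball_normE /= ord1.
  by rewrite -modcE -eE ltcR.
split=> [/nbhs_ballP[e /= e0 eU]|[e e0 eU]].
  exists (complex.Re e); first by move: e0; rewrite ltcE => /andP[].
  by move=> y /(ballE e y e0)/eU.
have eC : (0 : R[i]) < e%:C by rewrite ltcR.
by apply/nbhs_ballP; exists e%:C => //= y /(ballE _ _ eC); apply: eU.
Qed.

Lemma closed_tup N s (S : set (tup N s)) :
  (forall x : tup N s, (forall e : R, 0 < e -> exists2 y, S y &
     forall j k l, modc (x 0 j k l - y 0 j k l) < e) -> S x) -> closed S.
Proof.
move=> h x Sx; apply: h => e e0.
have [y [Sy yU]] : S `&` [set y : tup N s | forall j k l, modc (x 0 j k l - y 0 j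
  k l) < e] !=set0.
  by apply: Sx; apply/nbhs_tupP; exists e.
by exists y.
Qed.

Lemma nbhs_rVP N (x : 'rV[R]_N) (U : set 'rV[R]_N) :
  nbhs x U <-> exists2 e : R, 0 < e & forall y : 'rV[R]_N,
    (forall j, `|x 0 j - y 0 j| < e) -> U y.
Proof.
split=> [/nbhs_ballP[e /= e0 eU]|[e e0 eU]].
  exists e => // y h; apply: eU; split=> // i j.
  by rewrite -ball_normE /= ord1; apply: h.
apply/nbhs_ballP; exists e => //= y [_ h]; apply: eU => j.
by have := h 0 j; rewrite -ball_normE.
Qed.

Lemma pairing_dist N s (x x' y : tup N s) (e T : R) :
  (forall j k l, modc (x 0 j k l - x' 0 j k l) <= e) ->
  (forall j k l, modc (y 0 j k l) <= T) ->
  modc (pairing x y - pairing x' y) <= (N * (s * s))%:R * (e * T).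
Proof.
move=> xe yT; rewrite pairingC [pairing x' y]pairingC -raddfB.
have modc_sum (I : finType) (F : I -> R[i]) : modc (\sum_i F i) <= \sum_i modc (F i).
  apply: (big_ind2 (fun (x : R[i]) (y : R) => modc x <= y)) => //.
    by rewrite /modc normr0.
  by move=> u v u' v' h h'; apply: le_trans (modcD _ _) _; rewrite lerD.
have sum_le (I : finType) (F : I -> R[i]) (c : R) : (forall i, modc (F i) <= c) ->
    modc (\sum_i F i) <= #|I|%:R * c.
  move=> Fc; apply: le_trans (modc_sum _ _) _.
  apply: le_trans (_ : \sum_(i : I) c <= _); first by apply: ler_sum => i _.
  by rewrite sumr_const mulr_natl.
apply: le_trans (_ : #|'I_N|%:R * (#|'I_s|%:R * (#|'I_s|%:R * (e * T))) <= _);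
  last first.
  by rewrite !card_ord !natrM -!mulrA.
apply/sum_le => j; apply/sum_le => k; apply/sum_le => l.
by rewrite modcM mulrC ler_pM ?modc_ge0 // !mxE.
Qed.

Section DualSystem.
Variables (n : nat) (n_gt0 : (0 < n)%N).
Local Notation N := n.+1.
Variable Y : forall s, set (tup N s).
Hypotheses (Yherm : forall s, @Y s `<=` hermtuple R N s)
  (Ycomp : forall s t (m : 'M[R[i]]_(s, t)) y, @Y s y -> @Y t (compress m y))
  (Ybound : forall s y j k l, @Y s y -> `|y 0 j k l| <= 2 * \tr (y 0 ord0))
  (Yvert : forall b i, @Y 1 (scalar_tup (vertex R b i))).

(** The test family [Y] is left open because the construction serves twice: testing on compressed
    vertices gives the maximal system over the cube, testing on the whole cube system the minimal
    one over the cross-polytope. *)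
Definition dualcone s : set (tup N s) :=
  [set a | hermtuple R N s a /\ forall y, @Y s y -> 0 <= pairing a y].

Let e0 : 'rV[R]_N := delta_mx 0 ord0.

Definition unit_tup s : tup N s := \row_j (if j == ord0 then 1%:M else 0).

Lemma unit_tup_herm s : hermtuple R N s (unit_tup s).
Proof.
move=> j; rewrite mxE; apply/hermsymmxP; case: ifP => _; first exact: conjtr1.
by rewrite trmx0 map_mx0.
Qed.

Lemma unit_tupE s j k l : unit_tup s 0 j k l = ((j == ord0) && (k == l))%:R.
Proof. by rewrite mxE; case: (j == ord0); rewrite mxE //=; case: eqP. Qed.

Lemma pairing_unit s (y : tup N s) : pairing (unit_tup s) y = \tr (y 0 ord0).
Proof.
rewrite /pairing (bigD1 ord0) //= [X in _ + X]big1 ?addr0; last first.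
  move=> j j0; rewrite big1 // => k _; rewrite big1 // => l _.
  by rewrite unit_tupE (negbTE j0) mul0r.
apply: eq_bigr => k _; rewrite (bigD1 k) //= big1 ?addr0 => [|l lk].
  by rewrite unit_tupE !eqxx mul1r.
by rewrite unit_tupE [k == l]eq_sym (negbTE lk) andbF mul0r.
Qed.

(** Pairing with the unit gives [T = tr y_0], while the entries of [y] are at most [2 T]; a small
    perturbation of the unit therefore changes the pairing by at most [T], uniformly in [y]. *)
Lemma dualcone_near_unit s : (0 < s)%N -> exists2 e : R, 0 < e & forall a : tup N s,
  hermtuple R N s a -> (forall j k l, modc (unit_tup s 0 j k l - a 0 j k l) < e) ->
  dualcone a.
Proof.
move=> s0; pose K : R := (N * (s * s))%:R; have K0 : 0 <= K by rewrite ler0n.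
exists (2 * K + 1)^-1; first by rewrite invr_gt0; lra.
move=> a ah ae; split=> // y Yy.
set T := \tr (y 0 ord0).
have T0 : 0 <= T.
  have := le_trans (normr_ge0 _) (Ybound ord0 (Ordinal s0) (Ordinal s0) Yy).
  by rewrite pmulr_rge0 // ltr0n.
have TE : (complex.Re T)%:C = T by rewrite RRe_real // ger0_real.
have Tr : 0 <= complex.Re T by rewrite -lecR TE.
have ybd j k l : modc (y 0 j k l) <= 2 * complex.Re T.
  by rewrite -lecR modcE rmorphM /= TE rmorph_nat; apply: Ybound.
have := @pairing_dist _ _ (unit_tup s) a y _ _ (fun j k l => ltW (ae j k l)) ybd.
rewrite pairing_unit -/T -/K => h.
have pr := pairing_real ah (Yherm Yy).
have pE : (complex.Re (pairing a y))%:C = pairing a y by rewrite RRe_real.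
have h1 : complex.Re T - complex.Re (pairing a y) <= K * ((2 * K + 1)^-1 * (2 *
  complex.Re T)).
  apply: le_trans h; apply: le_trans (modc_Re _).
  by rewrite raddfB /= ler_norm.
rewrite -pE lecR; set p := complex.Re (pairing a y) in h1 *.
have : K * ((2 * K + 1)^-1 * (2 * complex.Re T)) <= complex.Re T.
  rewrite mulrCA mulrC ler_pdivrMr; nra.
lra.
Qed.

Lemma dualcone_compress s t (m : 'M[R[i]]_(s, t)) a :
  @dualcone s a -> dualcone (compress m a).
Proof.
move=> [ah aY]; split; first exact: hermtuple_compress.
by move=> y Yy; rewrite pairing_compress; apply/aY/Ycomp.
Qed.

Lemma dualcone_sform s (a : tup N s) (b : bool) i :
  dualcone a -> psdmx (a 0 ord0 + (-1) ^+ b *: a 0 (lift ord0 i)).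
Proof.
move=> [ah aY] v; rewrite -[v]trmxK -pairing_vertex.
by apply: aY; apply/Ycomp/Yvert.
Qed.

Lemma psdmx_antisym m (M : 'M[R[i]]_m) : psdmx M -> psdmx (- M) -> M = 0.
Proof.
move=> Mp Mn; apply/matrixP => k l; rewrite [RHS]mxE; apply: psdmx_eq0 => //.
have := psdmx_diag k Mp; have := psdmx_diag k Mn; rewrite mxE oppr_ge0 => h1 h2.
by apply/eqP; rewrite eq_le h1.
Qed.

Lemma closed_nonneg (z : R[i]) :
  (forall e : R, 0 < e -> exists2 w : R[i], 0 <= w & modc (z - w) < e) -> 0 <= z.
Proof.
move=> h; rewrite lecE /=; apply/andP; split.
  apply/eqP/eqP; rewrite -normr_le0; apply/ler_addgt0Pl => e e0'; rewrite addr0.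
  have [w w0 zw] := h e e0'.
  have := modc_Im (z - w); rewrite raddfB /= (ger0_Im w0) subr0 => /le_trans; apply.
  exact: ltW.
rewrite -oppr_le0; apply/ler_addgt0Pl => e e0'; rewrite addr0.
have [w w0 zw] := h e e0'.
have := modc_Re (z - w); rewrite raddfB /= => /le_lt_trans /(_ zw).
rewrite ltr_norml => /andP[h1 _].
by move: w0; rewrite lecE /= => /andP[_]; lra.
Qed.

Lemma closed_eq0 (z : R[i]) :
  (forall e : R, 0 < e -> modc z < e) -> z = 0.
Proof.
move=> h; apply/eqP; rewrite -[_ == _]negbK -modc_gt0; apply/negP => z0.
by have := h _ z0; rewrite ltxx.
Qed.

Lemma dualcone_closed s : closed (@dualcone s).
Proof.
apply: closed_tup => x xe; split.
  move=> j; apply/hermsymmxP/matrixP => k l; rewrite !mxE; apply/eqP; rewrite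
    -subr_eq0.
  apply/eqP/closed_eq0 => e e_gt0.
  have [|y [yh _] xy] := xe (e / 2); first by rewrite divr_gt0.
  have yE : (y 0 j l k)^* = y 0 j k l by rewrite hermsymmx_conj.
  rewrite -[_ - _](addrK (y 0 j k l)) -{2}yE.
  rewrite (_ : _ - _ = (x 0 j l k - y 0 j l k)^* - (x 0 j k l - y 0 j k l)); last
    first.
    by rewrite rmorphB; ring.
  apply: le_lt_trans (modcD _ _) _; rewrite modcN (splitr e) ltrD //.
  by rewrite /modc norm_conjC; apply: xy.
move=> y Yy; apply: closed_nonneg => e e_gt0.
have [K Kle] : exists K, forall j k l, modc (y 0 j k l) <= K.
  pose F (p : 'I_N * 'I_s * 'I_s) := modc (y 0 p.1.1 p.1.2 p.2).
  exists (\sum_p F p) => j k l; rewrite (bigD1 (j, k, l)) //= lerDl.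
  by apply: sumr_ge0 => p _; apply: modc_ge0.
pose M : R := (N * (s * s))%:R * `|K| + 1.
have M0 : 0 < M by rewrite ltr_wpDl // mulr_ge0.
have [|a [ah aY] xa] := xe (e / M / 2); first by rewrite !divr_gt0.
exists (pairing a y); first exact: aY.
apply: le_lt_trans (pairing_dist (fun j k l => ltW (xa j k l)) Kle) _.
apply: le_lt_trans (_ : (N * (s * s))%:R * (e / M / 2 * `|K|) < _).
  by rewrite ler_wpM2l // ler_wpM2l ?ler_norm // !divr_ge0 // ltW.
rewrite [ltLHS](_ : _ = e * ((N * (s * s))%:R * `|K|) / 2 / M); last by ring.
have : 0 <= (N * (s * s))%:R * `|K| by rewrite mulr_ge0.
rewrite ltr_pdivrMr // /M; move: (_ * `|K|) => c c0; nra.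
Qed.

Lemma dualcone_proper s : (0 < s)%N -> proper_cone (@dualcone s).
Proof.
move=> s0; split.
- by move=> x [].
- by split=> [|y Yy]; [apply: hermtuple0 | rewrite pairingC raddf0].
- move=> x y [xh xY] [yh yY]; split; first exact: hermtupleD.
  by move=> z Yz; rewrite pairingC raddfD /= addr_ge0 // pairingC; [apply: xY |
    apply: yY].
- move=> r x r0 [xh xY]; split; first exact: hermtupleZ.
  by move=> z Yz; rewrite pairingC pairingZ mulr_ge0 ?lecR // pairingC; apply: xY.
- exact: dualcone_closed.
- move=> x Sx Sx'; have pz (b : bool) i : x 0 ord0 + (-1) ^+ b *: x 0 (lift ord0
  i) = 0.
    apply: psdmx_antisym; first exact: dualcone_sform.
    by have := dualcone_sform b i Sx'; rewrite !mxE scalerN -opprD.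
  have z0 : x 0 ord0 = 0.
    have := pz true (Ordinal n_gt0); have := pz false (Ordinal n_gt0).
    rewrite expr0 scale1r expr1 scaleN1r => h1 /eqP; rewrite subr_eq0 => /eqP h2.
    by rewrite -[x 0 ord0]half_double {2}h2 h1 scaler0.
  apply/rowP => j; rewrite [RHS]mxE; have [i ->|-> //] := unliftP ord0 j.
  by have := pz false i; rewrite expr0 scale1r z0 add0r.
have [e e_gt0 h] := dualcone_near_unit s0.
exists (unit_tup s); first exact: unit_tup_herm.
by apply/nbhs_tupP; exists e => // y ye yh; apply: h.
Qed.

Lemma dualcone_unit_interior : (first_level dualcone)^° (delta_mx 0 ord0).
Proof.
have [e e_gt0 h] := @dualcone_near_unit 1 isT.
apply/nbhs_rVP; exists e => // x xe; apply: h.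
  move=> j; rewrite mxE; apply/hermsymmxP; rewrite tr_scalar_mx map_scalar_mx /=.
  by congr (_%:M); apply/CrealP; rewrite complex_real.
move=> j k l; rewrite unit_tupE mxE (ord1 k) (ord1 l) eqxx andbT mxE eqxx mulr1n.
by have := xe j; rewrite mxE eqxx /= -modcR rmorphB /= rmorph_nat.
Qed.

Definition dual_opsystem : opsystem R N :=
  @OpSystem R N dualcone (delta_mx 0 ord0) dualcone_proper
    (fun s t m x _ _ => @dualcone_compress s t m x) dualcone_unit_interior.

End DualSystem.

End Topology.

(** * Separation of a point from a closed convex cone *)

Section ConeSeparation.
Variables (R : realType) (m : nat) (K : set 'rV[R]_m).
Hypotheses (Kclosed : closed K) (K0 : K 0)
  (KD : forall x y, K x -> K y -> K (x + y))
  (KZ : forall (r : R) x, 0 <= r -> K x -> K (r *: x)).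

Let dot (u v : 'rV[R]_m) : R := \sum_i u 0 i * v 0 i.

Let dotC u v : dot u v = dot v u.
Proof. by apply: eq_bigr => i _; rewrite mulrC. Qed.

Let dotDl u v w : dot (u + v) w = dot u w + dot v w.
Proof. by rewrite /dot -big_split; apply: eq_bigr => i _; rewrite mxE mulrDl. Qed.

Let dotZl r u w : dot (r *: u) w = r * dot u w.
Proof. by rewrite /dot mulr_sumr; apply: eq_bigr => i _; rewrite mxE mulrA. Qed.

Let dotNl u w : dot (- u) w = - dot u w.
Proof. by rewrite -scaleN1r dotZl mulN1r. Qed.

Let dot_ge0 u : 0 <= dot u u.
Proof. by apply: sumr_ge0 => i _; rewrite -expr2 sqr_ge0. Qed.

(* The functional is [y - a], with [y] the point of [K] nearest to [a]. *)
Lemma cone_separation a : ~ K a -> exists b : 'rV[R]_m,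
  (forall x, K x -> 0 <= \sum_i b 0 i * x 0 i) /\ \sum_i b 0 i * a 0 i < 0.
Proof.
move=> Ka; pose f (x : 'rV[R]_m) := \sum_i (x 0 i - a 0 i) * (x 0 i - a 0 i).
have fdot x : f x = dot (x - a) (x - a) by apply: eq_bigr => i _; rewrite !mxE.
have fcont : continuous f.
  apply: continuous_big; first exact: add_continuous.
  move=> i _ x; have ci : {for x, continuous (fun z : 'rV[R]_m => z 0 i - a 0 i)}.
    by apply: continuousB; [exact: coord_continuous | exact: cst_continuous].
  exact: (continuousM ci ci).
(* Only points of [K] at most as far from [a] as the origin compete, which makes the search set
   compact. *)
pose B := [set x | K x /\ f x <= f 0].
have Bcompact : compact B.
  pose c := f 0 + 1; have c0 : 0 <= f 0 by rewrite fdot.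
  apply: (@subclosed_compact _ _ [set x : 'rV[R]_m | forall i, [set z | z \in `[a
    0 i - c, a 0 i + c]] (x 0 i)]).
  - exact: (closedI Kclosed ((continuous_closedP f).1 fcont [set r | r <= f 0]
    (@closed_le _ _))).
  - exact: (@rV_compact R m (fun i => [set z | z \in `[a 0 i - c, a 0 i + c]])
    (fun i => @segment_compact _ _ _)).
  move=> x [_ xf] i /=.
  have : (x 0 i - a 0 i) ^+ 2 <= f 0.
    apply: le_trans xf; rewrite /f (bigD1 i) //= -expr2 lerDl.
    by apply: sumr_ge0 => j _; rewrite -expr2 sqr_ge0.
  rewrite in_itv /= /c; set t := x 0 i; set u := a 0 i => tu.
  by apply/andP; split; nra.
have [||y] := EVT_min_rV (f := f) _ Bcompact.
- by exists 0; split.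
- exact: continuous_subspaceT.
rewrite inE => -[Ky yf] ymin.
have {}ymin x : K x -> f y <= f x.
  move=> Kx; have [xf|xf] := leP (f x) (f 0); last exact: le_trans yf (ltW xf).
  by apply: ymin; rewrite inE.
pose b := y - a.
have fE x t : f (y + t *: x) = f y + (2 * t * dot b x + t ^+ 2 * dot x x).
  rewrite !fdot addrAC -/b dotDl dotZl dotC dotDl dotZl [dot x (b + _)]dotC dotDl
    dotZl.
  rewrite (dotC x b); ring.
(* A negative product would let a small step from [y] along [x] come closer to [a]. *)
have bpos x : K x -> 0 <= dot b x.
  move=> Kx; rewrite leNgt; apply/negP => bx.
  have x0 := dot_ge0 x; pose t := - dot b x / (dot x x + 1).
  have x1 : 0 < dot x x + 1 by lra.
  have t0 : 0 < t by rewrite divr_gt0 // oppr_gt0.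
  have := ymin (y + t *: x) (KD Ky (KZ (ltW t0) Kx)).
  rewrite fE lerDl leNgt => /negP; apply.
  have tE : t * (dot x x + 1) = - dot b x by rewrite /t divfK // gt_eqF.
  have : t * dot x x <= - dot b x by rewrite -tE; lra.
  nra.
(* A positive product would let shrinking [y] towards the origin come closer to [a]. *)
have by0 : dot b y <= 0.
  rewrite leNgt; apply/negP => by_gt0.
  have y0 := dot_ge0 y; pose t := Num.min 1 (dot b y / (dot y y + 1)).
  have y1 : 0 < dot y y + 1 by lra.
  have t0 : 0 < t by rewrite lt_min ltr01 divr_gt0.
  have t1 : t <= 1 by rewrite ge_min lexx.
  have tE : t * (dot y y + 1) <= dot b y by rewrite -ler_pdivlMr // ge_min lexx orbT.
  have Ky' : K (y + (- t) *: y).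
    by rewrite -{1}[y]scale1r -scalerDl; apply: KZ => //; rewrite subr_ge0.
  have := ymin _ Ky'; rewrite fE lerDl leNgt => /negP; apply; nra.
exists b; split=> //; rewrite -/(dot b a).
have -> : a = y - b by rewrite /b subKr.
rewrite dotC dotDl dotNl [dot y b]dotC.
have b0 : 0 < dot b b.
  rewrite lt0r dot_ge0 andbT; apply/eqP => bb; apply: Ka.
  suff : b = 0 by rewrite /b => /eqP; rewrite subr_eq0 => /eqP <-; exact: Ky.
  apply/rowP => i; rewrite [RHS]mxE; move/eqP: bb.
  rewrite /dot psumr_eq0 => [/allP/(_ i)|j _]; last by rewrite -expr2 sqr_ge0.
  by rewrite mem_index_enum -expr2 sqrf_eq0 => /(_ isT)/eqP.
lra.
Qed.

End ConeSeparation.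

Section TupleSeparation.
Variables (R : realType) (N s : nat).
Local Notation tup := 'rV['M[R[i]]_s]_N.
Local Notation T := ('I_N * 'I_s * 'I_s * bool)%type.
Local Notation M := #|{: T}|.

(** Tuples in real coordinates, the boolean selecting the imaginary part. *)
Let tup_of (c : 'rV[R]_M) : tup := \row_j \matrix_(k, l)
  (c 0 (enum_rank ((j, k, l, false) : T)) +i* c 0 (enum_rank ((j, k, l, true) : T))).

Let tup_ofE c j k l : tup_of c 0 j k l =
  c 0 (enum_rank ((j, k, l, false) : T)) +i* c 0 (enum_rank ((j, k, l, true) : T)).
Proof. by rewrite !mxE. Qed.

Let tup_of_surj (y : tup) : exists c, tup_of c = y.
Proof.
exists (\row_p let: (j, k, l, b) := enum_val p in
  if b then complex.Im (y 0 j k l) else complex.Re (y 0 j k l)).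
apply/rowP => j; apply/matrixP => k l.
by rewrite tup_ofE !mxE !enum_rankK; case: (y 0 j k l).
Qed.

Lemma tup_separation (S : set tup) (a : tup) : proper_cone S -> hermtuple R N s a
  -> ~ S a ->
  exists b : tup, [/\ hermtuple R N s b, forall y, S y -> 0 <= pairing b y &
    pairing b a < 0].
Proof.
move=> Sc ah Sa; have [al alE] := tup_of_surj a.
have [|||||be [beS bea]] := @cone_separation R M (tup_of @^-1` S) _ _ _ _ al.
- move=> c cS; apply: (cone_closed Sc) => U /nbhs_tupP[e e0 eU].
  have [c' [Sc' cc']] : (tup_of @^-1` S) `&` [set c' | forall p, `|c 0 p - c' 0
    p| < e / 2] !=set0.
    by apply: cS; apply/nbhs_rVP; exists (e / 2); rewrite ?divr_gt0.
  exists (tup_of c'); split=> //; apply: eU => j k l; rewrite !tup_ofE.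
  by apply: le_lt_trans (modc_rect _ _) _; rewrite (splitr e) ltrD //; apply: cc'.
- rewrite /preimage /= (_ : tup_of 0 = 0); first exact: cone0 Sc.
  by apply/rowP => j; apply/matrixP => k l; rewrite tup_ofE !mxE.
- move=> x y Sx Sy; rewrite /preimage /= (_ : tup_of _ = tup_of x + tup_of y).
    exact: coneD Sc _ _ Sx Sy.
  by apply/rowP => j; apply/matrixP => k l; rewrite !(tup_ofE, mxE).
- move=> r x r0 Sx; rewrite /preimage /= (_ : tup_of _ = map_mx ( *:%R r%:C)
  (tup_of x)).
    exact: (coneZ Sc r0 Sx).
  apply/rowP => j; apply/matrixP => k l; rewrite !(tup_ofE, mxE).
  by apply/eqP; rewrite eq_complex /= !mul0r subr0 addr0 !eqxx.
- by rewrite /preimage /= alE.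
(* Conjugating the coefficients makes the real part of the pairing equal to the real scalar product
   of coordinates. Averaging with the adjoint makes the tuple hermitian; on hermitian [y] this
   amounts to taking the real part. *)
pose b' : tup := \row_j \matrix_(k, l) (tup_of be 0 j k l)^*.
pose b : tup := \row_j (2^-1 *: (b' 0 j + (b' 0 j)^t*)).
have bE y : hermtuple R N s y -> pairing b y = (complex.Re (pairing b' y))%:C.
  move=> yh; rewrite ReJ_add.
  have -> : (pairing b' y)^*%C = \sum_j \sum_k \sum_l ((b' 0 j)^t*) k l * y 0 j k l.
    rewrite -[LHS]/((pairing b' y)^*) rmorph_sum; apply: eq_bigr => j _.
    rewrite rmorph_sum; under eq_bigr => k _ do rewrite rmorph_sum.
    rewrite exchange_big; apply: eq_bigr => k _; apply: eq_bigr => l _.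
    by rewrite rmorphM /= (hermsymmx_conj _ _ (yh j)) [in RHS]mxE [in RHS]mxE.
  rewrite /pairing -big_split mulr_suml; apply: eq_bigr => j _ /=.
  rewrite -big_split mulr_suml; apply: eq_bigr => k _ /=.
  rewrite -big_split mulr_suml; apply: eq_bigr => l _ /=.
  by rewrite /b !mxE; field.
have pE (c : 'rV[R]_M) : \sum_p be 0 p * c 0 p = complex.Re (pairing b' (tup_of c)).
  rewrite /pairing raddf_sum.
  under [RHS]eq_bigr => j _ do rewrite raddf_sum.
  under [RHS]eq_bigr => j _ do under eq_bigr => k _ do rewrite raddf_sum.
  rewrite pair_bigA pair_bigA /= (reindex (@enum_rank T)) /=; last first.
    by exists (@enum_val T predT) => p _; rewrite (enum_valK, enum_rankK).
  transitivity (\sum_(p : 'I_N * 'I_s * 'I_s) \sum_(e : bool)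
      be 0 (enum_rank ((p, e) : T)) * c 0 (enum_rank ((p, e) : T))).
    by rewrite pair_bigA; apply: eq_bigr => -[].
  apply: eq_bigr => -[[j k] l] _; rewrite big_bool /= !mxE /=; ring.
exists b; split.
- move=> j; rewrite mxE; apply/hermsymmxP; rewrite linearZ /= map_mxZ /= conjtrD
  trmxCK.
  rewrite addrC; congr (_ *: _); apply/CrealP; by rewrite rpredV realn.
- move=> y Sy; rewrite bE; last exact: cone_herm Sc _ Sy.
  have [c cE] := tup_of_surj y; rewrite -cE -pE lecR.
  by apply: beS; rewrite /preimage /= cE.
by rewrite bE // -alE -pE ltcR.
Qed.

End TupleSeparation.

(** * The cube and the cross-polytope *)

Section CubeSystems.
Variables (R : realType) (n : nat) (n_gt0 : (0 < n)%N).
Local Notation N := n.+1.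
Local Notation tup s := 'rV['M[R[i]]_s]_N.
Local Notation cubesys := (@cubesys R n).

Lemma psdmx_scalar m (r : R[i]) : 0 <= r -> psdmx (r%:M : 'M[R[i]]_m).
Proof. by move=> r0; rewrite -scalemx1; apply: psdmxZ => //; apply: psdmx1. Qed.

Lemma cubesys_psd0 s (y : tup s) : cubesys y -> psdmx (y 0 ord0).
Proof.
move=> [_ /(_ (Ordinal n_gt0))[yp ym]].
have half : 0 <= 2^-1 :> R[i] by rewrite invr_ge0 ler0n.
by have := psdmxZ half (psdmxD yp ym); rewrite addrACA subrr addr0 half_double.
Qed.

Lemma cubesys_entry s (y : tup s) j k l :
  cubesys y -> `|y 0 j k l| <= 2 * \tr (y 0 ord0).
Proof.
move=> yQ; have y0 := cubesys_psd0 yQ; have T0 := psdmx_trace y0.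
have two : 0 <= 2 :> R[i] by rewrite ler0n.
have [i ->|->] := unliftP ord0 j; last first.
  by apply: le_trans (psdmx_entry k l y0) _; rewrite mulr_natl mulr2n lerDl.
have [_ /(_ i)[yp ym]] := yQ.
have h1 := psdmx_entry k l yp; have h2 := psdmx_entry k l ym.
rewrite -(ler_pM2l (ltr0n _ 2)) -[X in X * `|_|]ger0_norm // -normrM.
rewrite (_ : 2 * y 0 (lift ord0 i) k l = (y 0 ord0 + y 0 (lift ord0 i)) k l -
  (y 0 ord0 - y 0 (lift ord0 i)) k l); last by rewrite !mxE; ring.
apply: le_trans (ler_normB _ _) _; apply: le_trans (lerD h1 h2) _.
rewrite [leLHS](_ : _ = 2 * \tr (y 0 ord0)); last by rewrite linearD linearB /=; ring.
by apply: ler_wpM2l => //; rewrite mulr_natl mulr2n lerDl.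
Qed.

Lemma cubesys_compress s t (m : 'M[R[i]]_(s, t)) (y : tup s) :
  cubesys y -> cubesys (compress m y).
Proof.
move=> [yh yP]; split=> [|i]; first exact: hermtuple_compress.
have [yp ym] := yP i; rewrite !mxE; split.
  by have := psdmx_congr m yp; rewrite mulmxDr mulmxDl.
by have := psdmx_congr m ym; rewrite mulmxBr mulmxBl.
Qed.

Lemma scalar_tup_herm (x : 'rV[R]_N) : hermtuple R N 1 (scalar_tup x).
Proof.
move=> j; rewrite mxE; apply/hermsymmxP; rewrite tr_scalar_mx map_scalar_mx /=.
by congr (_%:M); apply/CrealP; rewrite complex_real.
Qed.

Lemma cubesys_scalar (x : 'rV[R]_N) : cubesys (scalar_tup x) <-> cube_cone R n x.
Proof.
split=> [[_ xP] i|xP].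
  have [xp xm] := xP i; have := psdmx_diag 0 xp; have := psdmx_diag 0 xm.
  by rewrite !mxE !eqxx !mulr1n -rmorphB -rmorphD !lecR.
split=> [|i]; first exact: scalar_tup_herm.
have [xp xm] := xP i; rewrite !mxE -raddfD -raddfB /= -rmorphD -rmorphB.
by split; apply: psdmx_scalar; rewrite lecR.
Qed.

Lemma vertexE b (i : 'I_n) j :
  vertex R b i 0 j = (j == ord0)%:R + (-1) ^+ b * (j == lift ord0 i)%:R.
Proof. by rewrite !mxE. Qed.

Lemma cube_cone_vertex b i : cube_cone R n (vertex R b i).
Proof.
move=> k; rewrite !vertexE !eqxx /= mulr0 addr0 add0r (inj_eq lift_inj).
by case: (k == i); case: b; rewrite ?mulr0 ?mulr1 ?expr0 ?expr1; split; lra.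
Qed.

Lemma cross_cone_vertex b i : cross_cone R n (vertex R b i).
Proof.
rewrite /cross_cone /= vertexE eqxx /= mulr0 addr0 (bigD1 i) //= big1 => [|k ki].
  rewrite vertexE /= eqxx mulr1 add0r addr0 normrX normrN1 expr1n //.
by rewrite vertexE /= (inj_eq lift_inj) (negbTE ki) mulr0 addr0 normr0.
Qed.

(** For hermitian [x], nonnegative pairing with all of these says that each [x_0 + x_i] and
    [x_0 - x_i] is positive semidefinite. *)
Definition cube_tests s : set (tup s) :=
  [set y | exists b i (w : 'M[R[i]]_(1, s)), y = compress w (scalar_tup (vertex R
    b i))].

Lemma cube_tests_cubesys s : @cube_tests s `<=` @cubesys s.
Proof.
move=> _ [b [i [w ->]]]; apply: cubesys_compress.
by apply/cubesys_scalar/cube_cone_vertex.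
Qed.

Lemma cube_tests_compress s t (m : 'M[R[i]]_(s, t)) y :
  cube_tests y -> cube_tests (compress m y).
Proof. by move=> [b [i [w ->]]]; exists b, i, (w *m m); rewrite compressM. Qed.

Lemma compress1 s (y : tup s) : compress 1%:M y = y.
Proof. by apply/rowP => j; rewrite mxE conjtr1 mul1mx mulmx1. Qed.

Lemma cube_tests_vertex b i : cube_tests (scalar_tup (vertex R b i)).
Proof. by exists b, i, 1%:M; rewrite compress1. Qed.

Definition Tmax : opsystem R N := @dual_opsystem R n n_gt0 cube_tests
  (fun s y Yy => (cube_tests_cubesys Yy).1) cube_tests_compress
  (fun s y j k l Yy => cubesys_entry j k l (cube_tests_cubesys Yy)) cube_tests_vertex.

Definition Tmin : opsystem R N := @dual_opsystem R n n_gt0 cubesys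
  (fun s y Yy => Yy.1) cubesys_compress
  (fun s y j k l Yy => cubesys_entry j k l Yy)
  (fun b i => cube_tests_cubesys (cube_tests_vertex b i)).

Lemma Tmax_level s : Tmax s = @cubesys s.
Proof.
apply/seteqP; split=> a.
  move=> [ah aY]; split=> // i; split.
    move=> v; have := aY _ (ex_intro _ false (ex_intro _ i (ex_intro _ v^T erefl))).
    by rewrite pairing_vertex trmxK expr0 scale1r.
  move=> v; have := aY _ (ex_intro _ true (ex_intro _ i (ex_intro _ v^T erefl))).
  by rewrite pairing_vertex trmxK expr1 scaleN1r.
move=> [ah aP]; split=> // _ [b [i [w ->]]]; rewrite pairing_vertex.
have [ap am] := aP i.
by case: b; rewrite ?expr0 ?scale1r ?expr1 ?scaleN1r; [apply: am | apply: ap].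
Qed.

Lemma first_level_Tmax : first_level Tmax = cube_cone R n.
Proof.
have E : first_level Tmax = [set x | Tmax 1%N (scalar_tup x)] by [].
by rewrite E Tmax_level; apply/seteqP; split=> x /=; move/cubesys_scalar.
Qed.

Lemma pairing_scalar (x y : 'rV[R]_N) :
  pairing (scalar_tup x) (scalar_tup y) = (\sum_j x 0 j * y 0 j)%:C.
Proof.
rewrite rmorph_sum; apply: eq_bigr => j _.
by rewrite !big_ord1 !mxE !eqxx !mulr1n rmorphM.
Qed.

Lemma scalar_tupP (a : tup 1) : hermtuple R N 1 a -> exists x, a = scalar_tup x.
Proof.
move=> ah; exists (\row_j complex.Re (a 0 j 0 0)); apply/rowP => j; rewrite !mxE.
apply/matrixP => k l; rewrite !ord1 mxE eqxx mulr1n RRe_real //.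
by apply/CrealP; rewrite (hermsymmx_conj _ _ (ah j)).
Qed.

Lemma first_level_Tmin : first_level Tmin = cross_cone R n.
Proof.
apply/seteqP; split=> x; rewrite /first_level /= -/(scalar_tup x).
  move=> [_ xP].
  (* The sign vector whose pairing with [x] is [x_0] minus the sum of the [|x_i|]. *)
  pose y : 'rV[R]_N := \row_j (if unlift ord0 j is Some i then - Num.sg (x 0 j)
    else 1).
  have yC : cube_cone R n y.
    move=> i; rewrite !mxE unlift_none liftK.
    have : `|Num.sg (x 0 (lift ord0 i))| <= 1 by rewrite normr_sg lern1 leq_b1.
    by rewrite ler_norml; split; lra.
  have /cubesys_scalar/xP := yC; rewrite pairing_scalar lecR big_ord_recl !mxE
    unlift_none mulr1.
  rewrite (eq_bigr (fun i => - `|x 0 (lift ord0 i)|)) => [|i _]; last first.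
    by rewrite !mxE liftK mulrN mulrC normrEsg.
  by rewrite sumrN subr_ge0.
move=> xC; split; first exact: scalar_tup_herm.
move=> y yQ; have [z zE] := scalar_tupP yQ.1; rewrite zE in yQ *.
move/cubesys_scalar: yQ => zC; rewrite pairing_scalar lecR big_ord_recl.
have z0 : 0 <= z 0 ord0 by have [] := zC (Ordinal n_gt0); lra.
have h : \sum_(i < n) `|x 0 (lift ord0 i) * z 0 (lift ord0 i)| <= x 0 ord0 * z 0 ord0.
  apply: le_trans (ler_wpM2r z0 xC); rewrite mulr_suml; apply: ler_sum => i _.
  rewrite normrM ler_wpM2l // ler_norml; have [] := zC i; lra.
have h2 : - \sum_(i < n) x 0 (lift ord0 i) * z 0 (lift ord0 i) <=
    \sum_(i < n) `|x 0 (lift ord0 i) * z 0 (lift ord0 i)|.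
  by apply: le_trans (ler_norm _) _; rewrite normrN; apply: ler_norm_sum.
lra.
Qed.

(** Compression by a vector [v] brings an element [a] of [S s] to the first level, where the facet
    inequalities of the cube become nonnegativity at [v] of the forms of [a_0 + a_i] and
    [a_0 - a_i]. *)
Lemma maximal_cube (S : opsystem R N) s :
  (0 < s)%N -> maximal_over (cube_cone R n) S -> S s = @cubesys s.
Proof.
move=> s0 [SK Smax]; apply/seteqP; split; last first.
  by rewrite -Tmax_level; apply: Smax => //; apply: first_level_Tmax.
move=> a Sa; have ah := cone_herm (@level_proper _ _ S s s0) Sa.
have vP (b : bool) i (v : 'cV[R[i]]_s) :
    0 <= sform (a 0 ord0 + (-1) ^+ b *: a 0 (lift ord0 i)) v v.
  rewrite -[v]trmxK -pairing_vertex -pairing_compress.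
  have Sc : S 1%N (compress v a) by apply: level_compress.
  have [x xE] := scalar_tupP (hermtuple_compress v ah).
  have xC : cube_cone R n x by rewrite -SK /first_level /= -/(scalar_tup x) -xE.
  have [_ /(_ i)[xp xm]] := (cubesys_scalar x).2 xC.
  rewrite xE -[scalar_tup (vertex R b i)]compress1 pairing_vertex.
  by case: b; rewrite ?expr0 ?scale1r ?expr1 ?scaleN1r; [apply: xm | apply: xp].
split=> // i; split=> v.
  by have := vP false i v; rewrite expr0 scale1r.
by have := vP true i v; rewrite expr1 scaleN1r.
Qed.

(** A functional nonnegative on [S s] is nonnegative on the compressed vertices, which belong to
    [S s]; by [Tmax_level] it is then an element of the cube system, on which [a] is nonnegative. *)
Lemma minimal_cross (S : opsystem R N) s :
  (0 < s)%N -> minimal_over (cross_cone R n) S -> S s = @dualcone R n cubesys s.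
Proof.
move=> s0 [SK Smin]; apply/seteqP; split.
  by move=> a Sa; apply: (Smin Tmin) => //; apply: first_level_Tmin.
move=> a [ah aQ]; apply: contrapT => Sa.
have [b [bh bS ba]] := tup_separation (@level_proper _ _ S s s0) ah Sa.
suff bQ : cubesys b.
  by have := aQ b bQ; rewrite pairingC => /le_lt_trans /(_ ba); rewrite ltxx.
rewrite -Tmax_level; split=> // _ [e [i [w ->]]]; apply: bS.
apply: level_compress => //.
suff : first_level S (vertex R e i) by [].
by rewrite SK; apply: cross_cone_vertex.
Qed.

End CubeSystems.

(** * Realization by bounded functions *)

Section Amplify.
Variables (R : realType) (A : comCStar R).

Lemma star_sum (I : finType) (F : I -> A) : star (\sum_i F i) = \sum_i star (F i).
Proof.
have star0 : star 0 = 0 :> A by rewrite -{1}(scale0r 0) starZ rmorph0 scale0r.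
exact: (big_morph (@star R A) (@starD R A) star0).
Qed.

Lemma amplify_selfadj N d (psi : 'rV[R]_N -> 'M[A]_d) s (a : 'rV['M[R[i]]_s]_N) :
  (forall x, selfadjmx (psi x)) -> hermtuple R N s a -> selfadjmx (amplify psi a).
Proof.
move=> psis ah; apply/matrixP => p q; rewrite !mxE /amplify !summxE star_sum.
apply: eq_bigr => j _; rewrite !mxE starM mulrC.
have /matrixP h := psis (delta_mx 0 j); have := h (mxtens_unindex p).1
  (mxtens_unindex q).1.
rewrite !mxE => ->; congr (_ * _).
by rewrite starZ star1 (hermsymmx_conj _ _ (ah j)).
Qed.

Lemma map_amplify (chi : {rmorphism A -> R[i]}) N d (psi : 'rV[R]_N -> 'M[A]_d) s
    (a : 'rV['M[R[i]]_s]_N) : star_character chi ->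
  map_mx chi (amplify psi a) =
  \sum_j tensmx ((\row_k map_mx chi (psi (delta_mx 0 k))) 0 j) (a 0 j).
Proof.
move=> [chiA _]; rewrite /amplify map_mx_sum; apply: eq_bigr => j _.
apply/matrixP => p q; rewrite !mxE; etransitivity; first exact: (rmorphM chi).
by congr (_ * _); apply: chiA.
Qed.

End Amplify.

Section NormalizedCube.
Variables (R : realType) (n d : nat).

(** The points at which the realization evaluates; [x_0 = 1] sends the order unit to the identity
    and bounds all entries. *)
Record normalized_cube := NormalizedCube {
  nc_tup :> 'rV['M[R[i]]_d]_n.+1;
  nc_cube : cubesys nc_tup;
  nc_unit : nc_tup 0 ord0 = 1%:M }.

HB.instance Definition _ := gen_eqMixin normalized_cube.
HB.instance Definition _ := gen_choiceMixin normalized_cube.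

Lemma unit_tup_cubesys : cubesys (unit_tup R n d).
Proof.
split=> [|i]; first exact: unit_tup_herm.
by rewrite !mxE /= addr0 subr0; split; apply: psdmx1.
Qed.

Lemma unit_tup_unit : unit_tup R n d 0 ord0 = 1%:M.
Proof. by rewrite mxE. Qed.

HB.instance Definition _ :=
  isPointed.Build normalized_cube (NormalizedCube unit_tup_cubesys unit_tup_unit).

Lemma ncube_cubesys (x : 'I_n.+1 -> 'M[R[i]]_d) : ncube x ->
  cubesys (\row_j x j) /\ (\row_j x j) 0 ord0 = 1%:M.
Proof.
move=> [x0 xP]; split; last by rewrite mxE.
split=> [j|i]; last by rewrite !mxE x0; apply: xP.
rewrite mxE; have [i ->|->] := unliftP ord0 j; last by rewrite x0;
  apply/hermsymmxP/conjtr1.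
have [/psdmx_herm/hermsymmxP xh _] := xP i.
by apply/hermsymmxP; move: xh; rewrite conjtrD conjtr1 => /addrI.
Qed.

End NormalizedCube.

Section Realization.
Variables (R : realType) (n d : nat) (n_gt0 : (0 < n)%N) (d_gt0 : (0 < d)%N).
Local Notation N := n.+1.
Hypothesis dil : forall s (y : 'rV['M[R[i]]_s]_N), cubesys y ->
  dilation (ncube (n := n) (d := d)) (fun j => y 0 j).

Lemma cubesys_sum s (y : 'rV['M[R[i]]_s]_N) : cubesys y ->
  exists k (x : 'I_k -> normalized_cube R n d) (v : 'I_k -> 'M[R[i]]_(d, s)),
    y = \sum_i compress (v i) (x i).
Proof.
move=> /dil[k [x [v [xP yE]]]].
exists k, (fun i => NormalizedCube (ncube_cubesys (xP i)).1 (ncube_cubesys (xP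
  i)).2), v.
by apply/rowP => j; rewrite yE summxE; apply: eq_bigr => i _; rewrite [RHS]mxE /= mxE.
Qed.

Lemma dminimal_max (S : opsystem R N) : maximal_over (cube_cone R n) S ->
  dminimal d S.
Proof.
move=> Smax s s0; have Sd := maximal_cube n_gt0 d_gt0 Smax.
apply/seteqP; split=> a.
  rewrite (maximal_cube n_gt0 s0 Smax) => /cubesys_sum[k [x [v ->]]].
  exists k, (fun i => nc_tup (x i)), v; split=> // i; rewrite Sd; exact: nc_cube.
move=> [k [x [v [xS ->]]]]; have Sc := @level_proper _ _ S s s0.
apply: (big_ind (S s)); first exact: cone0 Sc.
  by move=> y z yS zS; apply: (coneD Sc yS zS).
by move=> i _; apply: level_compress => //; apply: xS.
Qed.

Let X := normalized_cube R n d.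
Let A := linf_cstar R X.

Lemma cube_realization_subproof (x : 'rV[R]_N) p q :
  exists M : R, forall t : X, modc (\sum_j (x 0 j)%:C * t 0 j p q) <= M.
Proof.
exists (\sum_j `|x 0 j| * (2 * d%:R)) => t.
apply: (big_ind2 (fun (u : R[i]) (v : R) => modc u <= v)).
- by rewrite /modc normr0.
- by move=> u v u' v' h h'; apply: le_trans (modcD _ _) _; rewrite lerD.
move=> j _; rewrite modcM modcR ler_wpM2l // -lecR modcE.
have := cubesys_entry n_gt0 j p q (nc_cube t).
by rewrite nc_unit mxtrace1 rmorphM /= !rmorph_nat.
Qed.

Definition cube_realization (x : 'rV[R]_N) : 'M[A]_d := \matrix_(p, q) (Linf
  (cube_realization_subproof x p q) : A).

Lemma cube_realization_eval t x p q : map_mx (linf_eval t) (cube_realization x) p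
  q = \sum_j (x 0 j)%:C * (t : X) 0 j p q.
Proof. by rewrite !mxE. Qed.

Lemma cube_realization_eval_delta (t : X) j : map_mx (linf_eval t)
  (cube_realization (delta_mx 0 j)) = t 0 j.
Proof.
apply/matrixP => p q; rewrite cube_realization_eval (bigD1 j) //= big1 ?addr0 =>
  [|k kj].
  by rewrite mxE !eqxx mul1r.
by rewrite mxE eqxx (negbTE kj) mul0r.
Qed.

(** Positivity at a point [t] is nonnegative pairing with all compressions of [t], and by
    [cubesys_sum] such compressions generate the whole cube system. *)
Lemma dsubhomogeneous_min (S : opsystem R N) : minimal_over (cross_cone R n) S ->
  order_unit S = delta_mx 0 ord0 -> dsubhomogeneous d S.
Proof.
move=> Smin Sunit; exists A, cube_realization.
have ext (P Q : 'M[A]_d) : (forall t, map_mx (linf_eval t) P = map_mx (linf_eval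
  t) Q) -> P = Q.
  move=> PQ; apply/matrixP => p q; apply: linfP => t.
  by have /matrixP/(_ p q) := PQ t; rewrite !mxE.
have psis x : selfadjmx (cube_realization x).
  apply: ext => t; apply/matrixP => p q; rewrite cube_realization_eval !mxE.
  rewrite -[LHS]/((\sum_j (x 0 j)%:C * t 0 j q p)^*) rmorph_sum; apply: eq_bigr
    => j _.
  rewrite rmorphM /= (hermsymmx_conj _ _ ((nc_cube t).1 j)); congr (_ * _).
  by apply/CrealP; rewrite complex_real.
have evalE s (a : 'rV['M[R[i]]_s]_N) (t : X) : map_mx (linf_eval t) (amplify
  cube_realization a) =
    \sum_j tensmx (t 0 j) (a 0 j).
  rewrite map_amplify; last exact: linf_eval_char.
  by apply: eq_bigr => j _; rewrite mxE cube_realization_eval_delta.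
split=> //.
- move=> r x y; apply: ext => t; apply/matrixP => p q; rewrite cube_realization_eval.
  transitivity (r%:C * (\sum_j (x 0 j)%:C * t 0 j p q) + \sum_j (y 0 j)%:C * t 0
    j p q).
    rewrite mulr_sumr -big_split; apply: eq_bigr => j _ /=.
    by rewrite !mxE rmorphD rmorphM mulrDl mulrA.
  by rewrite !mxE.
- rewrite Sunit; apply: ext => t; rewrite cube_realization_eval_delta nc_unit.
  by rewrite map_mx1.
move=> s a s0 ah; rewrite (minimal_cross n_gt0 s0 Smin); split.
  move=> [_ aQ]; apply: linf_posmx; first exact: amplify_selfadj.
  move=> t; rewrite evalE; apply/psdmx_tensP => Y.
  by apply/aQ/cubesys_compress/nc_cube.
move=> apos; split=> // y /cubesys_sum[k [x [v ->]]].
rewrite raddf_sum; apply: sumr_ge0 => i _.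
have := posmx_psdmx (@linf_eval_char R X (x i)) apos.
by rewrite evalE => /psdmx_tensP; apply.
Qed.

End Realization.

(** * The obstruction in dimension three and above *)

Section Obstruction.
Variables (R : realType) (n' d : nat).
Local Notation n := n'.+3.
Local Notation N := n.+1.
Local Notation C := R[i].
Local Notation tup s := 'rV['M[R[i]]_s]_N.

(** From the fourth coordinate on this is the identity, whose trace against [y_i] is at most
    [tr y_0] at once. *)
Definition symm (i : 'I_n) : 'M[C]_d.+1 :=
  match val i with
  | 0 => swap_mx C d false | 1 => swap_mx C d true | 2 => refl_mx C d | _ => 1%:M
  end.

Lemma symm_herm i : (symm i)^t* = symm i.
Proof.
rewrite /symm; case: (val i) => [|[|[|k]]];
  [exact: swap_mx_herm|exact: swap_mx_herm|exact: refl_mx_herm|exact: conjtr1].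
Qed.

Lemma symm_sq i : symm i *m symm i = 1%:M.
Proof.
rewrite /symm; case: (val i) => [|[|[|k]]];
  [exact: swap_mx_sq|exact: swap_mx_sq|exact: refl_mx_sq|exact: mulmx1].
Qed.

(** The entries are real; this absorbs the transpose in the pairing. *)
Lemma symm_tr i : (symm i)^T = symm i.
Proof.
have real b : b \is Num.real -> b^* = b by move=> /CrealP.
rewrite -[RHS]symm_herm; apply/matrixP => k l; rewrite !mxE; apply/esym/CrealP.
rewrite /symm; case: (val i) => [|[|[|m]]]; rewrite mxE.
- by rewrite realn.
- by rewrite realn.
- by rewrite rpredMn //; case: ifP; rewrite ?rpredN rpred1.
by rewrite realn.
Qed.

Definition symm_tup : tup d.+1 :=
  \row_j if unlift ord0 j is Some i then symm i else 1%:M.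

Definition separating_tup (e : C) : tup d.+1 :=
  \row_j if unlift ord0 j is Some i then - symm i else (n%:R - e)%:M.

Lemma symm_tup_cubesys : cubesys symm_tup.
Proof.
split=> [j|i].
  rewrite mxE; case: unliftP => [i _|_]; apply/hermsymmxP; [exact:
    symm_herm|exact: conjtr1].
rewrite !mxE unlift_none liftK.
by split; [apply: involution_psdmx|apply: involutionN_psdmx]; rewrite ?symm_herm
  ?symm_sq.
Qed.

Lemma separating_tup_herm e : e \is Num.real -> hermtuple R N d.+1 (separating_tup e).
Proof.
move=> er j; rewrite mxE; case: unliftP => [i _|_]; apply/hermsymmxP.
  by rewrite conjtrN symm_herm.
rewrite tr_scalar_mx map_scalar_mx /=; congr (_%:M); apply/CrealP.
by rewrite rpredB ?realn.
Qed.

Lemma pairing_separating e (y : tup d.+1) : pairing (separating_tup e) y =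
  (n%:R - e) * \tr (y 0 ord0) - \sum_i \tr (symm i *m y 0 (lift ord0 i)).
Proof.
rewrite /pairing big_ord_recl; congr (_ + _).
  rewrite mulr_sumr; apply: eq_bigr => k _; rewrite (bigD1 k) //= big1 ?addr0 =>
    [|l lk].
    by rewrite mxE unlift_none !mxE eqxx.
  by rewrite mxE unlift_none !mxE eq_sym (negbTE lk) mul0r.
rewrite -sumrN; apply: eq_bigr => i _; rewrite -{1}symm_tr -sumrN exchange_big.
apply: eq_bigr => l _; rewrite !mxE -sumrN; apply: eq_bigr => k _.
by rewrite !mxE liftK !mxE mulNr.
Qed.

Lemma pairing_separating_symm e : 0 < e -> pairing (separating_tup e) symm_tup < 0.
Proof.
move=> e0; rewrite pairing_separating mxE unlift_none mxtrace1.
under eq_bigr => i _ do rewrite mxE liftK symm_sq mxtrace1.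
rewrite sumr_const card_ord -[X in _ - X]mulr_natl mulrBl addrAC subrr sub0r oppr_lt0.
by rewrite mulr_gt0 // ltr0n.
Qed.

Lemma separating_tup_ge0 : exists2 e : C, 0 < e &
  forall (x : tup d) (X : 'M[C]_(d, d.+1)), cubesys x ->
    0 <= pairing (separating_tup e) (compress X x).
Proof.
have [e e0 eP] := deficit_lower_bound C d; exists e => // x X xQ.
have yQ := cubesys_compress X xQ; set y := compress X x in yQ *.
(* [X] has [d] rows and [d + 1] columns, so it kills a nonzero vector, and so does [y_0]. *)
have [z z0 Xz] : exists2 z : 'cV[C]_d.+1, z != 0 & X *m z = 0.
  have : kermx X^T != 0.
    rewrite kermx_eq0 /row_free neq_ltn; apply/orP; left.
    by rewrite ltnS mxrank_tr rank_leq_row.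
  move=> /rowV0Pn[w /sub_kermxP wX w0]; exists w^T.
    by rewrite -(inj_eq trmx_inj) trmxK trmx0.
  by apply: trmx_inj; rewrite trmx_mul trmxK wX trmx0.
have yz : y 0 ord0 *m z = 0 by rewrite /y [compress X x 0 ord0]mxE -!mulmxA Xz
  !mulmx0.
have [_ yP] := yQ.
rewrite pairing_separating 3!big_ord_recl /= subr_ge0.
set i0 := (lift ord0 ord0 : 'I_N); set i1 := lift ord0 (lift ord0 ord0).
have := eP _ (y 0 (lift ord0 ord0)) (y 0 (lift ord0 (lift ord0 ord0)))
  (y 0 (lift ord0 (lift ord0 (lift ord0 ord0)))) (ex_intro2 _ _ z z0 yz)
  (yP _).1 (yP _).2 (yP _).1 (yP _).2 (yP _).1 (yP _).2.
have rest : \sum_(i < n') \tr (symm (lift ord0 (lift ord0 (lift ord0 i))) *m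
    y 0 (lift ord0 (lift ord0 (lift ord0 (lift ord0 i))))) <= n'%:R * \tr (y 0 ord0).
  rewrite mulr_natl -[n' in _ *+ n'](card_ord n') -sumr_const; apply: ler_sum => i _.
  by rewrite /symm /= mul1mx; apply: deficit_trace1; have [] := yP (lift ord0
    (lift ord0 (lift ord0 i))).
(* [n - e] splits as [3 - e] for the first three coordinates and [n'] for the rest. *)
move=> h; rewrite !addrA; apply: le_trans (lerD h rest) _.
rewrite -mulrDl le_eqVlt; apply/orP; left; apply/eqP; congr (_ * _).
by rewrite -[n]addn3 natrD; ring.
Qed.

Hypothesis d_gt0 : (0 < d)%N.

Lemma max_not_dminimal (S : opsystem R N) :
  maximal_over (cube_cone R n) S -> ~ dminimal d S.
Proof.
move=> Smax Sd; have [e e0 eP] := separating_tup_ge0.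
have : S d.+1 symm_tup by rewrite (maximal_cube _ _ Smax) //; apply: symm_tup_cubesys.
rewrite (Sd d.+1 isT) => -[k [x [v [xS E]]]].
have := pairing_separating_symm e0; rewrite E raddf_sum => h.
have : 0 <= \sum_i pairing (separating_tup e) (compress (v i) (x i)).
  apply: sumr_ge0 => i _; apply: eP.
  by have := xS i; rewrite (maximal_cube _ d_gt0 Smax).
by move=> /le_lt_trans /(_ h); rewrite ltxx.
Qed.

Lemma min_not_dsubhomogeneous (S : opsystem R N) :
  minimal_over (cross_cone R n) S -> order_unit S = delta_mx 0 ord0 -> ~
    dsubhomogeneous d S.
Proof.
move=> Smin Sunit [A [psi [_ psis psi1 psiP]]]; have [e e0 eP] := separating_tup_ge0.
have eh : hermtuple R N d.+1 (separating_tup e).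
  by apply: separating_tup_herm; rewrite gtr0_real.
have : S d.+1 (separating_tup e).
  apply/psiP => //; apply: psdmx_posmx; first exact: amplify_selfadj.
  move=> chi chiP; rewrite map_amplify //; apply/psdmx_tensP => X; apply: eP.
  set x := \row_k _; have xj j : x 0 j = map_mx chi (psi (delta_mx 0 j)) by
    rewrite mxE.
  (* The vertices lie in [S], hence are positive in the realization, and [chi] preserves positivity;
     this puts [x] in the cube system. *)
  have xvert (b : bool) i : psdmx (x 0 ord0 + (-1) ^+ b *: x 0 (lift ord0 i)).
    have Sv : S 1%N (scalar_tup (vertex R b i)).
      suff : first_level S (vertex R b i) by [].
      by rewrite Smin.1; apply: cross_cone_vertex.
    have := posmx_psdmx chiP ((psiP 1%N _ isT (scalar_tup_herm _)).1 Sv).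
    rewrite map_amplify // -/x => /psdmx_tensP h v.
    by rewrite -[v]trmxK -pairing_vertex -pairing_compress pairingC; apply: h.
  split=> [j|i].
    rewrite xj; apply/hermsymmxP; rewrite -[in RHS](psis (delta_mx 0 j)).
    by apply/matrixP => p q; rewrite !mxE chiP.2.
  split; first by have := xvert false i; rewrite expr0 scale1r.
  by have := xvert true i; rewrite expr1 scaleN1r.
rewrite (minimal_cross _ _ Smin) // => -[_ /(_ _ symm_tup_cubesys)].
by move=> /le_lt_trans /(_ (pairing_separating_symm e0)); rewrite ltxx.
Qed.

End Obstruction.

Theorem theorem6p1 (R : realType) (n : nat) (n_ge1 : (1 <= n)%N)
    (Qmax Cmin : opsystem R n.+1)
    (Qmax_max : maximal_over (cube_cone R n) Qmax)
    (Qmax_unit : order_unit Qmax = delta_mx 0 ord0)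
    (Cmin_min : minimal_over (cross_cone R n) Cmin)
    (Cmin_unit : order_unit Cmin = delta_mx 0 ord0) :
  [/\ n = 1%N -> dminimal 1 Qmax /\ dsubhomogeneous 1 Cmin,
      n = 2%N -> dminimal 2 Qmax /\ dsubhomogeneous 2 Cmin
    & (3 <= n)%N -> forall d : nat, (0 < d)%N ->
        ~ dminimal d Qmax /\ ~ dsubhomogeneous d Cmin].
Proof.
split=> [n1|n2|].
- subst n; have dil s (y : 'rV['M[R[i]]_s]_2) : cubesys y ->
      dilation (ncube (n := 1) (d := 1)) (fun j => y 0 j).
    by move=> [_ yP]; apply: dilation_segment.
  by split; [apply: (dminimal_max n_ge1) | apply: (dsubhomogeneous_min n_ge1)].
- subst n; have dil s (y : 'rV['M[R[i]]_s]_3) : cubesys y ->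
      dilation (ncube (n := 2) (d := 2)) (fun j => y 0 j).
    by move=> yQ; apply: dilation_square; [apply: (cubesys_psd0 n_ge1) | apply: yQ.2].
  by split; [apply: (dminimal_max n_ge1) | apply: (dsubhomogeneous_min n_ge1)].
move=> n3 d d0; case: n n3 n_ge1 Qmax Qmax_max Qmax_unit Cmin Cmin_min Cmin_unit
  => [|[|[|n]]] //.
move=> _ _ Qmax Qmax_max _ Cmin Cmin_min Cmin_unit.
by split; [apply: max_not_dminimal | apply: min_not_dsubhomogeneous].
Qed.
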